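(* Let $\epsilon\in(0,1)$ and $\overline\sigma\ge1$, and let $B_0\subset\mathbb{X}\times\mathbb{Z}\times\mathbb{Z}$ be a compact set. Suppose that the sequences $\{x^k\}_{k\in\mathbb{N}}$ and $\{\rho_k\}_{k\in\mathbb{N}}$ generated by Algorithm 1 are bounded, that $\mathcal{S}\ne\emptyset$, and that there exist $a_{\min}>0$ and $b_{\min}>0$ such that the parameters in Algorithm 1 satisfy $a_k\ge a_{\min}$ and $b_k\ge b_{\min}$ for all $k\in\mathbb{N}$. (i) If Algorithm B with $\sigma_k\in[\overline\sigma^{-1},\overline\sigma]$ and $\overline w^{k,0}\in B_0$ (for all $k$) is used as the inner solver, then Algorithm 1 computes an $\epsilon$-stationary point of (P) in at most $O(\epsilon^{-4})$ oracle calls. (ii) If Algorithm A with $\sigma_k\in[\overline\sigma^{-1},\overline\sigma]$ and $w^{k,0}\in B_0$ (for all $k$) is used as the inner solver, and there is a constant $c_{\mathcal R}>0$, independent of $k$ and $l$, such that $\mathrm{dist}(w^{k,l},\mathcal{R}_k^{-1}(0))\le c_{\mathcal R}\|\mathcal{R}_k(w^{k,l})\|$ for all $k\in\mathbb{N}$ and all integers $l\ge1$, then Algorithm 1 computes an $\epsilon$-stationary point of (P) in at most $O(\epsilon^{-2}\log\epsilon^{-1})$ oracle calls. Here an oracle call is an evaluation of one of the mappings $g'(x^k)(\cdot)$, $\nabla g(x^k)(\cdot)$, $\mathcal{P}_{\sigma_k^{-1}\psi_{\rho_k}}(\cdot)$ (proximal mapping) and $\mathcal{P}_{T_{x^k}\mathcal{M}}(\cdot)$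 (projection) by the inner solver; the count is the total over all outer iterations up to the first one at which Algorithm 1 returns an $\epsilon$-stationary point, and the constants hidden in $O(\cdot)$ do not depend on $\epsilon$.
   Context: **Problem.** $\mathbb{X},\mathbb{Y}$ are finite-dimensional real Euclidean spaces (inner product $\langle\cdot,\cdot\rangle$, induced norm $\|\cdot\|$); $\mathbb{Z}:=\mathbb{X}\times\mathbb{Y}$ with $\|(z_1;z_2)\|:=(\|z_1\|^2+\|z_2\|^2)^{1/2}$. $\mathcal{M}\subset\mathbb{X}$ is a closed $\mathcal{C}^1$-embedded submanifold, with tangent and normal spaces $T_x\mathcal{M},N_x\mathcal{M}$; $K\subset\mathbb{Y}$ is closed and convex. $\mathcal{P}_C$ is the Euclidean projection onto a set $C$; for a closed proper function $\varphi$ and $\gamma>0$, $\mathcal{P}_{\gamma\varphi}(\cdot):=\arg\min_{x'}\{\varphi(x')+\frac{1}{2\gamma}\|x'-\cdot\|^2\}$. $\mathcal{N}_K$ is the normal cone; $\partial$ the limiting subdifferential; $\nabla g(x)$ the adjoint of $g'(x)$. $|||\cdot|||$ is a fixed norm on $\mathbb{Y}$ and $\mathrm{dist}(y,K):=\inf_{u\in K}|||y-u|||$. Problem (P): minimize $\Theta(x):=f(x)+\vartheta(x)-h(x)$ over $x\in g^{-1}(K)\cap\mathcal{M}$. Standing assumptions: $f,\vartheta,h:\mathbb{X}\to\mathbb{R}$, $g:\mathbb{X}\to\mathbb{Y}$; $f$ is differentiable with locally Lipschitz gradient and $g$ is differentiable with locally Lipschitz Jacobian on an open convex set $\mathcal{O}\supset\mathcal{M}$;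 $\vartheta,h$ are convex; $g^{-1}(K)\cap\mathcal{M}\ne\emptyset$. Penalty function: $\Theta_\rho(x):=\Theta(x)+\rho\,\mathrm{dist}(g(x),K)$. **$\epsilon$-stationary point of (P):** a point $x\in\mathcal{M}$ for which there exist $z\in\mathbb{X}$, $y\in K$, $\zeta\in\partial(-h)(x)$, $\xi_1\in\partial\vartheta(z)$, $\xi_2\in\mathcal{N}_K(y)$ with $\|x-z\|\le\epsilon$, $\|g(x)-y\|\le\epsilon$, $\|\mathcal{P}_{T_x\mathcal{M}}[\nabla f(x)+\zeta+\xi_1+\nabla g(x)\xi_2]\|\le\epsilon$. **Subproblem data at iteration $k$.** For $x^k\in\mathcal{M}$, $\zeta^k\in\partial(-h)(x^k)$, $\rho_k,\beta_k>0$: $\ell_k(v):=\langle\nabla f(x^k)+\zeta^k,v\rangle+f(x^k)-h(x^k)$; $G(x,v):=(x+v;\,g(x)+g'(x)v)$, with $\nabla_vG(x,v)(\xi_1;\xi_2)=\xi_1+\nabla g(x)\xi_2$; $\psi_\rho(z):=\vartheta(z_1)+\rho\,\mathrm{dist}(z_2,K)$; $\widehat\Theta_{\rho_k}(x^k+v;x^k):=\ell_k(v)+\psi_{\rho_k}(G(x^k,v))+\frac{\beta_k}{2}\|v\|^2$. The subproblem is (Sub$_k$) $\min_{v\in\mathbb{X},z\in\mathbb{Z}}\ \ell_k(v)+\psi_{\rho_k}(z)+\delta_{T_{x^k}\mathcal{M}}(v)+\frac{\beta_k}{2}\|v\|^2$ s.t. $G(x^k,v)-z=0$. For a triple $(v^k,z^k,\xi^k)\in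 T_{x^k}\mathcal{M}\times\mathbb{Z}\times\partial\psi_{\rho_k}(z^k)$ let $p^k:=\mathcal{P}_{T_{x^k}\mathcal{M}}(\nabla\ell_k(v^k)+\beta_kv^k+\nabla_vG(x^k,v^k)\xi^k)$ and consider (I1) $\max\{\|G(x^k,v^k)-z^k\|,\|p^k\|,\|\beta_kv^k\|\}\le\varepsilon_k$; (D) $\widehat\Theta_{\rho_k}(x^k+v^k;x^k)<\Theta_{\rho_k}(x^k)$; (I2) $\|G(x^k,v^k)-z^k\|\le a_k\|v^k\|^2$ and $\|p^k\|\le b_k\|v^k\|$. **Algorithm 1.** Input: a retraction $R$ on $\mathcal{M}$ (a smooth $R:T\mathcal{M}\to\mathcal{M}$ with $R_x:=R(x,\cdot)$, $R_x(0)=x$, $R_x'(0)=\mathrm{id}$), $\rho_0>0$, $0<\beta_{\min}<\beta_0$, $a_{\max},b_{\max}>0$, $\tau>1$, $\varepsilon_0>0$, $\varsigma\in(0,1)$, $0<\eta_1<\eta_2<1$, $\overline\gamma>0$, $0<\sigma_2<1<\sigma_1$, $x^0\in\mathcal{M}$. For $k=0,1,2,\dots$: Step 3: choose $\zeta^k\in\partial(-h)(x^k)$. Step 4: choose $a_k\in(0,a_{\max}]$, $b_k\in(0,b_{\max}]$ and find, by running the inner solver on (Sub$_k$), a triple $(v^k,z^k,\xi^k)\in T_{x^k}\mathcal{M}\times\mathbb{Z}\times\partial\psi_{\rho_k}(z^k)$ satisfying either (I1) or both (D) and (I2). If (I1) holds go to Step 5, else to Step 6. Step 5: if $\max\{\varepsilon_k,\mathrm{dist}(z_2^k,K)\}=0$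 stop. Otherwise $x^{k+1}:=x^k$, $\beta_{k+1}:=\beta_k$, $\varepsilon_{k+1}:=\varsigma\varepsilon_k$, $\rho_{k+1}:=\rho_k$ if $\mathrm{dist}(z_2^k,K)\le\varepsilon_k$ and $\rho_{k+1}:=\tau\rho_k$ otherwise; next iteration. Step 6: if $\max\{\|v^k\|,\mathrm{dist}(z_2^k,K)\}=0$ stop. Otherwise let $\mathrm{ared}_k:=\Theta_{\rho_k}(x^k)-\Theta_{\rho_k}(R_{x^k}(v^k))$, $\mathrm{pred}_k:=\Theta_{\rho_k}(x^k)-\widehat\Theta_{\rho_k}(x^k+v^k;x^k)$, $r_k:=\mathrm{ared}_k/\mathrm{pred}_k$. If $r_k<\eta_1$ or $\mathrm{pred}_k<\overline\gamma\|v^k\|^2$: $x^{k+1}:=x^k$, $\beta_{k+1}:=\sigma_1\beta_k$, $\rho_{k+1}:=\rho_k$; next iteration. Otherwise (successful iteration) $x^{k+1}:=R_{x^k}(v^k)$, $\beta_{k+1}:=\beta_k$ if $r_k<\eta_2$ and $\beta_{k+1}:=\max\{\sigma_2\beta_k,\beta_{\min}\}$ otherwise. Step 7: $\rho_{k+1}:=\tau\rho_k$ if $\max\{\rho_k,[\mathrm{dist}(z_2^k,K)]^{-1}\}<\beta_k^{-1}\|v^k\|^{-1}$, and $\rho_{k+1}:=\rho_k$ otherwise. ($\varepsilon_k$ changes only in Step 5.) $\mathcal{S}$ denotes the set of successful iterations. **Inner solvers.** $\mathcal{A}_k:\mathbb{X}\to\mathbb{Z}$ is the (constant) Jacobian of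 $G(x^k,\cdot)$, i.e. $\mathcal{A}_kv=(v;g'(x^k)v)$; $\mathcal{L}_{\sigma}(v,z,\lambda):=\ell_k(v)+\frac{\beta_k}{2}\|v\|^2+\delta_{T_{x^k}\mathcal{M}}(v)+\psi_{\rho_k}(z)+\langle\lambda,G(x^k,v)-z\rangle+\frac{\sigma}{2}\|G(x^k,v)-z\|^2$; $\gamma_k:=\sigma_k\|\mathcal{A}_k\|^2$; $\|u\|_{\mathcal Q}:=\sqrt{\langle u,\mathcal{Q}u\rangle}$. *Algorithm A (semi-proximal ADMM):* from $w^{k,0}=(v^{k,0},z^{k,0},\lambda^{k,0})\in T_{x^k}\mathcal{M}\times\mathbb{Z}\times\mathbb{Z}$, for $l=0,1,\dots$: $v^{k,l+1}:=\arg\min_v\mathcal{L}_{\sigma_k}(v,z^{k,l},\lambda^{k,l})+\frac12\|v-v^{k,l}\|^2_{\gamma_k\mathcal{I}-\sigma_k\mathcal{A}_k^*\mathcal{A}_k}$; $z^{k,l+1}:=\arg\min_z\mathcal{L}_{\sigma_k}(v^{k,l+1},z,\lambda^{k,l})$; $\lambda^{k,l+1}:=\lambda^{k,l}+\sigma_k(G(x^k,v^{k,l+1})-z^{k,l+1})$. *Algorithm B (accelerated semi-proximal ADMM):* parameters $\alpha\ge2$, $\varrho\in(0,2]$; from $\overline w^{k,0}=(\overline v^{k,0},\overline z^{k,0},\overline\lambda^{k,0})\in T_{x^k}\mathcal{M}\times\mathbb{Z}\times\mathbb{Z}$, $\widehat w^{k,0}:=\overline w^{k,0}$, for $l=0,1,\dots$: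 $z^{k,l}:=\arg\min_z\mathcal{L}_{\sigma_k}(\overline v^{k,l},z,\overline\lambda^{k,l})$; $\lambda^{k,l}:=\overline\lambda^{k,l}+\sigma_k(G(x^k,\overline v^{k,l})-z^{k,l})$; $v^{k,l}:=\arg\min_v\mathcal{L}_{\sigma_k}(v,z^{k,l},\lambda^{k,l})+\frac12\|v-\overline v^{k,l}\|^2_{\gamma_k\mathcal{I}-\sigma_k\mathcal{A}_k^*\mathcal{A}_k}$; $\widehat w^{k,l+1}:=(1-\varrho)\overline w^{k,l}+\varrho w^{k,l}$; $\overline w^{k,l+1}:=\overline w^{k,l}+\frac{\alpha}{2(l+\alpha)}(\widehat w^{k,l+1}-\overline w^{k,l})+\frac{l}{l+\alpha}(\widehat w^{k,l+1}-\widehat w^{k,l})$. In both, $w^{k,l}:=(v^{k,l},z^{k,l},\lambda^{k,l})$, and the inner solver is stopped once the triple $(v^k,z^k,\xi^k):=(v^{k,l},z^{k,l},\lambda^{k,l})$ satisfies (I1) or both (D) and (I2). **KKT residual.** For $w=(v,z,\lambda)$, $$\mathcal{R}_k(w):=\begin{pmatrix}v-\mathcal{P}_{T_{x^k}\mathcal{M}}[v-\nabla\ell_k(v)-\beta_kv-\nabla_vG(x^k,v)\lambda]\\ z-\mathcal{P}_{\psi_{\rho_k}}(z+\lambda)\\ z-G(x^k,v)\end{pmatrix},$$ and $\mathrm{dist}(\cdot,\mathcal{R}_k^{-1}(0))$ is the Euclidean distance. *)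

(* Defs.v *)
From HB Require Import structures.
From mathcomp Require Import all_boot all_order all_algebra.
From mathcomp Require Import all_classical all_reals all_analysis.

Set Implicit Arguments.
Unset Strict Implicit.
Unset Printing Implicit Defensive.

Import Order.TTheory GRing.Theory Num.Theory.
Import numFieldNormedType.Exports.

Local Open Scope classical_set_scope.
Local Open Scope ring_scope.

(* A Euclidean structure on a normed module: an inner product together with    *)
(* finite dimensionality. The library norm `|x| is not required to be the      *)
(* Euclidean norm [enorm]: in finite dimension all norms are equivalent, so    *)
(* limits, open sets, compactness and differentials are the same, and the      *)
(* library product X * Y (whose norm is the max) can carry the product inner   *)
(* product. Every metric quantity below is measured by [enorm].                *)
Record euclidean (R : realType) (V : normedModType R) := Euclidean {
  inner : V -> V -> R ;
  innerC : forall u v, inner u v = inner v u ;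
  innerDl : forall u v w, inner (u + v) w = inner u w + inner v w ;
  innerZl : forall a u v, inner (a *: u) v = a * inner u v ;
  inner_gt0 : forall u, u != 0 -> 0 < inner u u ;
  euclidean_findim : exists (n : nat) (e : 'I_n -> V),
    forall u, exists c : 'I_n -> R, u = \sum_i c i *: e i }.

Section product.
Context {R : realType} {V W : normedModType R}.
Variables (eV : euclidean V) (eW : euclidean W).

Definition prod_inner (p q : (V * W)%type) : R :=
  inner eV p.1 q.1 + inner eW p.2 q.2.

Fact prod_innerC p q : prod_inner p q = prod_inner q p.
Proof. by rewrite /prod_inner innerC [X in _ + X]innerC. Qed.

Fact prod_innerDl p q r :
  prod_inner (p + q) r = prod_inner p r + prod_inner q r.
Proof. by rewrite /prod_inner !innerDl addrACA. Qed.

Fact prod_innerZl a p q : prod_inner (a *: p) q = a * prod_inner p q.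
Proof. by rewrite /prod_inner !innerZl mulrDr. Qed.

Fact prod_inner_gt0 p : p != 0 -> 0 < prod_inner p p.
Proof.
have ge0 (U : normedModType R) (eU : euclidean U) u : 0 <= inner eU u u.
  have [->|u0] := eqVneq u 0; last exact/ltW/inner_gt0.
  by rewrite -[X in inner eU X _](scale0r 0) innerZl mul0r.
case: p => u v; rewrite /prod_inner /=; have [->|u0 _] := eqVneq u 0.
  have [->|v0 _] := eqVneq v 0; first by rewrite eqxx.
  by rewrite ltr_wpDl ?ge0 ?inner_gt0.
by rewrite ltr_pwDl ?ge0 ?inner_gt0.
Qed.

Fact prod_findim : exists (n : nat) (e : 'I_n -> (V * W)%type),
  forall u, exists c : 'I_n -> R, u = \sum_i c i *: e i.
Proof.
have [m [e1 E1]] := euclidean_findim eV.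
have [n [e2 E2]] := euclidean_findim eW.
exists (m + n)%N, (fun k : 'I_(m + n) =>
  match fintype.split k with inl i => (e1 i, 0) | inr j => (0, e2 j) end).
move=> [u v]; have [c1 ->] := E1 u; have [c2 ->] := E2 v.
exists (fun k : 'I_(m + n) => match fintype.split k with inl i => c1 i | inr j => c2 j end).
have splitl i : fintype.split (lshift n i) = inl i := unsplitK (inl i).
have splitr i : fintype.split (rshift m i) = inr i := unsplitK (inr i).
symmetry; rewrite big_split_ord /=.
under eq_bigr => i _ do rewrite splitl.
under [X in _ + X]eq_bigr => i _ do rewrite splitr.
have sumE I (s : seq I) (F : I -> (V * W)%type) :
    \sum_(i <- s) F i = (\sum_(i <- s) (F i).1, \sum_(i <- s) (F i).2).
  elim: s => [|i s IH]; first by rewrite !big_nil.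
  by rewrite !big_cons IH.
rewrite !sumE; congr pair => /=.
  by rewrite [X in _ + X]big1 ?addr0 // => i _; rewrite scaler0.
by rewrite [X in X + _]big1 ?add0r // => i _; rewrite scaler0.
Qed.

Definition prod_euclidean : euclidean (V * W)%type :=
  Euclidean prod_innerC prod_innerDl prod_innerZl prod_inner_gt0 prod_findim.

End product.

Section euclidean_theory.
Context {R : realType}.
Implicit Types V W : normedModType R.

Definition enorm V (eV : euclidean V) (u : V) : R := Num.sqrt (inner eV u u).

Definition adjoint V W (eV : euclidean V) (eW : euclidean W) (L : V -> W)
    (y : W) : V :=
  xget 0 [set u | forall v, inner eV u v = inner eW y (L v)].

Definition opnorm V W (eV : euclidean V) (eW : euclidean W) (L : V -> W) : R :=
  sup [set enorm eW (L v) | v in [set v | enorm eV v <= 1]].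

(* The library's differential needs a normed module as codomain: R^o. *)
Definition grad V (eV : euclidean V) (f : V -> R) (x : V) : V :=
  xget 0 [set u | forall v, inner eV u v = 'd (f : V -> R^o) x v].

Definition is_argmin (T : Type) (D : set T) (F : T -> R) (u : T) :=
  D u /\ forall u', D u' -> F u <= F u'.

Definition proj V (eV : euclidean V) (C : set V) (u : V) : V :=
  xget 0 (is_argmin C (fun u' => enorm eV (u - u'))).

Definition prox V (eV : euclidean V) (gamma : R) (phi : V -> R) (u : V) : V :=
  xget 0 (is_argmin setT
    (fun u' => phi u' + (2 * gamma)^-1 * enorm eV (u' - u) ^+ 2)).

Definition wnorm V (eV : euclidean V) (Q : V -> V) (u : V) : R :=
  Num.sqrt (inner eV u (Q u)).

(* Distance to a possibly empty set, with the convention dist(., set0) = +oo. *)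
Definition edist V (eV : euclidean V) (S : set V) (u : V) : \bar R :=
  ereal_inf [set (enorm eV (u - u'))%:E | u' in S].

Definition is_norm V (N : V -> R) :=
  [/\ forall u v, N (u + v) <= N u + N v,
      forall a u, N (a *: u) = `|a| * N u
    & forall u, N u = 0 -> u = 0].

Definition normal_cone V (eV : euclidean V) (K : set V) (y xi : V) :=
  K y /\ forall u, K u -> inner eV xi (u - y) <= 0.

(* Regular (Frechet) subgradients: the o(|y - x|) lower bound. *)
Definition regular_subdiff V (eV : euclidean V) (phi : V -> R) (x zeta : V) :=
  forall e : R, 0 < e -> \forall y \near x,
    phi x + inner eV zeta (y - x) - e * enorm eV (y - x) <= phi y.

Definition limiting_subdiff V (eV : euclidean V) (phi : V -> R) (x zeta : V) :=
  exists (xs zs : nat -> V),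
    [/\ xs @ \oo --> x,
        (fun n => phi (xs n)) @ \oo --> phi x,
        zs @ \oo --> zeta
      & forall n, regular_subdiff eV phi (xs n) (zs n)].

(* In finite dimension, continuity of all partial maps y |-> 'd F y w is       *)
(* continuity of the derivative, so this is the class C^n on the open set U.   *)
Fixpoint Cn (n : nat) V W (U : set V) (F : V -> W) : Prop :=
  match n with
  | 0 => forall y, U y -> {for y, continuous F}
  | n'.+1 => (forall y, U y -> differentiable F y) /\
             forall w, Cn n' U (fun y => 'd F y w)
  end.

(* C^1-embedded submanifold, given locally as the zero set of a C^1            *)
(* submersion onto R^c, where c is the codimension.                            *)
Definition C1_submanifold V (M : set V) := exists c : nat,
  forall x, M x -> exists (U : set V) (F : V -> 'rV[R]_c),
    [/\ open U, U x, Cn 1 U F,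
        forall y, U y -> forall w, exists v, 'd F y v = w
      & forall y, U y -> (M y <-> F y = 0)].

Definition tangent V (M : set V) (x : V) : set V :=
  [set v | exists (c : R^o -> V) (e : R),
    [/\ 0 < e, Cn 1 [set t : R^o | `|t| < e] c,
        forall t : R^o, `|t| < e -> M (c t),
        c 0 = x & 'd c 0 (1 : R^o) = v]].

(* [r x v] stands for R_x(v); only its values on the tangent bundle matter.    *)
(* The tangent bundle is a subset of V * V, on which a map is smooth when it   *)
(* has a C^oo extension near each point. As R_x is defined on the tangent      *)
(* space only, R_x'(0) = id is read along the lines t |-> t v.                 *)
Definition retraction V (M : set V) (r : V -> V -> V) :=
  [/\ forall x v, M x -> tangent M x v -> M (r x v),
      forall x v, M x -> tangent M x v ->
        exists (U : set (V * V)%type) (F : (V * V)%type -> V),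
          [/\ open U, U (x, v), forall n, Cn n U F
            & forall y w, U (y, w) -> M y -> tangent M y w ->
                F (y, w) = r y w],
      forall x, M x -> r x 0 = x
    & forall x v, M x -> tangent M x v ->
        is_derive (0 : R^o) (1 : R^o) (fun t : R^o => r x (t *: v)) v].

End euclidean_theory.

(* [tnorm] is the fixed norm |||.||| on Y, [dom] the open convex set on which  *)
(* f and g are differentiable, and [th] the convex term vartheta.              *)
Record problem (R : realType) (X Y : normedModType R) := Problem {
  eX : euclidean X ; eY : euclidean Y ;
  M : set X ; K : set Y ; dom : set X ; tnorm : Y -> R ;
  f : X -> R ; th : X -> R ; h : X -> R ; g : X -> Y }.

Record params (R : realType) (X : normedModType R) := Params {
  retr : X -> X -> X ; x0 : X ;
  rho0 : R ; beta_min : R ; beta0 : R ; a_max : R ; b_max : R ; tau : R ;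
  eps0 : R ; varsigma : R ; eta1 : R ; eta2 : R ; gbar : R ;
  sg1 : R ; sg2 : R }.

Record subproblem (R : realType) (X : normedModType R) := Subproblem {
  sx : X ; szeta : X ; srho : R ; sbeta : R }.

(* A record of an execution. [tout k l] is the triple produced by pass l       *)
(* (l = 0, 1, ...) of the loop of the inner solver in outer iteration k.       *)
(* Only the entries at outer iterations that are [reached] are meaningful.     *)
Record trace (R : realType) (X Y : normedModType R) := Trace {
  tx : nat -> X ; tzeta : nat -> X ;
  trho : nat -> R ; tbeta : nat -> R ; teps : nat -> R ;
  ta : nat -> R ; tb : nat -> R ; tsigma : nat -> R ;
  tout : nat -> nat -> (X * (X * Y) * (X * Y))%type }.

Variant oracle_call (X Y : Type) :=
  | JacCall of X           (* g'(x^k)(.) *)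
  | AdjCall of Y           (* nabla g(x^k)(.) *)
  | ProxCall of (X * Y)    (* proximal mapping of sigma_k^-1 psi_(rho_k) *)
  | ProjCall of X.         (* projection onto the tangent space at x^k *)
Arguments JacCall {X Y}.
Arguments AdjCall {X Y}.
Arguments ProxCall {X Y}.
Arguments ProjCall {X Y}.

Section problem_theory.
Context {R : realType} {X Y : normedModType R}.
Variable P : problem X Y.

Local Notation Z := (X * Y)%type.
Local Notation W := (X * Z * Z)%type.
Local Notation "<< u , v >>X" := (inner (eX P) u v).
Local Notation normX := (enorm (eX P)).
Local Notation normY := (enorm (eY P)).

Definition eZ : euclidean Z := prod_euclidean (eX P) (eY P).
Definition eW : euclidean W := prod_euclidean (prod_euclidean (eX P) eZ) eZ.

Definition jac (x : X) : X -> Y := 'd (g P) x.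
Definition adjg (x : X) : Y -> X := adjoint (eX P) (eY P) (jac x).
Definition gradf (x : X) : X := grad (eX P) (f P) x.
Definition projT (x : X) : X -> X := proj (eX P) (tangent (M P) x).

Definition dist (y : Y) : R := inf [set tnorm P (y - u) | u in K P].
Definition Theta (x : X) : R := f P x + th P x - h P x.
Definition Theta_pen (rho : R) (x : X) : R := Theta x + rho * dist (g P x).

Definition standing_assumptions :=
  [/\ C1_submanifold (M P) /\ closed (M P),
      closed (K P) /\ convex_set (K P : set (convex_lmodType Y)),
      is_norm (tnorm P),
      [/\ open (dom P), convex_set (dom P : set (convex_lmodType X)),
          M P `<=` dom P,
          forall x, dom P x -> differentiable (f P : X -> R^o) x
        & forall x, dom P x -> differentiable (g P) x] /\
      (forall x, dom P x -> exists L : R, \forall y \near x & y' \near x,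
          dom P y -> dom P y' ->
          normX (gradf y - gradf y') <= L * normX (y - y') /\
          opnorm (eX P) (eY P) (fun v => jac y v - jac y' v)
            <= L * normX (y - y'))
    & [/\ convex_function (setT : set (convex_lmodType X)) (th P),
          convex_function (setT : set (convex_lmodType X)) (h P)
        & exists x, K P (g P x) /\ M P x]].

Definition subdiff_mh : X -> X -> Prop :=
  limiting_subdiff (eX P) (fun x => - h P x).

Definition eps_stationary (eps : R) (x : X) :=
  M P x /\ exists (z zeta xi1 : X) (y xi2 : Y),
    [/\ K P y,
        [/\ subdiff_mh x zeta, limiting_subdiff (eX P) (th P) z xi1
          & normal_cone (eY P) (K P) y xi2],
        normX (x - z) <= eps, normY (g P x - y) <= eps
      & normX (projT x (gradf x + zeta + xi1 + adjg x xi2)) <= eps].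

Definition valid_params (p : params X) :=
  [/\ retraction (M P) (retr p) /\ M P (x0 p),
      [/\ 0 < rho0 p, 0 < beta_min p < beta0 p, 0 < a_max p & 0 < b_max p],
      [/\ 1 < tau p, 0 < eps0 p & 0 < varsigma p < 1]
    & [/\ 0 < eta1 p, eta1 p < eta2 p, eta2 p < 1, 0 < gbar p
        & 0 < sg2 p < 1 /\ 1 < sg1 p]].

Section subproblem.
Variable s : subproblem X.
Local Notation x := (sx s).
Local Notation T := (tangent (M P) x).

(* gradient of the affine function [ell] *)
Definition gradell : X := gradf x + szeta s.
Definition ell (v : X) : R := << gradell, v >>X + f P x - h P x.
Definition G (v : X) : Z := (x + v, g P x + jac x v).
Definition gradG (xi : Z) : X := xi.1 + adjg x xi.2.
Definition opA (v : X) : Z := (v, jac x v).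
Definition psi (z : Z) : R := th P z.1 + srho s * dist z.2.
Definition Theta_hat (v : X) : R :=
  ell v + psi (G v) + sbeta s / 2 * normX v ^+ 2.

Definition stat_vec (v : X) (xi : Z) : X :=
  projT x (gradell + sbeta s *: v + gradG xi).

Definition cond_I1 (eps : R) (w : W) : bool :=
  let: (v, z, xi) := w in
  Num.max (Num.max (enorm eZ (G v - z)) (normX (stat_vec v xi)))
    (normX (sbeta s *: v)) <= eps.

Definition cond_D (w : W) : bool := Theta_hat w.1.1 < Theta_pen (srho s) x.

Definition cond_I2 (a b : R) (w : W) : bool :=
  let: (v, z, xi) := w in
  (enorm eZ (G v - z) <= a * normX v ^+ 2)
    && (normX (stat_vec v xi) <= b * normX v).

Definition inner_accept (eps a b : R) (w : W) : Prop :=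
  let: (v, z, xi) := w in
  [/\ T v, limiting_subdiff eZ psi z xi
    & cond_I1 eps w || (cond_D w && cond_I2 a b w)].

(* The augmented Lagrangian without the indicator of the tangent space, which  *)
(* is the feasible set of the v-updates.                                       *)
Definition augL (sigma : R) (v : X) (z lam : Z) : R :=
  ell v + sbeta s / 2 * normX v ^+ 2 + psi z + inner eZ lam (G v - z)
  + sigma / 2 * enorm eZ (G v - z) ^+ 2.

Definition gam (sigma : R) : R := sigma * opnorm (eX P) eZ opA ^+ 2.

Definition proxQ (sigma : R) (u : X) : X :=
  gam sigma *: u - sigma *: adjoint (eX P) eZ opA (opA u).

Definition v_update (sigma : R) (vc : X) (z lam : Z) : X -> Prop :=
  is_argmin T (fun v => augL sigma v z lam
                        + 2^-1 * wnorm (eX P) (proxQ sigma) (v - vc) ^+ 2).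

Definition z_update (sigma : R) (v : X) (lam : Z) : Z -> Prop :=
  is_argmin setT (fun z => augL sigma v z lam).

Definition admm_step (sigma : R) (w w' : W) : Prop :=
  let: (v, z, lam) := w in
  let: (v', z', lam') := w' in
  [/\ v_update sigma v z lam v', z_update sigma v' lam z'
    & lam' = lam + sigma *: (G v' - z')].

Definition spadmm (sigma : R) (w : nat -> W) : Prop :=
  T (w 0).1.1 /\ forall l, admm_step sigma (w l) (w l.+1).

Definition accelerated_step (sigma : R) (wb w : W) : Prop :=
  let: (vb, zb, lamb) := wb in
  let: (v, z, lam) := w in
  [/\ z_update sigma vb lamb z, lam = lamb + sigma *: (G vb - z)
    & v_update sigma vb z lam v].

Definition accelerated_spadmm (alpha vrho sigma : R) (wb wh w : nat -> W) :=
  [/\ T (wb 0).1.1, wh 0 = wb 0 &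
      forall l, [/\ accelerated_step sigma (wb l) (w l),
        wh l.+1 = (1 - vrho) *: wb l + vrho *: w l
      & wb l.+1 = wb l + (alpha / (2 * (l%:R + alpha))) *: (wh l.+1 - wb l)
                       + (l%:R / (l%:R + alpha)) *: (wh l.+1 - wh l)]].

(* The oracle calls of one pass of the inner solvers. Since the term in        *)
(* gamma I - sigma A* A linearizes the quadratic penalty at the centre vc, and *)
(* the tangent space is a subspace,                                            *)
(*   v-update = projT ((gamma + beta)^-1                                       *)
(*      (gamma vc - gradell - A* (lam + sigma (G vc - z)))),  A* = gradG,      *)
(*   z-update = prox_(sigma^-1 psi) (G v + sigma^-1 lam),                      *)
(* and the stopping test on (v, z, lam) needs G v and [stat_vec v lam].        *)
Definition v_update_arg (sigma : R) (vc : X) (y : Z) : X :=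
  (gam sigma + sbeta s)^-1 *: (gam sigma *: vc - gradell - gradG y).

Definition admm_calls (sigma : R) (w w' : W) : seq (oracle_call X Y) :=
  let: (v, z, lam) := w in
  let: (v', z', lam') := w' in
  let y := lam + sigma *: (G v - z) in
  [:: JacCall v; AdjCall y.2; ProjCall (v_update_arg sigma v y);
      JacCall v'; ProxCall (G v' + sigma^-1 *: lam);
      AdjCall lam'.2; ProjCall (gradell + sbeta s *: v' + gradG lam')].

Definition accelerated_calls (sigma : R) (wb w : W) : seq (oracle_call X Y) :=
  let: (vb, zb, lamb) := wb in
  let: (v, z, lam) := w in
  let y := lam + sigma *: (G vb - z) in
  [:: JacCall vb; ProxCall (G vb + sigma^-1 *: lamb);
      AdjCall y.2; ProjCall (v_update_arg sigma vb y);
      JacCall v; AdjCall lam.2; ProjCall (gradell + sbeta s *: v + gradG lam)].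

Definition kkt_residual (w : W) : W :=
  let: (v, z, lam) := w in
  (v - projT x (v - gradell - sbeta s *: v - gradG lam),
   z - prox eZ 1 psi (z + lam),
   z - G v).

End subproblem.

Section execution.
Variables (p : params X) (t : trace X Y).

Definition sub (k : nat) : subproblem X :=
  Subproblem (tx t k) (tzeta t k) (trho t k) (tbeta t k).

(* The inner solver of iteration k terminates with pass l. *)
Definition inner_stops (k l : nat) : Prop :=
  let acc l := inner_accept (sub k) (teps t k) (ta t k) (tb t k) (tout t k l) in
  acc l /\ forall l', (l' < l)%N -> ~ acc l'.

Definition inner_last (k : nat) : nat := xget 0%N (inner_stops k).

Definition triple (k : nat) : W := tout t k (inner_last k).
Definition vk (k : nat) : X := (triple k).1.1.
Definition dk (k : nat) : R := dist (triple k).1.2.2.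
Definition I1k (k : nat) : bool := cond_I1 (sub k) (teps t k) (triple k).

Definition outer_stop (k : nat) : bool :=
  if I1k k then Num.max (teps t k) (dk k) == 0
  else Num.max (normX (vk k)) (dk k) == 0.

(* Outer iteration k is entered; the inner solver of an iteration that is      *)
(* reached is not assumed to terminate.                                        *)
Fixpoint reached (k : nat) : Prop :=
  match k with
  | 0 => True
  | k'.+1 => [/\ reached k', exists l, inner_stops k' l & ~~ outer_stop k']
  end.

Definition completed (k : nat) := reached k /\ exists l, inner_stops k l.

Definition ared (k : nat) : R :=
  Theta_pen (trho t k) (tx t k)
  - Theta_pen (trho t k) (retr p (tx t k) (vk k)).
Definition pred_red (k : nat) : R :=
  Theta_pen (trho t k) (tx t k) - Theta_hat (sub k) (vk k).
Definition ratio (k : nat) : R := ared k / pred_red k.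

Definition rejected (k : nat) : bool :=
  (ratio k < eta1 p) || (pred_red k < gbar p * normX (vk k) ^+ 2).

Definition successful (k : nat) : Prop :=
  completed k /\ [&& ~~ I1k k, ~~ outer_stop k & ~~ rejected k].

(* Computed in the extended reals, where 0^-1 = +oo. *)
Definition increase_rho (k : nat) : bool :=
  (Order.max (trho t k)%:E ((dk k)%:E)^-1
   < ((tbeta t k)^-1)%:E * ((normX (vk k))%:E)^-1)%E.

Definition outer_update (k : nat) : Prop :=
  if I1k k then
    [/\ tx t k.+1 = tx t k, tbeta t k.+1 = tbeta t k,
        teps t k.+1 = varsigma p * teps t k
      & trho t k.+1 =
          if dk k <= teps t k then trho t k else tau p * trho t k]
  else if rejected k then
    [/\ tx t k.+1 = tx t k, tbeta t k.+1 = sg1 p * tbeta t k,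
        teps t k.+1 = teps t k & trho t k.+1 = trho t k]
  else
    [/\ tx t k.+1 = retr p (tx t k) (vk k),
        tbeta t k.+1 = (if ratio k < eta2 p then tbeta t k
                        else Num.max (sg2 p * tbeta t k) (beta_min p)),
        teps t k.+1 = teps t k
      & trho t k.+1 =
          if increase_rho k then tau p * trho t k else trho t k].

Definition algorithm1 : Prop :=
  [/\ [/\ tx t 0 = x0 p, trho t 0 = rho0 p, tbeta t 0 = beta0 p
        & teps t 0 = eps0 p],
      forall k, reached k ->
        [/\ subdiff_mh (tx t k) (tzeta t k), 0 < ta t k <= a_max p
          & 0 < tb t k <= b_max p]
    & forall k, reached k.+1 -> outer_update k].

Definition common_assumptions (sbar a_min b_min : R) : Prop :=
  [/\ exists C : R, forall k, reached k ->
        normX (tx t k) <= C /\ `|trho t k| <= C,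
      exists k, successful k,
      forall k, reached k -> a_min <= ta t k /\ b_min <= tb t k
    & forall k, reached k -> sbar^-1 <= tsigma t k <= sbar].

Definition solver_A (B0 : set W) (w : nat -> nat -> W) : Prop :=
  forall k, reached k ->
    [/\ B0 (w k 0%N), spadmm (sub k) (tsigma t k) (w k)
      & forall l, tout t k l = w k l.+1].

Definition calls_A (w : nat -> nat -> W) (k l : nat) : nat :=
  size (admm_calls (sub k) (tsigma t k) (w k l) (w k l.+1)).

Definition solver_B (alpha vrho : R) (B0 : set W)
    (wb wh w : nat -> nat -> W) : Prop :=
  forall k, reached k ->
    [/\ B0 (wb k 0%N),
        accelerated_spadmm (sub k) alpha vrho (tsigma t k)
          (wb k) (wh k) (w k)
      & forall l, tout t k l = w k l].

Definition calls_B (wb w : nat -> nat -> W) (k l : nat) : nat :=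
  size (accelerated_calls (sub k) (tsigma t k) (wb k l) (w k l)).

Definition error_bound (w : nat -> nat -> W) (c : R) : Prop :=
  forall k, reached k -> forall l, (1 <= l)%N ->
    (edist eW [set u | kkt_residual (sub k) u = 0%R] (w k l)
     <= (c * enorm eW (kkt_residual (sub k) (w k l)))%:E)%E.

(* Calls made in the outer iterations 0, ..., k, where [calls j l] is the      *)
(* number of calls in pass l of the inner solver of iteration j.               *)
Definition total_calls (calls : nat -> nat -> nat) (k : nat) : nat :=
  \sum_(j < k.+1) \sum_(l < (inner_last j).+1) calls j l.

Definition first_stationary (eps : R) (k : nat) : Prop :=
  [/\ completed k, eps_stationary eps (tx t k)
    & forall j, (j < k)%N -> ~ eps_stationary eps (tx t j)].

(* C is independent of eps, which ranges over E: for a bound that vanishes at  *)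
(* eps = 1, such as eps^-2 log eps^-1, E has to stay away from 1.              *)
Definition oracle_complexity (calls : nat -> nat -> nat) (E : set R)
    (bound : R -> R) : Prop :=
  exists2 C : R, 0 < C & forall eps, E eps -> exists k,
    first_stationary eps k /\ (total_calls calls k)%:R <= C * bound eps.

End execution.
End problem_theory.

(* Main.v *)
Require Import Defs.
From HB Require Import structures.
From mathcomp Require Import all_boot all_order all_algebra.
From mathcomp Require Import all_classical all_reals all_analysis.
From mathcomp Require Import ring lra.
Import Order.TTheory GRing.Theory Num.Theory.
Import numFieldNormedType.Exports.

(** The argument separates the outer iteration, which takes O(eps^-2) steps whatever the
    inner solver is, from the number of passes that an inner solver needs.

    Outer iteration. Along a bounded run all data have uniform constants
    ([tame_uniform]). A triple that satisfies (D) has a nonzero step with beta |v|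
    bounded ([step_bound]), and tolerances remain positive, so the stopping tests
    never fire ([reachedS]); once beta exceeds the curvature of the data the
    retracted step is accepted ([large_beta]); hence beta stays bounded. If (I1)
    holds with a tolerance of order eps and z.2 is close to K, then the iterate is
    eps-stationary, because a subgradient of rho dist is normal to K at the nearest
    point ([stationary_of_small]). Before stationarity every reduction of a
    tolerance that is already small is therefore accompanied by an increase of rho,
    and since rho is bounded the tolerance remains at least c eps
    ([tolerance_bounded]). If (I1) fails, (I2) forces a step of length at least c
    eps ([long_step]), and a successful iteration decreases the merit function Theta
    + rho (dist - D), which is nonincreasing in rho, by a multiple of eps^2. Adding
    the logarithms of the tolerance and of 1 / beta, with suitable weights, gives a
    potential that drops by one in each iteration and starts at O(eps^-2)
    ([iterations_bounded]).

    Inner solvers. A triple whose residuals are of order eps^2 is accepted: either its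
    step is so small that (I1) holds, or the residuals are dominated by the square of
    the step, which yields (D) by strong convexity, and (I2) ([acceptance]). Both rates
    start from KKT points of the subproblem, which exist by quadratic
    penalization ([kkt_exists]) and are uniformly bounded ([kkt_uniform]).
    The accelerated method is a fast Krasnoselskii-Mann iteration for a proximal point
    step in a degenerate metric, so its residuals are O(1/l) ([fast_KM_residual],
    [accelerated_rate]), and O(eps^-2) passes suffice.
    The semi-proximal ADMM is Fejer monotone; the error bound makes each decrease of the
    distance to the KKT set comparable to the distance that remains, so that the
    residuals decrease geometrically ([admm_linear_rate]), and O(log eps^-1) passes
    suffice. A pass of either method costs seven calls.

    Two geometric facts underlie the whole: tangent spaces are linear subspaces, by the
    implicit function theorem ([implicit_curve], [tangent_subspace]), and a retraction
    agrees with x + v up to O(|v|^2), uniformly on bounded sets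
    ([retraction_second_order], [smooth_uniform]). *)

Set Implicit Arguments.
Unset Strict Implicit.
Unset Printing Implicit Defensive.

Local Open Scope classical_set_scope.
Local Open Scope ring_scope.


(** * Positive semidefinite forms *)

Lemma addrBK (V : zmodType) (a b : V) : a + b - a = b.
Proof. by rewrite addrC addKr. Qed.

Lemma subrACA (V : zmodType) (a b c d : V) : a - b - (c - d) = a - c - (b - d).
Proof. by rewrite !opprD !opprK addrACA. Qed.

(** Semidefinite forms are needed besides inner products: the proximal weight of the
    ADMM and the metric of its accelerated variant are both degenerate. *)
Record psd_form (R : realType) (V : lmodType R) (B : V -> V -> R) : Prop := PsdForm {
  psdC : forall u v, B u v = B v u ;
  psdDl : forall u v w, B (u + v) w = B u w + B v w ;
  psdZl : forall a u v, B (a *: u) v = a * B u v ;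
  psd_ge0 : forall u, 0 <= B u u }.

Section psd_theory.
Context {R : realType} {V : lmodType R} {B : V -> V -> R} (hB : psd_form B).

Lemma psdDr u v w : B w (u + v) = B w u + B w v.
Proof. by rewrite psdC// psdDl// (psdC hB u) (psdC hB v). Qed.
Lemma psdZr a u v : B u (a *: v) = a * B u v.
Proof. by rewrite psdC// psdZl// (psdC hB v). Qed.
Lemma psd0l v : B 0 v = 0.
Proof. by rewrite -(scale0r 0) psdZl// mul0r. Qed.
Lemma psd0r v : B v 0 = 0.
Proof. by rewrite psdC// psd0l. Qed.
Lemma psdNl u v : B (- u) v = - B u v.
Proof. by rewrite -scaleN1r psdZl// mulN1r. Qed.
Lemma psdNr u v : B u (- v) = - B u v.
Proof. by rewrite -scaleN1r psdZr// mulN1r. Qed.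
Lemma psdBl u v w : B (u - v) w = B u w - B v w.
Proof. by rewrite psdDl// psdNl. Qed.
Lemma psdBr u v w : B w (u - v) = B w u - B w v.
Proof. by rewrite psdDr// psdNr. Qed.
Lemma psd_suml I (r : seq I) (P : pred I) (F : I -> V) v :
  B (\sum_(i <- r | P i) F i) v = \sum_(i <- r | P i) B (F i) v.
Proof.
elim/big_rec2: _ => [|i y x _ <-]; first exact: psd0l.
by rewrite psdDl.
Qed.
Lemma psd_sumr I (r : seq I) (P : pred I) (F : I -> V) v :
  B v (\sum_(i <- r | P i) F i) = \sum_(i <- r | P i) B v (F i).
Proof. by rewrite psdC// psd_suml; apply: eq_bigr => i _; rewrite psdC. Qed.

Definition psdE := (psdDl hB, psdDr, psdZl hB, psdZr, psdNl, psdNr, psd0l, psd0r).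

Definition seminorm u := Num.sqrt (B u u).

Lemma seminorm_ge0 u : 0 <= seminorm u.
Proof. exact: sqrtr_ge0. Qed.

Lemma sqr_seminorm u : seminorm u ^+ 2 = B u u.
Proof. by rewrite sqr_sqrtr// psd_ge0. Qed.

(** The discriminant of t |-> B (u + t v) (u + t v) is nonpositive; when B v v = 0
    the polynomial is affine and bounded below, which forces B u v = 0. *)
Lemma psd_CS u v : B u v <= seminorm u * seminorm v.
Proof.
have key t : 0 <= B u u + 2 * t * B u v + t ^+ 2 * B v v.
  have := psd_ge0 hB (u + t *: v); rewrite !psdE (psdC hB v u).
  by congr (_ <= _); ring.
have [Buv|Buv] := leP (B u v) 0.
  by rewrite (le_trans Buv)// mulr_ge0// seminorm_ge0.
rewrite -(@ler_pXn2r _ 2)// ?nnegrE ?mulr_ge0 ?seminorm_ge0 ?(ltW Buv)//.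
rewrite exprMn !sqr_seminorm.
have [Bv0|Bv0] := eqVneq (B v v) 0.
  have := key (- (B u u + 1) / (2 * B u v)).
  rewrite Bv0 mulr0 addr0.
  have -> : B u u + 2 * (- (B u u + 1) / (2 * B u v)) * B u v = -1.
    by field; rewrite gt_eqF.
  by move/le_lt_trans/(_ (ltrN10 _)); rewrite ltxx.
have Bv : 0 < B v v by rewrite lt_neqAle eq_sym Bv0 psd_ge0.
have := key (- B u v / B v v).
have -> : B u u + 2 * (- B u v / B v v) * B u v + (- B u v / B v v) ^+ 2 * B v v
  = (B u u * B v v - B u v ^+ 2) / B v v by field.
by rewrite pmulr_lge0 ?invr_gt0// subr_ge0.
Qed.

Lemma psd_CS_abs u v : `|B u v| <= seminorm u * seminorm v.
Proof.
rewrite ler_norml psd_CS andbT lerNl -psdNl (le_trans (psd_CS _ _))//.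
by rewrite /seminorm psdNl psdNr opprK.
Qed.

Lemma seminorm0 : seminorm 0 = 0.
Proof. by rewrite /seminorm psd0l sqrtr0. Qed.

Lemma seminormZ a u : seminorm (a *: u) = `|a| * seminorm u.
Proof. by rewrite /seminorm psdZl// psdZr mulrA -expr2 sqrtrM ?sqr_ge0// sqrtr_sqr. Qed.

Lemma seminormN u : seminorm (- u) = seminorm u.
Proof. by rewrite -scaleN1r seminormZ normrN1 mul1r. Qed.

Lemma seminormD u v : seminorm (u + v) <= seminorm u + seminorm v.
Proof.
rewrite -(@ler_pXn2r _ 2)// ?nnegrE ?addr_ge0 ?seminorm_ge0//.
rewrite sqrrD !sqr_seminorm !psdE (psdC hB v u).
have := psd_CS u v; lra.
Qed.

Lemma seminormB u v : seminorm (u - v) <= seminorm u + seminorm v.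
Proof. by rewrite -(seminormN v) seminormD. Qed.

Lemma psd_polar u v w :
  2 * B (u - v) (u - w) = B (u - w) (u - w) + B (u - v) (u - v) - B (v - w) (v - w).
Proof. rewrite !psdE (psdC hB v u) (psdC hB w u) (psdC hB w v); ring. Qed.

End psd_theory.

(** * Euclidean spaces *)

Lemma inner_psd (R : realType) (V : normedModType R) (eV : euclidean V) :
  psd_form (inner eV).
Proof.
split; [exact: innerC|exact: innerDl|exact: innerZl|].
move=> u; have [->|u0] := eqVneq u 0; last exact/ltW/inner_gt0.
by rewrite -{1}(scale0r (0 : V)) innerZl mul0r.
Qed.

Section euclid.
Context {R : realType} {V : normedModType R} (eV : euclidean V).
Local Notation "''[' u , v ]" := (inner eV u v).
Local Notation N := (enorm eV).
Let hI := inner_psd eV.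

Lemma innerDr u v w : '[w, u + v] = '[w, u] + '[w, v]. Proof. exact: psdDr. Qed.
Lemma innerZr a u v : '[u, a *: v] = a * '[u, v]. Proof. exact: psdZr. Qed.
Lemma inner0l v : '[0, v] = 0. Proof. exact: psd0l. Qed.
Lemma inner0r v : '[v, 0] = 0. Proof. exact: psd0r. Qed.
Lemma innerNl u v : '[- u, v] = - '[u, v]. Proof. exact: psdNl. Qed.
Lemma innerNr u v : '[u, - v] = - '[u, v]. Proof. exact: psdNr. Qed.
Lemma innerBl u v w : '[u - v, w] = '[u, w] - '[v, w]. Proof. exact: psdBl. Qed.
Lemma innerBr u v w : '[w, u - v] = '[w, u] - '[w, v]. Proof. exact: psdBr. Qed.
Definition innerE :=
  (innerDl, innerDr, innerZl, innerZr, innerNl, innerNr, inner0l, inner0r).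

Lemma enorm_ge0 u : 0 <= N u. Proof. exact: seminorm_ge0. Qed.
Lemma sqr_enorm u : N u ^+ 2 = '[u, u]. Proof. exact: sqr_seminorm. Qed.
Lemma inner_CS u v : '[u, v] <= N u * N v. Proof. exact: psd_CS. Qed.
Lemma inner_CS_abs u v : `|'[u, v]| <= N u * N v. Proof. exact: psd_CS_abs. Qed.
Lemma enorm0 : N 0 = 0. Proof. exact: seminorm0. Qed.
Lemma enormZ a u : N (a *: u) = `|a| * N u. Proof. exact: seminormZ. Qed.
Lemma enormZp a u : 0 <= a -> N (a *: u) = a * N u.
Proof. by move=> a0; rewrite enormZ ger0_norm. Qed.
Lemma enormN u : N (- u) = N u. Proof. exact: seminormN. Qed.
Lemma enormD u v : N (u + v) <= N u + N v. Proof. exact: seminormD. Qed.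
Lemma enormB u v : N (u - v) <= N u + N v. Proof. exact: seminormB. Qed.

Lemma enorm_distC u v : N (u - v) = N (v - u).
Proof. by rewrite -enormN opprB. Qed.

Lemma enorm_eq0 u : (N u == 0) = (u == 0).
Proof.
apply/eqP/eqP => [N0|->]; last exact: enorm0.
apply/eqP/negPn/negP => /(inner_gt0 eV).
by rewrite -sqr_enorm N0 expr0n ltxx.
Qed.

Lemma enorm_gt0 u : (0 < N u) = (u != 0).
Proof. by rewrite lt_neqAle enorm_ge0 andbT eq_sym enorm_eq0. Qed.

Lemma enorm_triangle w u v : N (u - v) <= N (u - w) + N (w - v).
Proof. by rewrite (le_trans _ (enormD _ _))// addrA subrK. Qed.

Lemma enorm_le_add u v : N u <= N v + N (u - v).
Proof. by have := enormD v (u - v); rewrite addrC subrK. Qed.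

Lemma enorm_sum I (r : seq I) (P : pred I) (F : I -> V) :
  N (\sum_(i <- r | P i) F i) <= \sum_(i <- r | P i) N (F i).
Proof.
elim/big_ind2: _ => [|u a v b ha hb|//]; first by rewrite enorm0.
by rewrite (le_trans (enormD _ _))// lerD.
Qed.

Definition orthonormal_family n (e : 'I_n -> V) := forall i j, '[e i, e j] = (i == j)%:R.

(** Gram-Schmidt: the normalized residual of the last vector is adjoined when it
    is nonzero. *)
Lemma gram_schmidt n (e : 'I_n -> V) : exists m (b : 'I_m -> V),
  orthonormal_family b /\ forall i, e i = \sum_j '[e i, b j] *: b j.
Proof.
elim: n e => [|n IH] e.
  by exists 0%N, (fun _ => 0); split => [[]|[]].
have [m [b [bo be]]] := IH (fun i => e (lift ord0 i)).
pose r := e ord0 - \sum_j '[e ord0, b j] *: b j.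
have rb j : '[r, b j] = 0.
  rewrite innerBl psd_suml// (bigD1 j)//= innerZl bo eqxx mulr1.
  rewrite big1 ?addr0 ?subrr// => i ij.
  by rewrite innerZl bo (negbTE ij) mulr0.
have [r0|r0] := eqVneq r 0.
  exists m, b; split=> // i; case: (unliftP ord0 i) => [j ->|->]; first exact: be.
  by apply/eqP; rewrite -subr_eq0; apply/eqP.
pose q := (N r)^-1 *: r.
have Nr : N r != 0 by rewrite enorm_eq0.
have qb j : '[q, b j] = 0 by rewrite innerZl rb mulr0.
have qq : '[q, q] = 1.
  by rewrite innerZl innerZr -sqr_enorm; field.
exists m.+1, (fun i => if unlift ord0 i is Some j then b j else q); split.
  move=> i j; case: (unliftP ord0 i) => [i' ->|->]; case: (unliftP ord0 j) => [j' ->|->].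
  - by rewrite ?liftK ?unlift_none bo (inj_eq lift_inj).
  - by rewrite ?liftK ?unlift_none innerC qb.
  - by rewrite ?liftK ?unlift_none qb.
  - by rewrite ?liftK ?unlift_none qq eqxx.
move=> i; rewrite big_ord_recl unlift_none.
under eq_bigr => j _ do rewrite liftK.
have ei0 : e ord0 = r + \sum_j '[e ord0, b j] *: b j by rewrite subrK.
case: (unliftP ord0 i) => [j ->|->].
  rewrite -be; have -> : '[e (lift ord0 j), q] = 0; last by rewrite scale0r add0r.
  by rewrite be psd_suml// big1// => k _; rewrite innerZl (innerC _ _ q) qb mulr0.
have -> : '[e ord0, q] = N r.
  rewrite ei0 innerDl psd_suml//= [X in _ + X]big1 => [|k _].
    by rewrite addr0 innerZr -sqr_enorm; field.
  by rewrite innerZl (innerC _ _ q) qb mulr0.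
by rewrite /q scalerA mulfV// scale1r -ei0.
Qed.

Lemma orthonormal_basis : exists n (e : 'I_n -> V),
  orthonormal_family e /\ forall u, u = \sum_j '[u, e j] *: e j.
Proof.
have [n [e espan]] := euclidean_findim eV.
have [m [b [bo be]]] := gram_schmidt e.
exists m, b; split=> // u.
have [c uc] := espan u.
rewrite {1}uc (eq_bigr (fun i => \sum_j (c i * '[e i, b j]) *: b j)); last first.
  by move=> i _; rewrite {1}be scaler_sumr; apply: eq_bigr => j _; rewrite scalerA.
rewrite exchange_big; apply: eq_bigr => j _ /=.
rewrite -scaler_suml; congr (_ *: _); rewrite uc psd_suml//.
by apply: eq_bigr => i _; rewrite innerZl.
Qed.

Lemma orthonormal_coord_le n (e : 'I_n -> V) : orthonormal_family e ->
  forall u i, `|'[u, e i]| <= N u.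
Proof.
move=> eo u i; rewrite (le_trans (inner_CS_abs _ _))//.
by rewrite [N (e i)]/enorm eo eqxx sqrtr1 mulr1.
Qed.

Lemma riesz (phi : V -> R) : (forall u v, phi (u + v) = phi u + phi v) ->
  (forall a u, phi (a *: u) = a * phi u) -> exists w, forall v, '[w, v] = phi v.
Proof.
move=> phiD phiZ; have [n [e [eo espan]]] := orthonormal_basis.
have phi0 : phi 0 = 0 by rewrite -(scale0r 0) phiZ mul0r.
exists (\sum_j phi (e j) *: e j) => v.
rewrite psd_suml// {2}(espan v) (big_morph phi phiD phi0).
by apply: eq_bigr => j _; rewrite phiZ innerZl innerC mulrC.
Qed.

End euclid.

(** * Equivalence of norms and compactness *)

Lemma continuous_sumr (R : realType) (T : topologicalType) (W : normedModType R)
    (I : Type) (r : seq I) (F : I -> T -> W) :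
  (forall i, continuous (F i)) -> continuous (fun x => \sum_(i <- r) F i x).
Proof.
move=> cF x; rewrite /continuous_at; elim: r => [|i r IH].
  by under eq_fun do rewrite big_nil; rewrite big_nil; exact: cvg_cst.
under eq_fun do rewrite big_cons.
by rewrite big_cons; apply: cvgD => //; exact: cF.
Qed.

Section row_vectors.
Context {R : realType} {n : nat}.

Lemma coord_le_norm (c : 'rV[R]_n) i : `|c 0 i| <= `|c|.
Proof.
rewrite [leRHS]/Num.norm/= mx_normrE; apply/bigmax_geP; right => /=.
by exists (0, i).
Qed.

Lemma norm_le_coord (c : 'rV[R]_n) r : 0 <= r -> (forall i, `|c 0 i| <= r) -> `|c| <= r.
Proof.
move=> r0 cr; rewrite [leLHS]/Num.norm/= mx_normrE; apply/bigmax_leP; split => //.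
by move=> [i j] _ /=; rewrite (ord1 i).
Qed.

Lemma row_lipschitz_continuous (F : 'rV[R]_n -> R) (C : R) : 0 <= C ->
  (forall a b, F a - F b <= C * `|a - b|) -> continuous F.
Proof.
move=> C0 FC c; apply/(@cvgrPdist_le _ _ _ (nbhs c)) => e e0 /=.
have e1 : 0 < e / (C + 1) by rewrite divr_gt0// ltr_pwDr.
apply: filterS (@nbhsx_ballx R 'rV[R]_n c _ e1) => c'.
rewrite -ball_normE/= => cc'.
have h : C * `|c - c'| <= e.
  rewrite (le_trans (ler_wpM2l C0 (ltW cc')))// mulrCA ler_piMr ?(ltW e0)//.
  by rewrite ler_pdivrMr ?ltr_pwDr// mul1r lerDl.
have h1 := FC c c'; have := FC c' c; rewrite distrC => h2.
rewrite ler_norml; apply/andP; split; lra.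
Qed.

End row_vectors.

Section topology.
Context {R : realType} {V : normedModType R} (eV : euclidean V).
Local Notation "''[' u , v ]" := (inner eV u v).
Local Notation N := (enorm eV).

Lemma is_norm0 (W : normedModType R) (F : W -> R) : is_norm F -> F 0 = 0.
Proof. by move=> [_ FZ _]; rewrite -(scale0r 0) FZ normr0 mul0r. Qed.

Lemma is_norm_ge0 (W : normedModType R) (F : W -> R) u : is_norm F -> 0 <= F u.
Proof.
move=> hF; have [FD FZ _] := hF.
have := FD u (- u); rewrite subrr is_norm0// -scaleN1r FZ normrN1 mul1r; lra.
Qed.

Lemma is_norm_sum (W : normedModType R) (F : W -> R) I (r : seq I) (P : pred I)
    (e : I -> W) : is_norm F -> F (\sum_(i <- r | P i) e i) <= \sum_(i <- r | P i) F (e i).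
Proof.
move=> hF; have [FD FZ _] := hF; elim/big_ind2: _ => [|u a v b ha hb|//].
  by rewrite is_norm0.
by rewrite (le_trans (FD _ _))// lerD.
Qed.

Lemma enorm_coordE n (e : 'I_n -> V) (c : 'I_n -> R) : orthonormal_family eV e ->
  N (\sum_i c i *: e i) ^+ 2 = \sum_i c i ^+ 2.
Proof.
move=> eo; rewrite sqr_enorm psd_suml; last exact: inner_psd.
apply: eq_bigr => i _; rewrite innerZl psd_sumr; last exact: inner_psd.
rewrite (bigD1 i)//= innerZr eo eqxx mulr1 big1 ?addr0 ?expr2// => j ji.
by rewrite innerZr eo eq_sym (negbTE ji) mulr0.
Qed.

(** In orthonormal coordinates the unit sphere is a compact set of row vectors,
    on which a norm attains a positive minimum. *)
Lemma norm_equiv (F : V -> R) : is_norm F ->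
  exists2 c, 0 < c & forall u, F u <= c * N u /\ N u <= c * F u.
Proof.
move=> hF; have [FD FZ F0] := hF.
have [n [e [eo espan]]] := orthonormal_basis eV.
pose C := \sum_i F (e i).
have C0 : 0 <= C by apply: sumr_ge0 => i _; exact: is_norm_ge0.
have FC u : F u <= C * N u.
  rewrite {1}(espan u) (le_trans (is_norm_sum _ _ _ hF))// mulr_suml.
  apply: ler_sum => i _; rewrite FZ mulrC ler_wpM2l ?is_norm_ge0//.
  exact: orthonormal_coord_le.
have [m m0 mF] : exists2 m, 0 < m & forall u, m * N u <= F u.
  pose phi (c : 'rV[R]_n) := \sum_i c 0 i *: e i.
  pose S := [set c : 'rV[R]_n | \sum_i c 0 i ^+ 2 = 1].
  have [S0|/set0P S0] := eqVneq S set0.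
    exists 1 => // u; have [->|u0] := eqVneq u 0; first by rewrite enorm0 mulr0 is_norm_ge0.
    exfalso; have : S (\row_i '[(N u)^-1 *: u, e i]).
      rewrite /S/=; under eq_bigr do rewrite mxE.
      rewrite -(enorm_coordE _ eo) -espan enormZ ger0_norm ?invr_ge0 ?enorm_ge0//.
      by rewrite mulVf ?expr1n// enorm_eq0.
    by rewrite S0.
  have cS : compact S.
    apply: bounded_closed_compact.
      exists 1; split; first exact: num_real.
      move=> r r1 c; rewrite /S/= => c1.
      apply: norm_le_coord => [|j]; first lra.
      rewrite (le_trans _ (ltW r1))//.
      rewrite -(@ler_pXn2r _ 2)// ?nnegrE// expr1n real_normK ?num_real//.
      rewrite -c1 (bigD1 j)//= lerDl sumr_ge0// => k _; exact: sqr_ge0.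
    have -> : S = (fun c : 'rV[R]_n => \sum_i c 0 i ^+ 2) @^-1` [set 1] by [].
    apply: closed_comp; last exact: closed_eq.
    move=> c _; apply: (continuous_sumr (W := R^o)) => i {}c.
    have hc : {for c, continuous (fun x : 'rV[R]_n => x 0 i)} by exact: coord_continuous.
    exact: (cvgM hc hc).
  have cont : continuous (F \o phi).
    apply: (row_lipschitz_continuous C0) => a b /=.
    have := FD (phi b) (phi a - phi b); rewrite addrC subrK => h.
    rewrite (le_trans (lerB h (lexx _)))// addrAC subrr add0r.
    rewrite /phi -sumrB (le_trans (is_norm_sum _ _ _ hF))// mulr_suml.
    apply: ler_sum => i _; rewrite -scalerBl FZ mulrC ler_wpM2l ?is_norm_ge0//.
    have -> : a 0 i - b 0 i = (a - b) 0 i by rewrite !mxE.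
    exact: coord_le_norm.
  have [c /[!inE] Sc minc] := @compact_EVT_min _ R (F \o phi) S S0 cS
    (continuous_subspaceT cont).
  exists (F (phi c)).
    rewrite lt_neqAle eq_sym is_norm_ge0// andbT; apply/eqP => /F0 phi0.
    have := enorm_coordE (fun i => c 0 i) eo; rewrite -/(phi c) phi0 enorm0 Sc expr0n/=.
    by move/eqP; rewrite eq_sym oner_eq0.
  move=> u; have [->|u0] := eqVneq u 0; first by rewrite enorm0 mulr0 is_norm_ge0.
  pose w := (N u)^-1 *: u.
  have Sw : S (\row_i '[w, e i]).
    rewrite /S/=; under eq_bigr do rewrite mxE.
    rewrite -(enorm_coordE _ eo) -espan enormZ ger0_norm ?invr_ge0 ?enorm_ge0//.
    by rewrite mulVf ?expr1n// enorm_eq0.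
  have := minc _ (mem_set Sw); rewrite /= {2}/phi.
  under [X in _ <= F X -> _]eq_bigr do rewrite mxE.
  rewrite -espan FZ ger0_norm ?invr_ge0 ?enorm_ge0// ler_pdivlMl ?enorm_gt0//.
  by rewrite mulrC.
have m'0 : 0 < m^-1 by rewrite invr_gt0.
exists (C + m^-1); first by rewrite ltr_wpDl.
move=> u; split.
  by rewrite (le_trans (FC u))// ler_wpM2r ?enorm_ge0// lerDl ltW.
have h : N u <= m^-1 * F u by rewrite ler_pdivlMl.
by rewrite (le_trans h)// ler_wpM2r ?is_norm_ge0// lerDr.
Qed.

Lemma normr_is_norm : is_norm (fun u : V => `|u|).
Proof. by split; [exact: ler_normD|exact: normrZ|exact: normr0_eq0]. Qed.

Lemma nbhs_enormP (x : V) (A : set V) :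
  nbhs x A <-> exists2 d, 0 < d & forall y, N (y - x) < d -> A y.
Proof.
have [c c0 cN] := norm_equiv normr_is_norm.
split=> [/nbhs_ballP[d d0 dA]|[d d0 dA]].
  exists (d / c); first exact: divr_gt0.
  move=> y; rewrite ltr_pdivlMr// mulrC => yx; apply: dA.
  rewrite -ball_normE/= distrC (le_lt_trans _ yx)//; exact: (cN _).1.
apply/nbhs_ballP; exists (d / c); first exact: divr_gt0.
move=> y; rewrite -ball_normE/= distrC ltr_pdivlMr// mulrC => yx; apply: dA.
by rewrite (le_lt_trans _ yx)//; exact: (cN _).2.
Qed.

Lemma near_enorm (x : V) (d : R) : 0 < d -> \forall y \near x, N (y - x) < d.
Proof. by move=> d0; apply/nbhs_enormP; exists d. Qed.

Lemma cvg_enormP (T : Type) (G : set_system T) (FG : Filter G) (u : T -> V) (x : V) :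
  u @ G --> x <-> forall e, 0 < e -> \forall t \near G, N (u t - x) < e.
Proof.
split=> [ux e e0|ux A /nbhs_enormP[d d0 dA]].
  exact: (ux _ (near_enorm x e0)).
by apply: filterS (ux _ d0) => t; exact: dA.
Qed.

(** The ball is covered by the image of a cube of orthonormal coordinates. *)
Lemma compact_enorm (A : set V) (r : R) :
  closed A -> (forall u, A u -> N u <= r) -> compact A.
Proof.
move=> clA Ar; have [n [e [eo espan]]] := orthonormal_basis eV.
pose phi (c : 'rV[R]_n) := \sum_i c 0 i *: e i.
pose S := [set c : 'rV[R]_n | forall i, c 0 i \in `[(- r), r]].
have cS : compact S.
  apply: (@rV_compact _  _ (fun=> `[(- r), r]%classic)) => _; exact: segment_compact.
apply: (@subclosed_compact _ _ (phi @` S)) => //.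
  apply: continuous_compact => //; apply: continuous_subspaceT.
  apply: continuous_sumr => i c.
  have hc : {for c, continuous (fun x : 'rV[R]_n => x 0 i)} by exact: coord_continuous.
  exact: (cvgZr_tmp hc).
move=> u Au; exists (\row_i '[u, e i]).
  move=> i; rewrite mxE in_itv/= -ler_norml.
  by rewrite (le_trans _ (Ar _ Au))// orthonormal_coord_le.
by rewrite /phi {2}(espan u); apply: eq_bigr => i _; rewrite mxE.
Qed.

Lemma compact_enorm_bounded (A : set V) : compact A ->
  exists2 r, 0 < r & forall u, A u -> N u <= r.
Proof.
have [c c0 cN] := norm_equiv normr_is_norm.
move=> /compact_bounded/ex_strict_bound_gt0[r r0 Ar].
exists (c * r); first exact: mulr_gt0.
by move=> u /Ar/ltW ur; rewrite (le_trans (cN _).2)// ler_pM2l.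
Qed.

Lemma bounded_cluster (u : nat -> V) (r : R) : (forall n, N (u n) <= r) ->
  exists x, forall e, 0 < e -> forall m, exists2 n, (m <= n)%N & N (u n - x) < e.
Proof.
move=> ur; pose A := closure (range u).
have Ar v : A v -> N v <= r + 1.
  move=> /(_ _ (near_enorm v ltr01))[_ [[n _ <-] /= un]].
  by rewrite (le_trans (enorm_le_add eV _ (u n)))// lerD// ltW// enorm_distC.
have cA := compact_enorm (@closed_closure _ _) Ar.
have [|x [_ clx]] := cA (u @ \oo) _.
  by exists 0%N => // n _; apply: subset_closure; exists n.
exists x => e e0 m.
have [|_ [[n /= mn <-] une]] := clx (u @` [set n | (m <= n)%N]) _ _ (near_enorm x e0).
  by exists m => // n /= mn; exists n.
by exists n.
Qed.

(** The minimum over the compact sublevel set of u0 is global. *)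
Lemma coercive_min (D : set V) (F : V -> R) (u0 : V) (r : R) :
  closed D -> continuous F -> D u0 ->
  (forall u, D u -> F u <= F u0 -> N u <= r) -> exists u, is_argmin D F u.
Proof.
move=> clD cF Du0 sub; pose A := D `&` [set u | F u <= F u0].
have cA : compact A.
  apply: (@compact_enorm _ r); last by move=> u [Du Fu]; exact: sub.
  apply: closedI => //; apply: (@closed_comp _ _ F [set y | y <= F u0]); last exact: closed_le.
  by move=> x _; exact: cF.
have A0 : A !=set0 by exists u0; split=> /=.
have [c /[!inE] -[Dc Fc] minc] := @compact_EVT_min _ R F A A0 cA
  (continuous_subspaceT cF).
exists c; split=> // u Du; have [Fu|/ltW Fu] := leP (F u) (F u0).
  by apply: minc; rewrite inE.
exact: le_trans Fc Fu.
Qed.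

End topology.

Section continuity.
Context {R : realType} {V W : normedModType R} (eV : euclidean V) (eW : euclidean W).

Lemma continuous_enormP (F : V -> W) (x : V) : {for x, continuous F} <->
  forall e, 0 < e -> exists2 d, 0 < d & forall y, enorm eV (y - x) < d ->
    enorm eW (F y - F x) < e.
Proof.
split=> [/(cvg_enormP eW) Fx e /Fx /(nbhs_enormP eV)//|Fx].
by apply/(cvg_enormP eW) => e /Fx /(nbhs_enormP eV).
Qed.

Lemma continuous_realP (F : V -> R) (x : V) : {for x, continuous F} <->
  forall e, 0 < e -> exists2 d, 0 < d & forall y, enorm eV (y - x) < d ->
    `|F y - F x| < e.
Proof.
split=> [/cvgr_distC_lt Fx e /Fx /(nbhs_enormP eV)//|Fx].
by apply/cvgrPdistC_lt => e /Fx /(nbhs_enormP eV).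
Qed.

(** ** Linear maps *)

Section linear.
Variable L : V -> W.
Hypothesis LD : forall u v, L (u + v) = L u + L v.
Hypothesis LZ : forall a u, L (a *: u) = a *: L u.

Lemma linear_bounded : exists2 C, 0 < C & forall v, enorm eW (L v) <= C * enorm eV v.
Proof.
have L0 : L 0 = 0 by rewrite -(scale0r 0) LZ scale0r.
have [n [e [eo espan]]] := orthonormal_basis eV.
exists (\sum_i enorm eW (L (e i)) + 1).
  by rewrite ltr_pwDr// sumr_ge0// => i _; exact: enorm_ge0.
move=> v; rewrite {1}(espan v) (big_morph L LD L0).
rewrite (le_trans (enorm_sum _ _ _ _))// mulrDl mul1r ler_wpDr ?enorm_ge0//.
rewrite mulr_suml; apply: ler_sum => i _.
by rewrite LZ enormZ mulrC ler_wpM2l ?enorm_ge0// orthonormal_coord_le.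
Qed.

Lemma opnormP v : enorm eW (L v) <= opnorm eV eW L * enorm eV v.
Proof.
have L0 : L 0 = 0 by rewrite -(scale0r 0) LZ scale0r.
have [->|v0] := eqVneq v 0; first by rewrite L0 !enorm0 mulr0.
have Nv : 0 < enorm eV v by rewrite enorm_gt0.
rewrite -ler_pdivrMr//; apply: sup_upper_bound.
  split; first by exists (enorm eW (L 0)), 0 => //=; rewrite enorm0 ler01.
  have [C C0 LC] := linear_bounded; exists C => _ [u /= u1 <-].
  by rewrite (le_trans (LC _))// ler_piMr// ltW.
exists ((enorm eV v)^-1 *: v) => /=.
  by rewrite enormZ ger0_norm ?invr_ge0 ?enorm_ge0// mulVf// gt_eqF.
by rewrite LZ enormZ ger0_norm ?invr_ge0 ?enorm_ge0// mulrC.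
Qed.

Lemma opnorm_ge0 : 0 <= opnorm eV eW L.
Proof.
have [C C0 LC] := linear_bounded.
have L0 : L 0 = 0 by rewrite -(scale0r 0) LZ scale0r.
apply: (@le_trans _ _ (enorm eW (L 0))); first exact: enorm_ge0.
apply: sup_upper_bound; last by exists 0 => //=; rewrite enorm0 ler01.
split; first by exists (enorm eW (L 0)), 0 => //=; rewrite enorm0 ler01.
by exists C => _ [u /= u1 <-]; rewrite (le_trans (LC _))// ler_piMr// ltW.
Qed.

Lemma opnorm_le C : 0 <= C -> (forall v, enorm eW (L v) <= C * enorm eV v) ->
  opnorm eV eW L <= C.
Proof.
move=> C0 LC; apply: ge_sup; first by exists (enorm eW (L 0)), 0 => //=; rewrite enorm0 ler01.
by move=> _ [u /= u1 <-]; rewrite (le_trans (LC _))// ler_piMr.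
Qed.

Lemma adjointP y v : inner eV (adjoint eV eW L y) v = inner eW y (L v).
Proof.
move: v; rewrite /adjoint.
have [u uP] : exists u, forall v, inner eV u v = inner eW y (L v).
  by apply: riesz => [u v|a u]; rewrite ?LD ?LZ innerE.
exact: (@xgetPex _ 0 [set u | forall v, inner eV u v = inner eW y (L v)]
  (ex_intro _ u uP)).
Qed.

End linear.
End continuity.

Section enorm_continuity.
Context {R : realType} {V : normedModType R} (eV : euclidean V).

Lemma enorm_continuous (w : V) : continuous (fun u => enorm eV (w - u)).
Proof.
move=> x; apply/(continuous_realP eV) => e e0; exists e => // y yx.
have h1 := enorm_triangle eV x w y; have h2 := enorm_triangle eV y w x.
by rewrite (enorm_distC eV x y) in h1; rewrite ltr_norml; apply/andP; split; lra.
Qed.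

Lemma continuous_enorm : continuous (enorm eV).
Proof.
have -> : enorm eV = (fun u => enorm eV (0 - u)) by apply/funext => u; rewrite sub0r enormN.
exact: enorm_continuous.
Qed.

End enorm_continuity.

Section product_norms.
Context {R : realType} {V W : normedModType R} (eV : euclidean V) (eW : euclidean W).
Local Notation e2 := (prod_euclidean eV eW).

Lemma enorm_fst_le (u : (V * W)%type) : enorm eV u.1 <= enorm e2 u.
Proof. by rewrite /enorm ler_wsqrtr//= /prod_inner lerDl psd_ge0//; exact: inner_psd. Qed.

Lemma enorm_snd_le (u : (V * W)%type) : enorm eW u.2 <= enorm e2 u.
Proof. by rewrite /enorm ler_wsqrtr//= /prod_inner lerDr psd_ge0//; exact: inner_psd. Qed.

Lemma enorm_prod_le (u : (V * W)%type) : enorm e2 u <= enorm eV u.1 + enorm eW u.2.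
Proof.
rewrite -(@ler_pXn2r _ 2)// ?nnegrE ?addr_ge0 ?enorm_ge0//.
rewrite sqr_enorm /= /prod_inner/= -!sqr_enorm.
by have := mulr_ge0 (enorm_ge0 eV u.1) (enorm_ge0 eW u.2); lra.
Qed.

End product_norms.

(** ** Orthogonal projection onto a subspace *)

Definition linear_subspace (R : realType) (V : lmodType R) (T : set V) :=
  [/\ T 0, forall u v, T u -> T v -> T (u + v) & forall a u, T u -> T (a *: u)].

Section projection.
Context {R : realType} {V : normedModType R} (eV : euclidean V).
Variable T : set V.
Hypotheses (Tsub : linear_subspace T) (Tcl : closed T).
Local Notation "''[' u , v ]" := (inner eV u v).
Local Notation N := (enorm eV).

Lemma subspaceB u v : T u -> T v -> T (u - v).
Proof. by move=> Tu Tv; case: Tsub => _ TD TZ; rewrite -scaleN1r; apply: TD => //; exact: TZ. Qed.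

(** First-order optimality of the nearest point in each direction of T. *)
Lemma projP u : T (Defs.proj eV T u) /\ forall t, T t -> '[u - Defs.proj eV T u, t] = 0.
Proof.
have [T0 TD TZ] := Tsub.
have [p pP] : exists p, is_argmin T (fun u' => N (u - u')) p.
  apply: (@coercive_min _ _ eV _ _ 0 (2 * N u)) => //; first exact: enorm_continuous.
  move=> w Tw; rewrite subr0 => h.
  by have := enorm_le_add eV w u; rewrite enorm_distC; lra.
have {p pP}[Tp minp] : is_argmin T (fun u' => N (u - u')) (Defs.proj eV T u).
  exact: (@xgetPex _ 0 (is_argmin T (fun u' => N (u - u'))) (ex_intro _ p pP)).
split=> // t Tt; set p := Defs.proj eV T u in Tp minp *.
have key s : 0 <= s ^+ 2 * '[t, t] - 2 * s * '[u - p, t].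
  have := minp _ (TD _ _ Tp (TZ s _ Tt)).
  rewrite -(@ler_pXn2r _ 2) ?nnegrE ?enorm_ge0// !sqr_enorm opprD addrA.
  move: (u - p) => w.
  rewrite innerBl !innerBr !innerZl !innerZr (innerC eV t w); lra.
have [t0|t0] := eqVneq t 0; first by rewrite t0 inner0r.
have tt := inner_gt0 eV t0.
have := key ('[u - p, t] / '[t, t]).
have -> : ('[u - p, t] / '[t, t]) ^+ 2 * '[t, t] - 2 * ('[u - p, t] / '[t, t]) * '[u - p, t]
  = - ('[u - p, t] ^+ 2 / '[t, t]) by field; rewrite gt_eqF.
rewrite oppr_ge0 pmulr_lle0 ?invr_gt0// => h.
by apply/eqP; rewrite -sqrf_eq0 eq_le h sqr_ge0.
Qed.

Lemma proj_uniq u p : T p -> (forall t, T t -> '[u - p, t] = 0) -> Defs.proj eV T u = p.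
Proof.
move=> Tp pP; have [Tq qP] := projP u; set q := Defs.proj eV T u in Tq qP *.
apply/eqP; rewrite -subr_eq0 -(enorm_eq0 eV) -sqrf_eq0 sqr_enorm.
have Tqp := subspaceB Tq Tp.
have -> : '[q - p, q - p] = '[u - p, q - p] - '[u - q, q - p] by rewrite !innerBl; ring.
by rewrite pP// qP// subrr.
Qed.

Lemma proj_inner u t : T t -> '[Defs.proj eV T u, t] = '[u, t].
Proof. by have [_ h] := projP u => Tt; apply/esym/eqP; rewrite -subr_eq0 -innerBl h. Qed.

Lemma enorm_proj_le u r : 0 <= r -> (forall t, T t -> '[u, t] <= r * N t) -> N (Defs.proj eV T u) <= r.
Proof.
move=> r0 ur; have [Tp _] := projP u; set p := Defs.proj eV T u in Tp *.
have [->|p0] := eqVneq p 0; first by rewrite enorm0.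
have Np : 0 < N p by rewrite enorm_gt0.
rewrite -(ler_pM2r Np) -expr2 sqr_enorm.
by have := proj_inner u Tp; rewrite -/p => ->; exact: ur.
Qed.

Lemma proj_le u : N (Defs.proj eV T u) <= N u.
Proof. by apply: enorm_proj_le => [|t _]; [exact: enorm_ge0|exact: inner_CS]. Qed.

Lemma projD u v : Defs.proj eV T (u + v) = Defs.proj eV T u + Defs.proj eV T v.
Proof.
have [Tu uP] := projP u; have [Tv vP] := projP v; have [_ TD _] := Tsub.
apply: proj_uniq => [|t Tt]; first exact: TD.
by rewrite opprD addrACA innerDl uP// vP// addr0.
Qed.

End projection.

(** * Convex functions *)

Definition cvx (R : realType) (V : lmodType R) (phi : V -> R) :=
  forall t u v, 0 <= t <= 1 ->
    phi (t *: u + (1 - t) *: v) <= t * phi u + (1 - t) * phi v.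

Definition subgrad (R : realType) (V : normedModType R) (eV : euclidean V)
    (phi : V -> R) (x zeta : V) :=
  forall y, phi x + inner eV zeta (y - x) <= phi y.

Lemma convex_function_cvx (R : realType) (V : normedModType R) (phi : V -> R) :
  convex_function (setT : set (convex_lmodType V)) phi -> cvx phi.
Proof.
move=> hphi t u v /andP[t0 t1].
by have := hphi (Itv01 t0 t1) u v (in_setT _) (in_setT _).
Qed.

Section convex.
Context {R : realType} {V : normedModType R} (eV : euclidean V).
Variable phi : V -> R.
Hypothesis hphi : cvx phi.
Local Notation "''[' u , v ]" := (inner eV u v).
Local Notation N := (enorm eV).

Lemma cvx_half u v : phi (u + v) <= 2^-1 * phi (2 *: u) + 2^-1 * phi (2 *: v).
Proof.
have := @hphi 2^-1 (2 *: u) (2 *: v).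
have -> : 1 - 2^-1 = 2^-1 :> R by field.
by rewrite !scalerA mulVf ?scale1r//; apply; apply/andP; split; lra.
Qed.

Lemma cvx_line (e : V) (r s : R) : 0 < r -> `|s| <= r ->
  phi (s *: e) <= Num.max (phi (r *: e)) (phi (- r *: e)).
Proof.
move=> r0; rewrite ler_norml => /andP[s1 s2].
pose t := (s + r) / (2 * r).
have t01 : 0 <= t <= 1.
  apply/andP; split; first by rewrite divr_ge0; lra.
  by rewrite ler_pdivrMr; lra.
have := hphi (r *: e) (- r *: e) t01.
rewrite !scalerA -scalerDl.
have -> : t * r + (1 - t) * - r = s by rewrite /t; field; rewrite gt_eqF.
move=> /le_trans; apply; move/andP: t01 => [t0 t1].
set m := Num.max _ _.
have h1 : phi (r *: e) <= m by rewrite le_max lexx.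
have h2 : phi (- r *: e) <= m by rewrite le_max lexx orbT.
have := ler_wpM2l t0 h1; have t1' : 0 <= 1 - t by lra.
have := ler_wpM2l t1' h2; lra.
Qed.

(** Halving splits off one coordinate axis, on which the maximum is at an endpoint, at
    the price of doubling the box for the remaining coordinates. *)
Lemma cvx_box n (e : 'I_n -> V) (r : R) : 0 < r ->
  exists C, forall c, (forall i, `|c i| <= r) -> phi (\sum_i c i *: e i) <= C.
Proof.
elim: n e r => [|n IH] e r r0.
  by exists (phi 0) => c _; rewrite big_ord0.
have r2 : 0 < 2 * r by lra.
have [C hC] := IH (fun i => e (lift ord0 i)) _ r2.
pose m := Num.max (phi (2 * r *: e ord0)) (phi (- (2 * r) *: e ord0)).
exists (2^-1 * m + 2^-1 * C) => c cr.
rewrite big_ord_recl (le_trans (cvx_half _ _))// lerD// ler_wpM2l ?invr_ge0//.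
  by rewrite scalerA cvx_line// normrM ger0_norm// ler_pM2l// cr.
rewrite scaler_sumr; under eq_bigr do rewrite scalerA.
by apply: hC => i; rewrite normrM ger0_norm// ler_pM2l// cr.
Qed.

(** The upper bound at - u gives the lower bound at u by convexity at the midpoint 0. *)
Lemma cvx_bounded (r : R) : exists2 C, 0 <= C & forall u, N u <= r -> `|phi u| <= C.
Proof.
have [n [e [eo espan]]] := orthonormal_basis eV.
pose r' := Num.max r 1.
have r0 : 0 < r' by rewrite lt_max ltr01 orbT.
have [C hC] := cvx_box e r0.
have up u : N u <= r -> phi u <= C.
  move=> ur; rewrite (espan u); apply: hC => i.
  by rewrite (le_trans (orthonormal_coord_le eo _ _))// le_max ur.
exists (`|C| + 2 * `|phi 0|); first by rewrite addr_ge0// mulr_ge0.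
move=> u ur; have h1 := up _ ur; have := up (- u); rewrite enormN => /(_ ur) h2.
have := cvx_half (2^-1 *: u) (- (2^-1 *: u)); rewrite subrr scalerN !scalerA mulfV// scale1r => h3.
have := ler_norm C; have := ler_norm (- phi 0); rewrite normrN => h4 h5.
have := normr_ge0 (phi 0) => h6.
rewrite ler_norml; apply/andP; split; lra.
Qed.

(** Convexity on the segment from u through v to a point at distance 1 beyond v turns
    a bound on phi into a Lipschitz bound. *)
Lemma cvx_lipschitz (r : R) : exists2 L, 0 <= L &
  forall u v, N u <= r -> N v <= r -> `|phi u - phi v| <= L * N (u - v).
Proof.
have [C C0 hC] := cvx_bounded (r + 1).
have half u v : N u <= r -> N v <= r -> phi v - phi u <= 2 * C * N (u - v).
  move=> ur vr; have [->|uv] := eqVneq u v; first by rewrite !subrr enorm0 mulr0.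
  have d0 : 0 < N (u - v) by rewrite enorm_gt0 subr_eq0.
  set d := N (u - v) in d0 *.
  pose w := v + d^-1 *: (v - u).
  have wr : N w <= r + 1.
    rewrite (le_trans (enormD _ _ _))// lerD// enormZp ?invr_ge0 ?enorm_ge0//.
    by rewrite enorm_distC mulVf// gt_eqF.
  pose t := d / (1 + d).
  have t01 : 0 <= t <= 1.
    apply/andP; split; first by rewrite divr_ge0; lra.
    by rewrite ler_pdivrMr; lra.
  have := hphi w u t01.
  have -> : t *: w + (1 - t) *: u = v.
    rewrite /w scalerDr scalerA.
    have -> : t * d^-1 = 1 - t by rewrite /t; field; rewrite !gt_eqF//; lra.
    by rewrite -addrA -scalerDr subrK -scalerDl addrC subrK scale1r.
  have := hC w wr; have := hC u; rewrite (le_trans ur) ?lerDl// => /(_ isT) hu hw.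
  have td : t <= d by rewrite ler_pdivrMr; nra.
  have h1 := ler_norm (phi w); have h2 := ler_norm (- phi u); rewrite normrN in h2.
  have t0 : 0 <= t by move/andP: t01 => [].
  nra.
exists (2 * C); first by rewrite mulr_ge0.
move=> u v ur vr; have := half _ _ ur vr; have := half _ _ vr ur.
by rewrite enorm_distC => h1 h2; rewrite ler_norml; apply/andP; split; lra.
Qed.

Lemma cvx_continuous : continuous phi.
Proof.
move=> x; apply/(continuous_realP eV) => e e0.
have [L L0 hL] := cvx_lipschitz (N x + 1).
exists (Num.min 1 (e / (L + 1))); first by rewrite lt_min ltr01/= divr_gt0// ltr_pwDr.
move=> y; rewrite lt_min => /andP[y1 y2].
have h := enorm_le_add eV y x.
rewrite (le_lt_trans (hL _ _ _ _))//; try lra.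
rewrite ltr_pdivlMr ?ltr_pwDr// in y2; have := enorm_ge0 eV (y - x); nra.
Qed.

(** The constant works on a ball for the function, for its subgradients and, by
    monotonicity of slopes, for the decrease along rays leaving the ball. *)
Lemma cvx_ball (r : R) : exists2 L, 0 <= L & [/\
  forall u v, N u <= r -> N v <= r -> `|phi u - phi v| <= L * N (u - v),
  forall x z, N x <= r -> subgrad eV phi x z -> N z <= L
  & forall x w, N x <= r -> phi x - L * N w <= phi (x + w)].
Proof.
have [L L0 hL] := cvx_lipschitz (r + 1).
exists L => //; split.
- by move=> u v ur vr; apply: hL; lra.
- move=> x z xr /(_ (x + (N z)^-1 *: z)).
  have [->|z0] := eqVneq z 0; first by rewrite enorm0.
  have Nz : 0 < N z by rewrite enorm_gt0.
  rewrite addrAC subrr add0r innerZr -sqr_enorm expr2 mulKf ?gt_eqF// => h.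
  have N1 : N ((N z)^-1 *: z) = 1 by rewrite enormZ ger0_norm ?invr_ge0 ?ltW// mulVf// gt_eqF.
  have := hL (x + (N z)^-1 *: z) x; rewrite [_ + _ - x]addrAC subrr add0r N1 mulr1.
  move=> /(_ _ _)/wrap[]; [|lra|].
    by rewrite (le_trans (enormD _ _ _))// N1; lra.
  by move=> /(le_trans (ler_norm _)); lra.
- move=> x w xr; have [->|w0] := eqVneq w 0; first by rewrite enorm0 mulr0 subr0 addr0.
  have Nw : 0 < N w by rewrite enorm_gt0.
  set d := N w in Nw *.
  pose u := x - d^-1 *: w; pose t := (1 + d)^-1.
  have t01 : 0 <= t <= 1.
    by rewrite invr_ge0 invf_le1; [apply/andP; split|]; lra.
  have := hphi (x + w) u t01.
  have -> : t *: (x + w) + (1 - t) *: u = x.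
    rewrite /u scalerDr scalerBr scalerA.
    have -> : (1 - t) * d^-1 = t by rewrite /t; field; rewrite !gt_eqF//; lra.
    by rewrite addrACA subrr addr0 -scalerDl addrC subrK scale1r.
  have N1 : N (- (d^-1 *: w)) = 1.
    by rewrite enormN enormZ ger0_norm ?invr_ge0 ?ltW// mulVf// gt_eqF.
  have := hL u x; rewrite /u [_ - _ - x]addrAC subrr add0r N1 mulr1 => /(_ _ _)/wrap[]; [|lra|].
    by rewrite (le_trans (enormD _ _ _))// N1; lra.
  move=> /(le_trans (ler_norm _)); rewrite -/u => h1 h2.
  have e1 : 1 - t = t * d by rewrite /t; field; rewrite gt_eqF//; lra.
  have t0 : 0 < t by rewrite invr_gt0; lra.
  rewrite e1 in h2; rewrite -(ler_pM2l t0).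
  have e2 : t = 1 - t * d by lra.
  have : t * d * phi u <= t * d * (phi x + L).
    by rewrite ler_pM2l ?mulr_gt0//; lra.
  have -> : t * (phi x - L * d) = t * phi x - t * d * L by ring.
  have -> : t * phi x = phi x - t * d * phi x by rewrite {1}e2; ring.
  by rewrite mulrDr; lra.
Qed.

(** ** Subdifferentials *)

Lemma subgrad_closed (xs zs : nat -> V) x z :
  xs @ \oo --> x -> phi \o xs @ \oo --> phi x -> zs @ \oo --> z ->
  (forall n, subgrad eV phi (xs n) (zs n)) -> subgrad eV phi x z.
Proof.
move=> /(cvg_enormP eV) hx /cvgrPdist_lt hp /(cvg_enormP eV) hz hsub y.
set C := 3 + N (y - x) + N z.
have C0 : 0 < C by have := enorm_ge0 eV (y - x); have := enorm_ge0 eV z; rewrite /C; lra.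
apply/ler_addgt0Pr => e e0.
pose d := Num.min 1 (e / C).
have d0 : 0 < d by rewrite lt_min ltr01/= divr_gt0.
have [n [[h1 h2] h3]] := filter_ex (filterI (filterI (hx _ d0) (hp _ d0)) (hz _ d0)).
have := hsub n y.
have d1 : d <= 1 by rewrite ge_min lexx.
have dC : d * C <= e by rewrite -ler_pdivlMr// ge_min lexx orbT.
have -> : '[zs n, y - xs n] = '[z, y - x] + '[zs n - z, y - x] - '[zs n, xs n - x].
  by rewrite !innerE /=; ring.
have h4 := inner_CS_abs eV (zs n - z) (y - x).
have h5 := inner_CS_abs eV (zs n) (xs n - x).
have h6 : N (zs n) <= N z + 1 by rewrite (le_trans (enorm_le_add eV _ z))//; lra.
have h7 : N (zs n - z) * N (y - x) <= d * N (y - x).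
  by rewrite ler_wpM2r ?enorm_ge0// ltW.
have h8 : N (zs n) * N (xs n - x) <= (N z + 1) * d.
  by rewrite ler_pM ?enorm_ge0// ltW.
move: h4 h5 h2; rewrite /= !ler_norml ltr_norml => /andP[h4 h4'] /andP[h5 h5'] /andP[h2 h2'].
rewrite /C in dC; nra.
Qed.

(** A small step t from x towards y scales the o(t) error and the convexity bound
    alike, so the local lower bound becomes global. *)
Lemma cvx_regular_subgrad x z : regular_subdiff eV phi x z -> subgrad eV phi x z.
Proof.
move=> hreg y; have [->|yx] := eqVneq y x; first by rewrite subrr inner0r addr0.
have d0 : 0 < N (y - x) by rewrite enorm_gt0 subr_eq0.
apply/ler_addgt0Pr => e e0.
have ed0 : 0 < e / N (y - x) by exact: divr_gt0.
have /(nbhs_enormP eV)[d dd hd] := hreg _ ed0.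
pose t := Num.min 1 (d / (2 * N (y - x))).
have t0 : 0 < t by rewrite lt_min ltr01/= divr_gt0//; lra.
have t01 : 0 <= t <= 1 by rewrite ltW//= ge_min lexx.
have td : t * N (y - x) < d.
  have : t * (2 * N (y - x)) <= d by rewrite -ler_pdivlMr ?mulr_gt0// ge_min lexx orbT.
  by nra.
have ee : t *: y + (1 - t) *: x - x = t *: (y - x).
  by rewrite scalerBl scale1r scalerBr addrA addrAC addrK.
have := hd (t *: y + (1 - t) *: x); rewrite ee (enormZp _ _ (ltW t0)) innerZr.
move=> /(_ td) h; have := le_trans h (hphi y x t01).
have -> : e / N (y - x) * (t * N (y - x)) = e * t by field; rewrite gt_eqF.
move=> h'; rewrite -(ler_pM2l t0); lra.
Qed.

Lemma cvx_subgradP x z : limiting_subdiff eV phi x z <-> subgrad eV phi x z.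
Proof.
split=> [[xs [zs [hx hp hz hreg]]]|hz].
  by apply: (subgrad_closed hx hp hz) => n; exact: cvx_regular_subgrad.
exists (fun=> x), (fun=> z); split; try exact: cvg_cst.
move=> _ e e0; apply: nearW => y; have := hz y.
by have := mulr_ge0 (ltW e0) (enorm_ge0 eV (y - x)); lra.
Qed.

(** For a concave function the reflection of y through x carries the local lower
    bound to y, so that its limiting subgradients are opposites of subgradients. *)
Lemma concave_limiting_subgrad x z :
  limiting_subdiff eV (fun y => - phi y) x z -> subgrad eV phi x (- z).
Proof.
move=> [xs [zs [hx hp hz hreg]]].
apply: (@subgrad_closed xs (fun n => - zs n)) => //; first 2 last.
- move=> n; move: (xs n) (zs n) (hreg n) => {xs zs hx hp hz hreg}x {}z hreg y.
  have [->|yx] := eqVneq y x; first by rewrite subrr inner0r addr0.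
  have d0 : 0 < N (y - x) by rewrite enorm_gt0 subr_eq0.
  apply/ler_addgt0Pr => e e0.
  have ed0 : 0 < e / N (y - x) by exact: divr_gt0.
  have /(nbhs_enormP eV)[d dd hd] := hreg _ ed0.
  pose t := d / (2 * N (y - x)).
  have t0 : 0 < t by rewrite divr_gt0//; lra.
  have td : t * N (y - x) < d by rewrite /t; have -> : d / (2 * N (y - x)) * N (y - x) = d / 2; [by field; rewrite gt_eqF|lra].
  have := hd (x - t *: (y - x)).
  rewrite [_ - _ - x]addrAC subrr add0r enormN (enormZp _ _ (ltW t0)) => /(_ td).
  rewrite innerNr innerZr innerNl.
  have -> : e / N (y - x) * (t * N (y - x)) = e * t by field; rewrite gt_eqF.
  pose s := t / (1 + t).
  have s01 : 0 <= s <= 1.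
    apply/andP; split; first by rewrite divr_ge0; lra.
    by rewrite ler_pdivrMr; lra.
  have := hphi y (x - t *: (y - x)) s01.
  have -> : s *: y + (1 - s) *: (x - t *: (y - x)) = x.
    have -> : x - t *: (y - x) = (1 + t) *: x - t *: y.
      by rewrite scalerBr opprB addrA scalerDl scale1r addrAC.
    rewrite scalerBr !scalerA.
    have -> : (1 - s) * (1 + t) = 1 by rewrite /s; field; rewrite gt_eqF//; lra.
    have -> : (1 - s) * t = s by rewrite /s; field; rewrite gt_eqF//; lra.
    by rewrite scale1r addrC subrK.
  have sE : s * (1 + t) = t by rewrite /s; field; rewrite gt_eqF//; lra.
  have t1 : 0 < 1 + t by lra.
  move=> h1 h2; have := ler_wpM2r (ltW t1) h1.
  have -> : (s * phi y + (1 - s) * phi (x - t *: (y - x))) * (1 + t)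
    = s * (1 + t) * phi y + (1 + t - s * (1 + t)) * phi (x - t *: (y - x)) by ring.
  rewrite sE => h3.
  rewrite -(ler_pM2l t0); lra.
- have -> : phi \o xs = (fun n => - - phi (xs n)) by apply/funext => n /=; rewrite opprK.
  by rewrite -[phi x]opprK; exact: cvgN.
- exact: cvgN.
Qed.

End convex.

(** * The distance to the constraint set *)

Section distance.
Context {R : realType} {X Y : normedModType R} (P : problem X Y).
Hypotheses (Kcl : closed (K P)) (Kcvx : convex_set (K P : set (convex_lmodType Y))).
Hypotheses (K0 : K P !=set0) (hN : is_norm (tnorm P)).
Local Notation N := (enorm (eY P)).
Local Notation tN := (tnorm P).
Local Notation d := (Defs.dist P).

Lemma dist_lbound y : has_lbound [set tN (y - u) | u in K P].
Proof. by exists 0 => _ [u _ <-]; exact: is_norm_ge0. Qed.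

Lemma dist_le y u : K P u -> d y <= tN (y - u).
Proof. by move=> Ku; apply: ge_inf; [exact: dist_lbound|exists u]. Qed.

Lemma dist_ge0 y : 0 <= d y.
Proof.
have [u Ku] := K0.
apply: lb_le_inf; first by exists (tN (y - u)), u.
by move=> _ [v _ <-]; exact: is_norm_ge0.
Qed.

Lemma is_normN u : tN (- u) = tN u.
Proof. by have [_ FZ _] := hN; rewrite -scaleN1r FZ normrN1 mul1r. Qed.

Lemma tnorm_continuous (y : Y) : continuous (fun u => tN (y - u)).
Proof.
have [c c0 cN] := norm_equiv (eY P) hN; have [FD _ _] := hN.
move=> x; apply/(continuous_realP (eY P)) => e e0.
exists (e / c); first exact: divr_gt0.
move=> z; rewrite ltr_pdivlMr// mulrC => zx.
have h1 := FD (y - x) (x - z); rewrite addrA subrK in h1.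
have h2 := FD (y - z) (z - x); rewrite addrA subrK in h2.
have h3 : tN (x - z) = tN (z - x) by rewrite -is_normN opprB.
have := (cN (z - x)).1; rewrite ltr_norml => h4; apply/andP; split; lra.
Qed.

Lemma dist_attained y : exists2 u, K P u & d y = tN (y - u).
Proof.
have [c c0 cN] := norm_equiv (eY P) hN; have [u0 Ku0] := K0.
have [u [Ku minu]] : exists u, is_argmin (K P) (fun u => tN (y - u)) u.
  apply: (@coercive_min _ _ (eY P) _ _ u0 (N y + c * tN (y - u0))) => //.
    exact: tnorm_continuous.
  move=> u _ h; rewrite (le_trans (enorm_le_add (eY P) _ y))// lerD2l enorm_distC.
  by rewrite (le_trans (cN _).2)// ler_pM2l.
exists u => //; apply/eqP; rewrite eq_le dist_le//=.
by apply: lb_le_inf => [|_ [v Kv <-]]; [exists (tN (y - u)), u|exact: minu].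
Qed.

Lemma dist_tnorm y w : d (y + w) <= d y + tN w.
Proof.
have [u Ku ->] := dist_attained y; have [FD _ _] := hN.
by rewrite (le_trans (dist_le _ Ku))// addrAC.
Qed.

Lemma dist_lipschitz : exists2 c, 0 < c & forall y z, d y - d z <= c * N (y - z).
Proof.
have [c c0 cN] := norm_equiv (eY P) hN; exists c => // y z.
have := dist_tnorm z (y - z); rewrite addrC subrK.
by have := (cN (y - z)).1; lra.
Qed.

Lemma cvx_dist : cvx d.
Proof.
move=> t u v t01; have /andP[t0 t1] := t01.
have [a Ka ->] := dist_attained u; have [b Kb ->] := dist_attained v.
have [FD FZ _] := hN.
have Kab : K P (t *: a + (1 - t) *: b).
  by have := Kcvx (Itv01 t0 t1) (mem_set Ka) (mem_set Kb); rewrite inE.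
rewrite (le_trans (dist_le _ Kab))// opprD addrACA -!scalerBr.
by rewrite (le_trans (FD _ _))// !FZ !ger0_norm//; lra.
Qed.

(** A subgradient of rho dist has dual norm at most rho, and is therefore aligned
    with the segment from z to its nearest point in K. *)
Lemma subgrad_dist_normal rho z xi u : 0 <= rho -> K P u -> d z = tN (z - u) ->
  subgrad (eY P) (fun y => rho * d y) z xi -> normal_cone (eY P) (K P) u xi.
Proof.
move=> rho0 Ku dzu hxi; split=> // k Kk.
have h1 : inner (eY P) xi (z - u) <= rho * tN (z - u).
  have := hxi (z + (z - u)); rewrite [_ + _ - z]addrAC subrr add0r.
  have := ler_wpM2l rho0 (dist_tnorm z (z - u)); lra.
have := hxi k.
have -> : d k = 0.
  by apply/eqP; rewrite eq_le dist_ge0 andbT (le_trans (dist_le _ Kk))// subrr is_norm0.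
have -> : k - u = (k - z) + (z - u) by rewrite addrA subrK.
by rewrite innerDr mulr0 dzu; lra.
Qed.

Variables (th_cvx : cvx (th P)) (s : subproblem X) (rho0 : 0 <= srho s).

Lemma cvx_psi : cvx (psi P s).
Proof.
move=> t u v t01; rewrite /psi/=.
have := th_cvx u.1 v.1 t01; have := ler_wpM2l rho0 (cvx_dist u.2 v.2 t01).
lra.
Qed.

Lemma subgrad_psi z xi : subgrad (eZ P) (psi P s) z xi ->
  subgrad (eX P) (th P) z.1 xi.1 /\ subgrad (eY P) (fun y => srho s * d y) z.2 xi.2.
Proof.
move=> h; split=> y.
  have := h (y, z.2); rewrite /psi/= /prod_inner/= subrr inner0r; lra.
have := h (z.1, y); rewrite /psi/= /prod_inner/= subrr inner0r; lra.
Qed.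

End distance.

(** * Differential calculus in Euclidean norms *)

Section real_line.
Context {R : realType}.

Fact Ro_innerC (u v : R^o) : u * v = v * u :> R. Proof. exact: mulrC. Qed.
Fact Ro_innerDl (u v w : R^o) : (u + v) * w = u * w + v * w :> R. Proof. exact: mulrDl. Qed.
Fact Ro_innerZl (a : R) (u v : R^o) : (a *: u) * v = a * (u * v) :> R.
Proof. by rewrite mulrA. Qed.
Fact Ro_inner_gt0 (u : R^o) : u != 0 -> 0 < u * u :> R.
Proof. by move=> u0; rewrite -expr2 exprn_even_gt0. Qed.
Fact Ro_findim : exists (n : nat) (e : 'I_n -> R^o),
  forall u, exists c : 'I_n -> R, u = \sum_i c i *: e i.
Proof.
by exists 1%N, (fun=> 1) => u; exists (fun=> u); rewrite big_ord1 [RHS]mulr1.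
Qed.

Definition real_euclidean : euclidean (R^o : normedModType R) :=
  Euclidean Ro_innerC Ro_innerDl Ro_innerZl Ro_inner_gt0 Ro_findim.

Lemma enorm_real (u : R^o) : enorm real_euclidean u = `|u|.
Proof. by rewrite /enorm/= -expr2 sqrtr_sqr. Qed.

End real_line.

Section row_space.
Context {R : realType} {n : nat}.

Definition row_inner (u v : 'rV[R]_n) : R := \sum_i u 0 i * v 0 i.
Fact row_innerC u v : row_inner u v = row_inner v u.
Proof. by apply: eq_bigr => i _; rewrite mulrC. Qed.
Fact row_innerDl u v w : row_inner (u + v) w = row_inner u w + row_inner v w.
Proof. by rewrite -big_split; apply: eq_bigr => i _; rewrite mxE mulrDl. Qed.
Fact row_innerZl a u v : row_inner (a *: u) v = a * row_inner u v.
Proof. by rewrite mulr_sumr; apply: eq_bigr => i _; rewrite mxE mulrA. Qed.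
Fact row_inner_gt0 u : u != 0 -> 0 < row_inner u u.
Proof.
move=> u0; have ge0 i : 0 <= u 0 i * u 0 i by rewrite -expr2 sqr_ge0.
rewrite lt_neqAle sumr_ge0// andbT eq_sym; apply: contra u0 => /eqP h.
apply/eqP/rowP => i; rewrite mxE.
have /eqP : u 0 i * u 0 i = 0 by exact: (psumr_eq0P (fun i _ => ge0 i) h).
by rewrite mulf_eq0 orbb => /eqP.
Qed.
Fact row_findim : exists (m : nat) (e : 'I_m -> 'rV[R]_n),
  forall u, exists c : 'I_m -> R, u = \sum_i c i *: e i.
Proof.
exists n, (fun i => delta_mx 0 i) => u; exists (fun i => u 0 i).
exact: row_sum_delta.
Qed.

Definition row_euclidean : euclidean ('rV[R]_n : normedModType R) :=
  Euclidean row_innerC row_innerDl row_innerZl row_inner_gt0 row_findim.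

End row_space.

Section derivative.
Context {R : realType}.

Lemma is_derive_enorm (W : normedModType R) (eW : euclidean W) (c : R^o -> W) (x : R^o) (v : W) :
  (forall e : R, 0 < e -> exists2 d : R, 0 < d & forall k : R, `|k| < d ->
     enorm eW (c (k + x) - c x - k *: v) <= e * `|k|) ->
  is_derive x (1 : R^o) c v.
Proof.
move=> h.
have hc : (fun k : R => k^-1 *: ((c \o shift x) (k *: (1 : R^o)) - c x)) @ 0^' --> v.
  apply/(cvg_enormP eW) => e e0.
  have e20 : 0 < e / 2 by lra.
  have [d d0 hd] := h _ e20.
  near=> k.
  have k0 : k != 0 by near: k; exact: nbhs_dnbhs_neq.
  have kd : `|k| < d.
    near: k; apply: dnbhs0_lt; exact: d0.
  have := hd _ kd; rewrite /= [k *: (1 : R^o)]mulr1.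
  have -> : k^-1 *: (c (k + x) - c x) - v = k^-1 *: (c (k + x) - c x - k *: v).
    by rewrite [in RHS]scalerBr scalerA mulVf// scale1r.
  rewrite enormZ normfV => h1.
  rewrite (@le_lt_trans _ _ (e / 2))//; last lra.
  by rewrite mulrC ler_pdivrMr ?normr_gt0.
apply: DeriveDef; first by apply/cvg_ex; exists v.
by rewrite /derive; apply: cvg_lim.
Unshelve. all: by end_near. Qed.

Context {V W : normedModType R} (eV : euclidean V) (eW : euclidean W).

Lemma differentiable_enorm (F : V -> W) x : differentiable F x ->
  forall e, 0 < e -> exists2 d, 0 < d & forall k, enorm eV k < d ->
    enorm eW (F (k + x) - F x - 'd F x k) <= e * enorm eV k.
Proof.
move=> /diff_locallyP[_ dF] e e0.
have [a a0 aV] := norm_equiv eV (normr_is_norm (V := V)).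
have [b b0 bW] := norm_equiv eW (normr_is_norm (V := W)).
have e'0 : 0 < e / (a * b) by rewrite divr_gt0// mulr_gt0.
have := (eqaddoP _ _ _ _).1 dF _ e'0.
move=> /(nbhs_enormP eV)[d d0 hd]; exists d => // k kd.
have := hd k; rewrite subr0 => /(_ kd); rewrite /= !fctE/= opprD addrA => h.
have h1 := (bW (F (k + x) - F x - 'd F x k)).2.
rewrite (le_trans h1)// -ler_pdivlMl// (le_trans h)//.
have h2 := (aV k).1.
have -> : b^-1 * (e * enorm eV k) = e / (a * b) * (a * enorm eV k).
  by field; rewrite !gt_eqF.
by rewrite ler_pM2l.
Qed.

Lemma differential_add (F : V -> W) x u v : 'd F x (u + v) = 'd F x u + 'd F x v.
Proof. by rewrite linearD. Qed.

Lemma differential_scale (F : V -> W) x a u : 'd F x (a *: u) = a *: 'd F x u.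
Proof. by rewrite linearZ. Qed.

Lemma differential_coord (F : V -> W) x n (b : 'I_n -> V) (c : 'I_n -> R) :
  'd F x (\sum_i c i *: b i) = \sum_i c i *: 'd F x (b i).
Proof. by rewrite linear_sum; apply: eq_bigr => i _; rewrite linearZ. Qed.

(** Mean value inequality: project the increment on its own direction and use the
    real mean value theorem. *)
Lemma mean_value_le (F : V -> W) y z (l : W) (r : R) : 
  (forall t : R, 0 <= t <= 1 -> differentiable F (y + t *: (z - y))) ->
  (forall t : R, 0 < t < 1 -> enorm eW ('d F (y + t *: (z - y)) (z - y) - l) <= r) ->
  enorm eW (F z - F y - l) <= r.
Proof.
move=> dF hr; have [q qE] : exists q, q = F z - F y - l by eexists.
rewrite -qE.
have r0 : 0 <= r.
  by have := hr 2^-1; move=> /(_ _)/wrap[]; [apply/andP; split; lra|exact/le_trans/enorm_ge0].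
pose f t := inner eW (F (y + t *: (z - y))) q - t * inner eW l q.
pose df t := inner eW ('d F (y + t *: (z - y)) (z - y) - l) q.
have hf (t : R^o) : 0 <= t <= 1 -> is_derive t (1 : R^o) (f : R^o -> R^o) (df t).
  move=> t01; apply: (is_derive_enorm (eW := real_euclidean)) => e e0.
  pose C := enorm eV (z - y) * enorm eW q.
  have C0 : 0 <= C by rewrite mulr_ge0 ?enorm_ge0.
  have eC : 0 < e / (C + 1) by rewrite divr_gt0// ltr_pwDr.
  have [d d0 hd] := differentiable_enorm (dF t t01) eC.
  exists (d / (enorm eV (z - y) + 1)); first by rewrite divr_gt0// ltr_pwDr ?enorm_ge0.
  move=> k; rewrite ltr_pdivlMr ?ltr_pwDr ?enorm_ge0// => kd.
  have kd' : enorm eV (k *: (z - y)) < d.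
    by rewrite enormZ; have := normr_ge0 k; nra.
  have := hd _ kd'; set p := _ - _ - _ => hp.
  rewrite enorm_real.
  have -> : f (k + t) - f t - k *: (df t : R^o) = inner eW p q.
    have sE (a b : R) : a *: (b : R^o) = a * b by [].
    by rewrite /p /f /df differential_scale scalerDl !innerE !sE [k *: _ + (y + _)]addrCA; ring.
  rewrite (le_trans (inner_CS_abs _ _ _))//.
  rewrite (le_trans (ler_wpM2r (enorm_ge0 eW q) hp))// enormZ.
  have -> : e / (C + 1) * (`|k| * enorm eV (z - y)) * enorm eW q = C / (C + 1) * (e * `|k|).
    by rewrite /C; field; rewrite gt_eqF// ltr_pwDr.
  by rewrite ler_piMl ?mulr_ge0 ?(ltW e0)// ler_pdivrMr ?ltr_pwDr// mul1r lerDl.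
have [c /[!in_itv]/= c01 hc] : exists2 c, c \in `]0, 1[%R & f 1 - f 0 = df c * (1 - 0).
  apply: (@MVT _ f df) => //.
    by move=> t; rewrite in_itv/= => /andP[t0 t1]; apply: hf; rewrite !ltW.
  apply: (@derivable_within_continuous R R^o) => t; rewrite in_itv/= => t01.
  by have := hf t t01 => -[].
have qq : f 1 - f 0 = enorm eW q ^+ 2.
  have qq : inner eW q q = inner eW (F z) q - inner eW (F y) q - inner eW l q.
    by rewrite {1}qE !innerBl.
  by rewrite sqr_enorm qq /f !scale1r scale0r addr0 [y + (z - y)]addrC subrK; ring.
move: hc; rewrite qq subr0 mulr1 => hc.
have h1 := inner_CS eW ('d F (y + c *: (z - y)) (z - y) - l) q.
have [q0|q0] := eqVneq (enorm eW q) 0; first by rewrite q0.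
have q0' : 0 < enorm eW q by rewrite lt_neqAle eq_sym q0 enorm_ge0.
rewrite -(ler_pM2r q0') -expr2 hc (le_trans h1)// ler_pM2r//; exact: hr.
Qed.

Lemma ball_segment (x y z : V) d (t : R) : 0 <= t <= 1 ->
  enorm eV (y - x) < d -> enorm eV (z - x) < d -> enorm eV (y + t *: (z - y) - x) < d.
Proof.
move=> /andP[t0 t1] yd zd.
have -> : y + t *: (z - y) - x = (1 - t) *: (y - x) + t *: (z - x).
  have -> : z - x = (z - y) + (y - x) by rewrite addrA subrK.
  by rewrite (scalerDr t (z - y) (y - x)) addrCA -scalerDl subrK scale1r addrAC addrC.
rewrite (le_lt_trans (enormD _ _ _))// !enormZp ?subr_ge0//.
set m := Num.max (enorm eV (y - x)) (enorm eV (z - x)).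
have my : enorm eV (y - x) <= m by rewrite le_max lexx.
have mz : enorm eV (z - x) <= m by rewrite le_max lexx orbT.
have md : m < d by rewrite gt_max yd zd.
have t1' : 0 <= 1 - t by lra.
have := ler_wpM2l t1' my; have := ler_wpM2l t0 mz; lra.
Qed.

Lemma differential_lipschitz_taylor (F : V -> W) x (d C : R) :
  (forall y, enorm eV (y - x) < d -> differentiable F y) ->
  (forall y z w, enorm eV (y - x) < d -> enorm eV (z - x) < d ->
     enorm eW ('d F z w - 'd F y w) <= C * enorm eV (z - y) * enorm eV w) ->
  0 <= C ->
  forall y z, enorm eV (y - x) < d -> enorm eV (z - x) < d ->
    enorm eW (F z - F y - 'd F y (z - y)) <= C * enorm eV (z - y) ^+ 2.
Proof.
move=> dF dL C0 y z yd zd; apply: mean_value_le => t.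
  by move=> t01; apply: dF; exact: ball_segment.
move=> /andP[t0 t1]; have t01 : 0 <= t <= 1 by rewrite !ltW.
rewrite (le_trans (dL _ _ _ yd (ball_segment t01 yd zd)))//.
rewrite addrAC subrr add0r (enormZp _ _ (ltW t0)) expr2 mulrA ler_wpM2r ?enorm_ge0//.
by rewrite ler_wpM2l// ler_piMl ?enorm_ge0// ltW.
Qed.

(** Pointwise continuity of the differential on a basis is uniform continuity in the
    direction. *)
Lemma Cn1_diff_cont (U : set V) (F : V -> W) x : open U -> U x -> Cn 1 U F ->
  forall e, 0 < e -> \forall y \near x, U y /\
    forall w, enorm eW ('d F y w - 'd F x w) <= e * enorm eV w.
Proof.
move=> oU Ux [_ cF] e e0; have [n [b [bo bspan]]] := orthonormal_basis eV.
have e'0 : 0 < e / (n%:R + 1) by rewrite divr_gt0// ltr_pwDr.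
have hb : \forall y \near x, forall i : 'I_n, enorm eW ('d F y (b i) - 'd F x (b i)) < e / (n%:R + 1).
  apply: filter_forall => i; have /(cvg_enormP eW) := cF (b i) x Ux; exact.
near=> y; split; first by near: y; exact: open_nbhs_nbhs.
have hy : forall i : 'I_n, enorm eW ('d F y (b i) - 'd F x (b i)) < e / (n%:R + 1) by near: y.
move=> w; rewrite {1 2}(bspan w) !differential_coord -sumrB.
rewrite (le_trans (enorm_sum _ _ _ _))//.
apply: (@le_trans _ _ (\sum_(i < n) e / (n%:R + 1) * enorm eV w)).
  apply: ler_sum => i _; rewrite -scalerBr enormZ mulrC.
  by rewrite ler_pM ?enorm_ge0 ?normr_ge0 ?orthonormal_coord_le// ltW.
rewrite sumr_const card_ord -(mulr_natl (_ * _)) mulrA ler_wpM2r ?enorm_ge0//.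
by rewrite mulrA ler_pdivrMr ?ltr_pwDr// mulrC ler_pM2l// lerDl.
Unshelve. all: by end_near. Qed.

Lemma Cn1_strict_diff (U : set V) (F : V -> W) x : open U -> U x -> Cn 1 U F ->
  forall e, 0 < e -> exists2 d, 0 < d & forall y z,
    enorm eV (y - x) < d -> enorm eV (z - x) < d ->
    enorm eW (F z - F y - 'd F x (z - y)) <= e * enorm eV (z - y).
Proof.
move=> oU Ux CF e e0; have /(nbhs_enormP eV)[d d0 hd] := Cn1_diff_cont oU Ux CF e0.
exists d => // y z yd zd; apply: mean_value_le => t.
  by move=> t01; apply: CF.1; exact: (hd _ (ball_segment t01 yd zd)).1.
move=> /andP[t0 t1]; have t01 : 0 <= t <= 1 by rewrite !ltW.
exact: (hd _ (ball_segment t01 yd zd)).2.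
Qed.

Lemma Cn1_lipschitz (U : set V) (F : V -> W) x : open U -> U x -> Cn 1 U F ->
  exists2 C, 0 < C & exists2 d, 0 < d & forall y z,
    enorm eV (y - x) < d -> enorm eV (z - x) < d ->
    enorm eW (F z - F y) <= C * enorm eV (z - y).
Proof.
move=> oU Ux CF; have [d d0 hd] := Cn1_strict_diff oU Ux CF ltr01.
have [C C0 hC] := linear_bounded eV eW (differential_add F x) (differential_scale F x).
exists (C + 1); first by rewrite addr_gt0.
exists d => // y z yd zd; rewrite (le_trans (enorm_le_add eW _ ('d F x (z - y))))//.
by rewrite mulrDl lerD//; exact: hd.
Qed.

End derivative.

Lemma finite_min (R : realType) n (f : 'I_n -> R) : (forall i, 0 < f i) ->
  exists2 d, 0 < d & forall i, d <= f i.
Proof.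
elim: n f => [|n IH] f f0; first by exists 1 => // -[].
have [d d0 hd] := IH (fun i => f (lift ord0 i)) (fun i => f0 _).
exists (Num.min d (f ord0)); first by rewrite lt_min d0 f0.
by move=> i; case: (unliftP ord0 i) => [j ->|->]; rewrite ge_min ?hd ?lexx ?orbT.
Qed.

Section second_order.
Context {R : realType} {V W : normedModType R} (eV : euclidean V) (eW : euclidean W).

(** On the vectors b i of a basis the maps 'd F _ (b i) are C^1, hence Lipschitz. *)
Lemma Cn2_differential_lipschitz (U : set V) (F : V -> W) x : open U -> U x -> Cn 2 U F ->
  exists2 C, 0 < C & exists2 d, 0 < d &
    (forall y, enorm eV (y - x) < d -> differentiable F y) /\
    forall y z w, enorm eV (y - x) < d -> enorm eV (z - x) < d ->
      enorm eW ('d F z w - 'd F y w) <= C * enorm eV (z - y) * enorm eV w.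
Proof.
move=> oU Ux [dF CF]; have [n [b [bo bspan]]] := orthonormal_basis eV.
have /(nbhs_enormP eV)[d0 d00 hd0] : nbhs x U by exact: open_nbhs_nbhs.
have /choice[Cd hCd] : forall i : 'I_n, exists p : R * R, [/\ 0 < p.1, 0 < p.2 &
    forall y z, enorm eV (y - x) < p.2 -> enorm eV (z - x) < p.2 ->
    enorm eW ('d F z (b i) - 'd F y (b i)) <= p.1 * enorm eV (z - y)].
  move=> i; have [C C0 [d d1 hd]] := Cn1_lipschitz eV eW oU Ux (CF (b i)).
  by exists (C, d).
exists (\sum_i (Cd i).1 + 1).
  by rewrite ltr_pwDr// sumr_ge0// => i _; have [/ltW] := hCd i.
have Cd0 i : 0 < (Cd i).2 by have [] := hCd i.
have [d1 d10 hd1] := finite_min Cd0.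
exists (Num.min d0 d1); first by rewrite lt_min d00.
split=> [y|y z w]; first by rewrite lt_min => /andP[yd _]; apply: dF; exact: hd0.
rewrite !lt_min => /andP[_ yd] /andP[_ zd].
rewrite {1 2}(bspan w) !differential_coord -sumrB (le_trans (enorm_sum _ _ _ _))//.
rewrite -mulrA mulrDl mul1r ler_wpDr ?mulr_ge0 ?enorm_ge0//.
rewrite mulr_suml; apply: ler_sum => i _.
rewrite -scalerBr enormZ mulrC mulrA.
have [p1 p2 hp] := hCd i.
by rewrite ler_pM ?enorm_ge0 ?orthonormal_coord_le//; apply: hp; exact: lt_le_trans (hd1 i).
Qed.

End second_order.

(** * Tangent spaces of a submanifold *)

Section perturbation.
Context {R : realType} {W : normedModType R} (eW : euclidean W).
Local Notation N := (enorm eW).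

(** Where N (f s) is minimal on the ball, the Newton step s - f s would halve it. *)
Lemma near_identity_zero (f : W -> W) (r : R) :
  (forall s s', N s <= r -> N s' <= r -> N (f s - f s' - (s - s')) <= 2^-1 * N (s - s')) ->
  5 * N (f 0) <= r -> exists2 s, N s <= r & f s = 0.
Proof.
move=> hf f0r; have f00 := enorm_ge0 eW (f 0).
have r0 : 0 <= r by lra.
pose A := [set s | N s <= r].
have lip s s' : A s -> A s' -> N (f s - f s') <= 3 / 2 * N (s - s').
  move=> As As'; have := hf _ _ As As'.
  have := enorm_le_add eW (f s - f s') (s - s'); lra.
have clA : closed A.
  apply: (@closed_comp _ _ N [set y | y <= r]); last exact: closed_le.
  by move=> x _; exact: continuous_enorm.
have cA : compact A by exact: (@compact_enorm _ _ eW A r clA (fun u Au => Au)).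
have A0 : A 0 by rewrite /A/= enorm0.
have cf : {within A, continuous (N \o f)}.
  apply/subspace_continuousP => s As; apply/cvgrPdist_lt => e e0.
  have e2 : 0 < e / 2 by lra.
  have := near_enorm eW s e2; apply: filterS => s' ss' As' /=.
  have h := lip _ _ As As'; have h' := lip _ _ As' As.
  have k := enorm_le_add eW (f s) (f s'); have k' := enorm_le_add eW (f s') (f s).
  rewrite (enorm_distC eW s s') in h.
  change (`|N (f s) - N (f s')| < e).
  rewrite (enorm_distC eW (f s) (f s')) in k h.
  rewrite ltr_norml; apply/andP; split; lra.
have [s /[!inE] As smin] := @compact_EVT_min _ R (N \o f) A (ex_intro _ 0 A0) cA cf.
have /= s0 := smin 0 (mem_set A0).
have sN : N s <= 4 * N (f 0).
  have := hf _ _ As A0; rewrite subr0 => h.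
  have := enorm_le_add eW s (f s - f 0); rewrite (enorm_distC eW s).
  have := enormB eW (f s) (f 0); lra.
exists s => //; apply/eqP; rewrite -(enorm_eq0 eW).
have As' : A (s - f s).
  by rewrite /A/= (le_trans (enormB _ _ _))//; lra.
have := smin _ (mem_set As'); have := hf _ _ As' As.
rewrite /= [s - f s - s]addrAC subrr add0r opprK subrK enormN => h1 h2.
by rewrite eq_le enorm_ge0 andbT; lra.
Qed.

(** A zero of the perturbed identity s |-> B s - b solves the equation. *)
Lemma near_identity_onto (B : W -> W) (b : W) :
  (forall u v, B (u + v) = B u + B v) -> (forall a u, B (a *: u) = a *: B u) ->
  (forall s, N (B s - s) <= 2^-1 * N s) -> exists s, B s = b.
Proof.
move=> BD BZ hB.
have B0 : B 0 = 0 by rewrite -{1}(scale0r (0 : W)) BZ scale0r.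
have [s s' _ _||s _ Bs] := @near_identity_zero (fun s => B s - b) (5 * N b).
- rewrite opprB addrA subrK.
  have -> : B s - B s' = B (s - s') by rewrite -(scaleN1r (B s')) -BZ -BD scaleN1r.
  exact: hB.
- by rewrite B0 sub0r enormN.
- by exists s; apply/eqP; rewrite -subr_eq0 Bs.
Qed.

Lemma near_identity_inverse (B : W -> W) s : N (B s - s) <= 2^-1 * N s -> N s <= 2 * N (B s).
Proof. by have := enorm_le_add eW s (B s); rewrite (enorm_distC eW s); lra. Qed.

End perturbation.

Lemma diff_curveE (R : realType) (V : normedModType R) (c : R^o -> V) (t : R^o) v :
  is_derive t (1 : R^o) c v -> differentiable c t /\ forall w : R^o, 'd c t w = w *: v.
Proof.
move=> [dc hc]; have dfc : differentiable c t by apply/derivable1_diffP.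
split=> // w; rewrite -{1}[w]mulr1 linearZ/=; congr (_ *: _).
by rewrite -hc deriveE.
Qed.

Section implicit_curve.
Context {R : realType} {V W : normedModType R} (eV : euclidean V) (eW : euclidean W).
Variables (U : set V) (F : V -> W) (x : V).
Hypotheses (oU : open U) (Ux : U x) (CF : Cn 1 U F) (Fx : F x = 0).
Hypothesis surj : forall w, exists v, 'd F x v = w.

Lemma right_inverse : exists J : W -> V, [/\ forall u v, J (u + v) = J u + J v,
  forall a u, J (a *: u) = a *: J u & forall w, 'd F x (J w) = w].
Proof.
have [n [b [bo bspan]]] := orthonormal_basis eW.
have /choice[j hj] : forall i : 'I_n, exists v, 'd F x v = b i by move=> i; exact: surj.
exists (fun w => \sum_i inner eW w (b i) *: j i); split.
- by move=> u v; rewrite -big_split; apply: eq_bigr => i _; rewrite innerDl scalerDl.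
- by move=> a u; rewrite scaler_sumr; apply: eq_bigr => i _; rewrite innerZl scalerA.
- move=> w; rewrite differential_coord [RHS]bspan; apply: eq_bigr => i _.
  by rewrite hj.
Qed.

(** The implicit function theorem along a line: x + t v is corrected in a complement
    of the kernel so as to stay in the zero set. The correction is Lipschitz in t; its derivative
    solves the linearized equation, whose inverse is bounded near x. *)
Lemma implicit_curve v : 'd F x v = 0 -> exists (c : R^o -> V) (e : R),
  [/\ 0 < e, Cn 1 [set t : R^o | `|t| < e] c,
      forall t : R^o, `|t| < e -> U (c t) /\ F (c t) = 0,
      c 0 = x & 'd c 0 (1 : R^o) = v].
Proof.
move=> Lv; have [J [JD JZ LJ]] := right_inverse.
have J0 : J 0 = 0 by rewrite -(scale0r 0) JZ scale0r.
have JB u w : J (u - w) = J u - J w by rewrite -(scaleN1r w) JD JZ scaleN1r.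
have [kap kap0 Jk] := linear_bounded eW eV JD JZ.
(* eta keeps the derivative on the complement within 1/2 of the identity; r and e keep
   the curve in the ball of radius d on which it does so. *)
pose eta := (2 * (kap + 1))^-1.
have k1 : 0 < kap + 1 by lra.
have eta0 : 0 < eta by rewrite invr_gt0 mulr_gt0.
have etak : eta * kap <= 2^-1.
  rewrite /eta invfM -mulrA ler_piMr ?invr_ge0// mulrC ler_pdivrMr//; lra.
have [d1 d10 sd] := Cn1_strict_diff eV eW oU Ux CF eta0.
have /(nbhs_enormP eV)[d2 d20 hd2] := Cn1_diff_cont eV eW oU Ux CF eta0.
pose d := Num.min d1 d2.
have d0 : 0 < d by rewrite lt_min d10.
pose r := d / (2 * (kap + 1)).
have r0 : 0 < r by rewrite divr_gt0// mulr_gt0.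
have rk : kap * r < d / 2.
  have -> : kap * r = d / 2 * (kap / (kap + 1)) by rewrite /r; field; rewrite gt_eqF.
  by rewrite gtr_pMr ?divr_gt0// ltr_pdivrMr// mul1r ltrDl.
pose Nv := enorm eV v; have Nv0 : 0 <= Nv := enorm_ge0 _ _.
have N2 : 0 < 2 * Nv + 1 by lra.
pose e := Num.min (d / (2 * (Nv + 1))) (r / (5 * eta * (Nv + 1))).
have v1 : 0 < Nv + 1 by lra.
have e0 : 0 < e by rewrite lt_min !divr_gt0// !mulr_gt0.
pose p (t : R) (s : W) := x + (t *: v + J s).
have pB t s t' s' : p t s - p t' s' = (t - t') *: v + J (s - s').
  by rewrite /p opprD addrACA subrr add0r opprD addrACA -scalerBl -JB.
have pd t s : `|t| < e -> enorm eW s <= r -> enorm eV (p t s - x) < d.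
  move=> te sr; rewrite /p addrAC subrr add0r (le_lt_trans (enormD _ _ _))// enormZ.
  have h1 : `|t| * (2 * (Nv + 1)) < d by rewrite -ltr_pdivlMr ?mulr_gt0// (lt_le_trans te)// ge_min lexx.
  have h2 := Jk s; have h3 : kap * enorm eW s <= kap * r by rewrite ler_pM2l.
  by have := normr_ge0 t; rewrite -/Nv; nra.
have pd1 t s : `|t| < e -> enorm eW s <= r -> enorm eV (p t s - x) < d1.
  by move=> te sr; rewrite (lt_le_trans (pd _ _ te sr))// ge_min lexx.
have pd2 t s : `|t| < e -> enorm eW s <= r -> enorm eV (p t s - x) < d2.
  by move=> te sr; rewrite (lt_le_trans (pd _ _ te sr))// ge_min lexx orbT.
have LpB t s t' s' : 'd F x (p t s - p t' s') = s - s'.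
  by rewrite pB differential_add differential_scale Lv scaler0 add0r LJ.
have est t s t' s' : `|t| < e -> enorm eW s <= r -> `|t'| < e -> enorm eW s' <= r ->
    enorm eW (F (p t s) - F (p t' s') - (s - s'))
      <= eta * Nv * `|t - t'| + 2^-1 * enorm eW (s - s').
  move=> te sr te' sr'; rewrite -{1}(LpB t s t' s').
  rewrite (le_trans (sd _ _ (pd1 _ _ te' sr') (pd1 _ _ te sr)))// pB.
  have h1 := enormD eV ((t - t') *: v) (J (s - s')); rewrite enormZ -/Nv in h1.
  have h2 := Jk (s - s'); have h3 := enorm_ge0 eW (s - s').
  have h4 : eta * enorm eV ((t - t') *: v + J (s - s')) <= eta * (`|t - t'| * Nv + kap * enorm eW (s - s')).
    by rewrite ler_pM2l//; lra.
  by have h5 := ler_wpM2r h3 etak; lra.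
have /choice[s hs] : forall t : R, exists s, `|t| < e -> enorm eW s <= r /\ F (p t s) = 0.
  move=> t; have [te|te] := ltP `|t| e; last by exists 0.
  have [s1 s2 sr1 sr2||s1 sr1 Fs] := @near_identity_zero R W eW (fun s => F (p t s)) r.
  - by have := est t s1 t s2 te sr1 te sr2; rewrite subrr normr0 mulr0 add0r.
  - have h0 : enorm eW 0 <= r by rewrite enorm0 ltW.
    have e00 : `|0 : R| < e by rewrite normr0.
    have := est t 0 0 0 te h0 e00 h0.
    have -> : p 0 0 = x by rewrite /p scale0r J0 !addr0.
    rewrite Fx !subr0 enorm0 mulr0 addr0 => h1.
    have : `|t| * (5 * eta * (Nv + 1)) < r.
      by rewrite -ltr_pdivlMr ?mulr_gt0// (lt_le_trans te)// ge_min lexx orbT.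
    by have := normr_ge0 t; nra.
  - by exists s1.
have [c cP] : exists c : R^o -> V, forall t, c t = p t (s t) by eexists.
have cB t t' : c t - c t' = (t - t') *: v + J (s t - s t') by rewrite !cP pB.
have sr t : `|t| < e -> enorm eW (s t) <= r by move=> /hs[].
have Fc t : `|t| < e -> F (c t) = 0 by rewrite cP => /hs[].
have Uc t : `|t| < e -> U (c t).
  by rewrite cP => te; exact: (hd2 _ (pd2 _ _ te (sr _ te))).1.
have slip t t' : `|t| < e -> `|t'| < e -> enorm eW (s t - s t') <= 2 * eta * Nv * `|t - t'|.
  move=> te te'; have := est _ _ _ _ te (sr _ te) te' (sr _ te').
  by rewrite -!cP !Fc// subrr sub0r enormN; lra.
have clip t t' : `|t| < e -> `|t'| < e -> enorm eV (c t - c t') <= (2 * Nv) * `|t - t'|.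
  move=> te te'; rewrite cB (le_trans (enormD _ _ _))// enormZ -/Nv.
  have h1 := Jk (s t - s t'); have h2 := slip _ _ te te'.
  have h3 : kap * enorm eW (s t - s t') <= kap * (2 * eta * Nv * `|t - t'|) by rewrite ler_pM2l.
  have h4 : 0 <= Nv * `|t - t'| by rewrite mulr_ge0.
  by have h5 := ler_wpM2r h4 etak; lra.
have Bid t w : `|t| < e -> enorm eW ('d F (c t) (J w) - w) <= 2^-1 * enorm eW w.
  rewrite cP => te; have [_ h] := hd2 _ (pd2 _ _ te (sr _ te)).
  have := h (J w); rewrite LJ => h1; rewrite (le_trans h1)//.
  have := Jk w; have := enorm_ge0 eW w => h2 h3.
  have h5 := ler_wpM2r h2 etak.
  by have h4 : eta * enorm eV (J w) <= eta * (kap * enorm eW w); [rewrite ler_pM2l|lra].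
have /choice[g hg] : forall t : R, exists g, `|t| < e -> 'd F (c t) (v + J g) = 0.
  move=> t; have [te|te] := ltP `|t| e; last by exists 0.
  have [||w|g gP] := @near_identity_onto R W eW (fun w => 'd F (c t) (J w)) (- 'd F (c t) v).
  - by move=> u w; rewrite JD differential_add.
  - by move=> a u; rewrite JZ differential_scale.
  - exact: Bid.
  - by exists g => _; rewrite differential_add gP subrr.
have inv t w : `|t| < e -> enorm eW w <= 2 * enorm eW ('d F (c t) (J w)).
  by move=> te; apply: (@near_identity_inverse R W eW (fun w => 'd F (c t) (J w))); exact: Bid.
have dc (t : R^o) : `|t| < e -> is_derive t (1 : R^o) c (v + J (g t)).
  move=> te; apply: (is_derive_enorm (eW := eV)) => ep ep0.
  pose a := ep / (2 * kap * (2 * Nv + 1)).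
  have a0 : 0 < a by rewrite divr_gt0// !mulr_gt0//; lra.
  have dFc : differentiable F (c t) by apply: CF.1; exact: Uc.
  have [d3 d30 hd3] := differentiable_enorm eV eW dFc a0.
  pose d4 := Num.min (e - `|t|) (d3 / (2 * Nv + 1)).
  have d40 : 0 < d4 by rewrite lt_min subr_gt0 te divr_gt0.
  exists d4 => // k; rewrite lt_min => /andP[k1' k2].
  have tke : `|k + t| < e by rewrite (le_lt_trans (ler_normD _ _))// -ltrBrDr.
  have kN := normr_ge0 k.
  have ck : enorm eV (c (k + t) - c t) <= 2 * Nv * `|k|.
    by have := clip _ _ tke te; rewrite addrK.
  have ckd : enorm eV (c (k + t) - c t) < d3.
    move: k2; rewrite ltr_pdivlMr// => k2.
    by rewrite (le_lt_trans ck)// (le_lt_trans _ k2)// mulrC ler_wpM2l// lerDl.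
  have := hd3 _ ckd; rewrite subrK !Fc// subrr sub0r enormN => h1.
  have cE : c (k + t) - c t - k *: (v + J (g t)) = J (s (k + t) - s t - k *: g t).
    by rewrite cB addrK scalerDr opprD addrACA subrr add0r -JZ -JB.
  have h2 := inv t (s (k + t) - s t - k *: g t) te; rewrite -cE in h2.
  rewrite differential_add -scaleN1r !differential_scale hg// !scaler0 addr0 in h2.
  rewrite cE (le_trans (Jk _))//.
  have h3 : kap * enorm eW (s (k + t) - s t - k *: g t) <= kap * (2 * (a * (2 * Nv * `|k|))).
    rewrite ler_pM2l// (le_trans h2)// ler_pM2l// (le_trans h1)// ler_pM2l//.
  rewrite (le_trans h3)//.
  have -> : kap * (2 * (a * (2 * Nv * `|k|))) = ep * `|k| * (2 * Nv / (2 * Nv + 1)).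
    by rewrite /a; field; rewrite !gt_eqF.
  by rewrite ler_piMr ?mulr_ge0 ?(ltW ep0)// ler_pdivrMr// mul1r lerDl.
have s0 : s 0 = 0.
  have e00 : `|0 : R| < e by rewrite normr0.
  have h0 : enorm eW 0 <= r by rewrite enorm0 ltW.
  have := est 0 (s 0) 0 0 e00 (sr _ e00) e00 h0.
  have -> : p 0 0 = x by rewrite /p scale0r J0 !addr0.
  rewrite -cP Fc// Fx !subrr !sub0r normr0 mulr0 add0r subr0 enormN => h1.
  by apply/eqP; rewrite -(enorm_eq0 eW) eq_le enorm_ge0 andbT; lra.
have c0 : c 0 = x by rewrite cP s0 /p scale0r J0 !addr0.
have g0 : g 0 = 0.
  have e00 : `|0 : R| < e by rewrite normr0.
  by have := hg 0 e00; rewrite c0 differential_add Lv add0r LJ.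
have dcE t (te : `|t| < e) (w : R^o) : 'd c t w = w *: (v + J (g t)) := (diff_curveE (dc t te)).2 w.
exists c, e; split=> //.
- split=> [t te|w t te]; first exact: (diff_curveE (dc t te)).1.
  apply/(continuous_enormP (@real_euclidean R) eV) => ep ep0.
  pose a := ep / (2 * kap * (`|w| + 1)).
  have w1 : 0 < `|w| + 1 by rewrite ltr_wpDl.
  have a0 : 0 < a by rewrite divr_gt0// !mulr_gt0.
  have := CF.2 (v + J (g t)) (c t) (Uc t te).
  move=> /(continuous_enormP eV eW)/(_ _ a0)[d3 d30 hd3].
  pose d4 := Num.min (e - `|t|) (d3 / (2 * Nv + 1)).
  have d40 : 0 < d4 by rewrite lt_min subr_gt0 te divr_gt0.
  exists d4 => // t'; rewrite enorm_real lt_min => /andP[k1' k2].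
  have te' : `|t'| < e by rewrite -[t'](subrK t) (le_lt_trans (ler_normD _ _))// -ltrBrDr.
  have E := f_equal2 (fun a b => a - b) (dcE t' te' w) (dcE t te w).
  rewrite E -scalerBr opprD addrACA subrr add0r -JB enormZ.
  have ckd : enorm eV (c t' - c t) < d3.
    rewrite (le_lt_trans (clip _ _ te' te))//; move: k2; rewrite ltr_pdivlMr//.
    by apply: le_lt_trans; rewrite mulrC ler_wpM2l// lerDl.
  have := hd3 _ ckd; rewrite hg// subr0 => h1.
  have h2 := inv t' (g t' - g t) te'.
  have e1 : 'd F (c t') (J (g t' - g t)) = - 'd F (c t') (v + J (g t)).
    have -> : J (g t' - g t) = (v + J (g t')) - (v + J (g t)).
      by rewrite opprD addrACA subrr add0r JB.
    by rewrite differential_add -scaleN1r differential_scale hg// add0r scaleN1r.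
  rewrite e1 enormN in h2.
  have h3 := Jk (g t' - g t).
  have h4 : kap * enorm eW (g t' - g t) < kap * (2 * a) by rewrite ltr_pM2l// (le_lt_trans h2)// ltr_pM2l.
  have h5 : enorm eV (J (g t' - g t)) < kap * (2 * a) := le_lt_trans h3 h4.
  have h6 : `|w| * enorm eV (J (g t' - g t)) <= `|w| * (kap * (2 * a)).
    by rewrite ler_wpM2l// ltW.
  rewrite (le_lt_trans h6)//.
  have -> : `|w| * (kap * (2 * a)) = ep * (`|w| / (`|w| + 1)).
    by rewrite /a; field; rewrite !gt_eqF.
  by rewrite gtr_pMr// ltr_pdivrMr// mul1r ltrDl.
- by move=> t te; split; [exact: Uc|exact: Fc].
- have e00 : `|0 : R^o| < e by rewrite normr0.
  by rewrite (dcE 0 e00) scale1r g0 J0 addr0.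
Qed.

End implicit_curve.

Section tangent_space.
Context {R : realType} {V : normedModType R} (eV : euclidean V).
Variable M : set V.
Hypothesis hM : C1_submanifold M.

(** Differentiating F along a curve in M gives one inclusion, and the curves of the
    implicit function theorem the other. *)
Lemma tangent_kernel x : M x -> exists (c : nat) (F : V -> 'rV[R]_c),
  differentiable F x /\ tangent M x = [set v | 'd F x v = 0].
Proof.
have [c hc] := hM => Mx; have [U [F [oU Ux CF surj MF]]] := hc x Mx.
have dF : differentiable F x by exact: CF.1.
have Fx : F x = 0 by apply/MF.
exists c, F; split=> //; apply/seteqP; split=> v /=.
  move=> [k [e [e0 [Ck _] Mk k0 kv]]].
  have e00 : `|0 : R^o| < e by rewrite normr0.
  have dk : differentiable k (0 : R^o) by exact: Ck.
  have := diff_comp dk; rewrite k0 => /(_ _ F dF) h.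
  have -> : 'd F x v = 'd (F \o k) (0 : R^o) (1 : R^o) by rewrite h /= kv.
  rewrite -deriveE; last by apply: differentiable_comp => //; rewrite k0.
  rewrite -(derive_cst (0 : 'rV[R]_c) (0 : R^o) (1 : R^o)).
  apply: near_eq_derive.
  have kU : \forall t \near (0 : R^o), U (k t).
    have := differentiable_continuous dk; apply; rewrite k0.
    exact: open_nbhs_nbhs.
  have ke : \forall t \near (0 : R^o), `|t| < e.
    by apply/(nbhs_enormP (@real_euclidean R)); exists e => // t; rewrite enorm_real subr0.
  near=> t => /=.
  have Ut : U (k t) by near: t.
  by apply/(MF _ Ut); apply: Mk; near: t.
move=> Fv; have [k [e [e0 Ck hk k0 kv]]] :=
  implicit_curve eV (@row_euclidean R c) oU Ux CF Fx (surj _ Ux) Fv.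
exists k, e; split=> // t te; have [Uk Fk] := hk t te; exact/(MF _ Uk).
Unshelve. all: by end_near. Qed.

Lemma tangent_subspace x : M x -> linear_subspace (tangent M x) /\ closed (tangent M x).
Proof.
move=> Mx; have [c [F [dF ->]]] := tangent_kernel Mx; split.
  split=> [|u v /= Fu Fv|a u /= Fu]; first by rewrite /= linear0.
    by rewrite linearD Fu Fv addr0.
  by rewrite linearZ/= Fu scaler0.
apply: (@closed_comp _ _ ('d F x) [set 0]); last first.
  by apply: accessible_closed_set1; apply: hausdorff_accessible; exact: norm_hausdorff.
by move=> u _; exact: diff_continuous.
Qed.

End tangent_space.

(** * Uniform constants on compact sets *)

(** By monotonicity in n the largest constant of a finite subcover serves everywhere. *)
Lemma compact_uniform (T : topologicalType) (D : set T) (Q : nat -> T -> Prop) :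
  compact D -> (forall n m x, (n <= m)%N -> Q n x -> Q m x) ->
  (forall x, D x -> exists n, \forall y \near x, Q n y) ->
  exists n, forall x, D x -> Q n x.
Proof.
move=> cD mono loc.
have [n _ hn] : \forall n \near \oo, D `<=` Q n.
  apply: (compact_near_coveringP _).1 cD _ _ _ _ _ => x /loc[n hn].
  exists ([set y | Q n y], [set m | (n <= m)%N]) => /=.
    by split=> //; exists n.
  by move=> [y m] [/= Qy nm]; exact: mono Qy.
by exists n => x Dx; exact: (hn n (leqnn n)).
Qed.

Section retraction.
Context {R : realType} {V : normedModType R} (eV : euclidean V).
Variables (M : set V) (r : V -> V -> V).
Hypotheses (hM : C1_submanifold M) (hr : retraction M r).
Local Notation N := (enorm eV).
Local Notation e2 := (prod_euclidean eV eV).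

Lemma enorm_pair0 (w : V) : enorm e2 (0, w) = N w.
Proof. by rewrite /enorm /= /prod_inner/= inner0l add0r. Qed.

(** The smooth extension F of the retraction satisfies F (y, 0) = y and has the
    derivative w at 0 along (0, w); the rest is Taylor's formula for F. *)
Lemma retraction_second_order x : M x -> exists2 C, 0 < C & exists2 d, 0 < d &
  forall y w, N (y - x) < d -> M y -> tangent M y w -> N w < d ->
    N (r y w - y - w) <= C * N w ^+ 2.
Proof.
move=> Mx; have [_ rsm r0 rder] := hr.
have T0 y : M y -> tangent M y 0 by move=> /(tangent_subspace eV hM)[[]].
have [U [F [oU Ux CF Fr]]] := rsm x 0 Mx (T0 x Mx).
have [C C0 [d d0 [dF dL]]] := Cn2_differential_lipschitz e2 eV oU Ux (CF 2).
have /(nbhs_enormP e2)[d1 d10 hd1] : nbhs (x, 0 : V) U by exact: open_nbhs_nbhs.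
exists C => //; pose d2 := Num.min d d1; have d20 : 0 < d2 by rewrite lt_min d0.
exists (d2 / 2) => [|y w yx My Tw wd]; first by lra.
have near2 (t : R) : `|t| <= 1 -> enorm e2 ((y, t *: w) - (x, 0)) < d2.
  move=> t1; have -> : (y, t *: w) - (x, 0) = (y - x, t *: w) by congr pair; rewrite /= subr0.
  rewrite (le_lt_trans (enorm_prod_le _ _ _))// enormZ.
  have := ler_wpM2r (enorm_ge0 eV w) t1; lra.
have neard t : `|t| <= 1 -> enorm e2 ((y, t *: w) - (x, 0)) < d.
  by move=> t1; rewrite (lt_le_trans (near2 t t1))// ge_min lexx.
have Tt t : tangent M y (t *: w).
  by have [[_ _ TZ] _] := tangent_subspace eV hM My; exact: TZ.
have FU t : `|t| <= 1 -> F (y, t *: w) = r y (t *: w).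
  move=> t1; apply: Fr => //; apply: hd1.
  by rewrite (lt_le_trans (near2 t t1))// ge_min lexx orbT.
have n0 : `|0 : R| <= 1 by rewrite normr0.
have n1 : `|1 : R| <= 1 by rewrite normr1.
have F0 : F (y, 0) = y by have := FU 0 n0; rewrite scale0r r0.
have F1 : F (y, w) = r y w by have := FU 1 n1; rewrite scale1r.
have dF0 : differentiable F (y, 0) by have := dF _ (neard 0 n0); rewrite scale0r.
have dw : 'd F (y, 0) (0, w) = w.
  have h1 : is_derive (0 : R^o) (1 : R^o) (fun t : R^o => F (y, t *: w)) ('d F (y, 0) (0, w)).
    apply: (is_derive_enorm (eW := eV)) => e e0.
    have ew : 0 < e / (N w + 1) by rewrite divr_gt0// ltr_wpDl ?enorm_ge0.
    have [d3 d30 hd3] := differentiable_enorm e2 eV dF0 ew.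
    have w1 : 0 < N w + 1 by rewrite ltr_wpDl ?enorm_ge0.
    exists (d3 / (N w + 1)); first by rewrite divr_gt0.
    move=> k; rewrite ltr_pdivlMr// => kd.
    have kw : k *: ((0 : V), w) = (0, k *: w) by congr pair; rewrite /= scaler0.
    have := hd3 (k *: (0, w)); rewrite kw enorm_pair0 enormZ.
    move=> /(_ _)/wrap[]; first by have := normr_ge0 k; nra.
    have -> : ((0 : V), k *: w) + (y, 0) = (y, k *: w) by congr pair; rewrite /= ?add0r ?addr0.
    rewrite -kw differential_scale addr0 scale0r => h; rewrite (le_trans h)//.
    have -> : e / (N w + 1) * (`|k| * N w) = e * `|k| * (N w / (N w + 1)).
      by field; rewrite gt_eqF.
    by rewrite ler_piMr ?mulr_ge0 ?(ltW e0)// ler_pdivrMr// mul1r lerDl.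
  have [_ <-] := h1; have [_ h2] := rder y w My Tw; rewrite -[RHS]h2.
  apply: near_eq_derive.
  have : \forall t \near (0 : R^o), `|t| < 1.
    by apply/(nbhs_enormP (@real_euclidean R)); exists 1 => // t; rewrite enorm_real subr0.
  by apply: filterS => t /ltW; exact: FU.
have := differential_lipschitz_taylor dF dL (ltW C0) (neard 0 n0) (neard 1 n1).
rewrite scale0r scale1r.
have -> : (y, w) - (y, 0) = ((0 : V), w) by congr pair; rewrite /= ?subrr ?subr0.
by rewrite dw enorm_pair0 F0 F1.
Qed.

End retraction.

Section smooth_data.
Context {R : realType} {X Y : normedModType R} (P : problem X Y).
Hypothesis hP : standing_assumptions P.
Local Notation NX := (enorm (eX P)).
Local Notation NY := (enorm (eY P)).
Local Notation gradf := (gradf P).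
Local Notation jac := (jac P).

Lemma jacD x u v : jac x (u + v) = jac x u + jac x v.
Proof. exact: differential_add. Qed.
Lemma jacZ x a u : jac x (a *: u) = a *: jac x u.
Proof. exact: differential_scale. Qed.

Lemma adjgP x y v : inner (eX P) (adjg P x y) v = inner (eY P) y (jac x v).
Proof. by apply: adjointP => *; rewrite ?jacD ?jacZ. Qed.

Lemma gradfP x v : inner (eX P) (gradf x) v = 'd (f P : X -> R^o) x v.
Proof.
move: v; rewrite /Defs.gradf /grad.
have [u uP] : exists u, forall v, inner (eX P) u v = 'd (f P : X -> R^o) x v.
  by apply: riesz => [u v|a u]; [rewrite differential_add|rewrite differential_scale].
exact: (@xgetPex _ 0 [set u | forall v, inner (eX P) u v = 'd (f P : X -> R^o) x v]
  (ex_intro _ u uP)).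
Qed.

(** The Lipschitz constants of the derivatives near x are at the same time constants of
    the first-order Taylor expansions from points near x. *)
Lemma smooth_local x : dom P x -> exists2 L, 0 < L & exists2 d, 0 < d &
  forall y, NX (y - x) < d ->
  [/\ `|f P y| <= L, NX (gradf y) <= L, NY (g P y) <= L,
      forall w, NY (jac y w) <= L * NX w
    & forall z, NX (z - y) < d ->
      `|f P z - f P y - inner (eX P) (gradf y) (z - y)| <= L * NX (z - y) ^+ 2 /\
      NY (g P z - g P y - jac y (z - y)) <= L * NX (z - y) ^+ 2].
Proof.
have [_ _ _ [[odom _ _ df dg] lip] _] := hP => dx.
have [L0 hL0] := lip x dx; pose L := `|L0| + 1.
have L00 : L0 <= L by rewrite /L; have := ler_norm L0; lra.
have Lp : 0 < L by rewrite ltr_wpDl.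
have [d d0 hd] : exists2 d, 0 < d & forall y z, NX (y - x) < d -> NX (z - x) < d ->
    [/\ dom P y, NX (gradf z - gradf y) <= L * NX (z - y)
      & forall w, NY (jac z w - jac y w) <= L * NX (z - y) * NX w].
  have [[A B] /= [/(nbhs_enormP (eX P))[d1 d10 hA] /(nbhs_enormP (eX P))[d2 d20 hB]] hAB] := hL0.
  have /(nbhs_enormP (eX P))[d3 d30 hD] : nbhs x (dom P) by exact: open_nbhs_nbhs.
  exists (Num.min d3 (Num.min d1 d2)); first by rewrite !lt_min d30 d10.
  move=> y z; rewrite !lt_min => /and3P[y3 y1 y2] /and3P[z3 z1 z2].
  have [h1 h2] := hAB (z, y) (conj (hA _ z1) (hB _ y2)) (hD _ z3) (hD _ y3).
  have h3 : L0 * NX (z - y) <= L * NX (z - y) by rewrite ler_wpM2r ?enorm_ge0.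
  split; [exact: hD|exact: le_trans h1 _|move=> w].
  have op := @opnormP R X Y (eX P) (eY P) (fun v => jac z v - jac y v).
  rewrite (le_trans (op _ _ w))//.
  - by move=> u v; rewrite !jacD opprD addrACA.
  - by move=> a u; rewrite !jacZ scalerBr.
  - by rewrite ler_wpM2r ?enorm_ge0// (le_trans h2).
have xx : NX (x - x) < d by rewrite subrr enorm0.
have hdom y : NX (y - x) < d -> dom P y by move=> yx; have [] := hd y y yx yx.
have [C C0 hC] := linear_bounded (eX P) (eY P) (jacD x) (jacZ x).
have cf : {for x, continuous (f P : X -> R^o)} := differentiable_continuous (df x dx).
have cg : {for x, continuous (g P)} := differentiable_continuous (dg x dx).
have [d1 d10 hd1] := (continuous_enormP (eX P) (@real_euclidean R) _ x).1 cf _ ltr01.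
have [d2 d20 hd2] := (continuous_enormP (eX P) (eY P) _ x).1 cg _ ltr01.
pose d' := Num.min (Num.min (d / 2) 1) (Num.min d1 d2).
pose L' := L + (`|f P x| + 1) + (NX (gradf x) + L) + (NY (g P x) + 1) + (C + L).
have p1 := normr_ge0 (f P x); have p2 := enorm_ge0 (eX P) (gradf x).
have p3 := enorm_ge0 (eY P) (g P x).
exists L'; first by rewrite /L'; lra.
exists d'; first by rewrite !lt_min d10 d20 divr_gt0// ltr01.
move=> y; rewrite !lt_min => /andP[/andP[yd y1] /andP[yd1 yd2]].
have yd' : NX (y - x) < d by lra.
have [_ hg hj] := hd x y xx yd'.
have Ld : L * NX (y - x) <= L by rewrite ler_piMr// ltW.
split.
- have := hd1 _ yd1; rewrite enorm_real => h.
  have := ler_normD (f P x) (f P y - f P x); rewrite addrC subrK /L' => h2.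
  have h3 : `|f P y - f P x| < 1 by []. lra.
- have := enorm_le_add (eX P) (gradf y) (gradf x); rewrite /L'; lra.
- have := hd2 _ yd2; have := enorm_le_add (eY P) (g P y) (g P x); rewrite /L'; lra.
- move=> w; have := enorm_le_add (eY P) (jac y w) (jac x w).
  have := hj w; have := hC w; have pw := enorm_ge0 (eX P) w.
  have := ler_wpM2r pw Ld.
  have : (C + L) * NX w <= L' * NX w by rewrite ler_wpM2r// /L'; lra.
  lra.
- move=> z; rewrite !lt_min => /andP[/andP[zy _] _].
  have zd : NX (z - x) < d.
    by have := enorm_triangle (eX P) y z x; lra.
  have LL : L * NX (z - y) ^+ 2 <= L' * NX (z - y) ^+ 2.
    by rewrite ler_wpM2r ?sqr_ge0// /L'; lra.
  split.
    rewrite gradfP -enorm_real (le_trans _ LL)//.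
    apply: (@differential_lipschitz_taylor R X R^o (eX P) (@real_euclidean R) (f P) x d L) => //.
    - by move=> u /hdom; exact: df.
    - move=> u v w ud vd; rewrite enorm_real -!gradfP -innerBl.
      have [_ h _] := hd u v ud vd.
      by rewrite (le_trans (inner_CS_abs _ _ _))// ler_wpM2r ?enorm_ge0.
    - exact: ltW.
  rewrite (le_trans _ LL)//.
  apply: (@differential_lipschitz_taylor R X Y (eX P) (eY P) (g P) x d L) => //.
  - by move=> u /hdom; exact: dg.
  - by move=> u v w ud vd; have [_ _ h] := hd u v ud vd; exact: h.
  - exact: ltW.
Qed.

Variable p : params X.
Hypothesis hr : retraction (M P) (retr p).

(** Everything that the analysis needs to know about the smooth data near a point. *)
Definition smooth_bounds (L : R) (y : X) :=
  [/\ `|f P y| <= L /\ NX (gradf y) <= L, NY (g P y) <= L,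
      forall w, NY (jac y w) <= L * NX w,
      forall z, NX (z - y) < L^-1 ->
        `|f P z - f P y - inner (eX P) (gradf y) (z - y)| <= L * NX (z - y) ^+ 2 /\
        NY (g P z - g P y - jac y (z - y)) <= L * NX (z - y) ^+ 2
    & forall w, tangent (M P) y w -> NX w < L^-1 ->
        NX (retr p y w - y - w) <= L * NX w ^+ 2].

Lemma smooth_uniform (C : R) : exists2 L, 0 < L &
  forall y, M P y -> NX y <= C -> smooth_bounds L y.
Proof.
have [[hM clM] _ _ [[odom _ Mdom _ _] _] _] := hP.
pose D := M P `&` [set y | NX y <= C].
have cD : compact D.
  apply: (@compact_enorm _ _ (eX P) D C); last by move=> u [].
  apply: closedI => //; apply: (@closed_comp _ _ NX [set y | y <= C]); last exact: closed_le.
  by move=> x _; exact: continuous_enorm.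
have [n hn] : exists n, forall x, D x -> M P x -> smooth_bounds n.+1%:R x.
  apply: compact_uniform => //.
    move=> n m x nm h Mx; have [[h1 h1'] h2 h3 h4 h5] := h Mx.
    have nm' : n.+1%:R <= m.+1%:R :> R by rewrite ler_nat.
    have nm2 : m.+1%:R^-1 <= n.+1%:R^-1 :> R by rewrite lef_pV2 ?posrE ?ltr0n.
    split=> [|| w|z zy|w Tw wd].
    - by split; apply: le_trans nm'.
    - exact: le_trans nm'.
    - by rewrite (le_trans (h3 w))// ler_wpM2r ?enorm_ge0.
    - have [h6 h7] := h4 z (lt_le_trans zy nm2).
      by split; [apply: (le_trans h6)|apply: (le_trans h7)]; rewrite ler_wpM2r ?sqr_ge0.
    - by rewrite (le_trans (h5 w Tw (lt_le_trans wd nm2)))// ler_wpM2r ?sqr_ge0.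
  move=> x [Mx _]; have [L L0 [d d0 hd]] := smooth_local (Mdom _ Mx).
  have [C' C'0 [d' d'0 hd']] := retraction_second_order (eX P) hM hr Mx.
  pose m := L + C' + d^-1 + d'^-1.
  have [pd pd'] : 0 < d^-1 /\ 0 < d'^-1 by rewrite !invr_gt0.
  pose n := Num.bound m; exists n.
  have mn : m < n.+1%:R.
    have m0 : 0 <= m by rewrite /m; lra.
    by rewrite (lt_trans (archi_boundP m0))// ltr_nat.
  have n0 : 0 < n.+1%:R :> R by rewrite ltr0n.
  have nd : n.+1%:R^-1 <= d by rewrite invf_ple ?posrE//; rewrite /m in mn; lra.
  have nd' : n.+1%:R^-1 <= d' by rewrite invf_ple ?posrE//; rewrite /m in mn; lra.
  have Ln : L <= n.+1%:R by rewrite /m in mn; lra.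
  have Cn : C' <= n.+1%:R by rewrite /m in mn; lra.
  near=> y => My.
  have [|h1 h2 h3 h4 h5] := hd y; first by near: y; exact: near_enorm.
  have yd' : NX (y - x) < d' by near: y; exact: near_enorm.
  split=> [|| w|z zy|w Tw wd].
  - by split; apply: le_trans Ln.
  - exact: le_trans Ln.
  - by rewrite (le_trans (h4 w))// ler_wpM2r ?enorm_ge0.
  - have [h6 h7] := h5 z (lt_le_trans zy nd).
    by split; [apply: (le_trans h6)|apply: (le_trans h7)]; rewrite ler_wpM2r ?sqr_ge0.
  - rewrite (le_trans (hd' y w yd' My Tw (lt_le_trans wd nd')))//.
    by rewrite ler_wpM2r ?sqr_ge0.
exists n.+1%:R; first by rewrite ltr0n.
by move=> y My yC; apply: hn.
Unshelve. all: by end_near. Qed.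

End smooth_data.

(** * Accelerated fixed-point iterations *)

(** Fast Krasnoselskii-Mann iterations with residual b k = x k - F (x k). The recursion
    is only tested through B, because a degenerate B does not determine vectors. *)

Section fast_krasnoselskii_mann.
Context {R : realType} {V : lmodType R} {B : V -> V -> R} (hB : psd_form B).
Variables (alpha : R) (x b : nat -> V) (xs : V).
Hypothesis alpha2 : 2 <= alpha.
Hypothesis coco : forall k,
  B (b k.+1 - b k) (b k.+1 - b k) <= 2 * B (b k.+1 - b k) (x k.+1 - x k).
Hypothesis coco_star : forall k, B (b k) (b k) <= 2 * B (b k) (x k - xs).
Hypothesis rec : forall k w, (k%:R + alpha) * (B (x k.+1) w - B (x k) w)
  = k%:R * (B (x k) w - B (x k.-1) w) - alpha / 2 * B (b k) w
    - k%:R * (B (b k) w - B (b k.-1) w).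
Local Notation N := (@seminorm R V B).

(** d is the momentum corrected by the previous residual; it evolves by a first-order
    recursion in b, and the norm of s is a Lyapunov function. *)
Let d k := k%:R *: (x k - x k.-1 + b k.-1).
Let s k := d k + (alpha - 1) *: (x k - xs).

Let natS k : k.+1%:R = k%:R + 1 :> R. Proof. by rewrite -natr1. Qed.

Let Bd k w : B (d k) w = k%:R * (B (x k) w - B (x k.-1) w + B (b k.-1) w).
Proof. by rewrite /d !(psdE hB). Qed.

Let Bs k w : B (s k) w = B (d k) w + (alpha - 1) * (B (x k) w - B xs w).
Proof. by rewrite /s !(psdE hB). Qed.

Let rec_d k w :
  (k%:R + alpha) * B (d k.+1) w = (k%:R + 1) * (B (d k) w + alpha / 2 * B (b k) w).
Proof.
rewrite !Bd natS /=.
have -> : (k%:R + alpha) * ((k%:R + 1) * (B (x k.+1) w - B (x k) w + B (b k) w))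
  = (k%:R + 1) * ((k%:R + alpha) * (B (x k.+1) w - B (x k) w) + (k%:R + alpha) * B (b k) w).
  by ring.
by rewrite rec; field.
Qed.

Let rec_s k w : B (s k.+1) w = B (s k) w - (alpha / 2 - 1) * B (b k) w.
Proof.
rewrite !Bs !Bd natS /=.
have -> : (k%:R + 1) * (B (x k.+1) w - B (x k) w + B (b k) w) + (alpha - 1) * (B (x k.+1) w - B xs w)
  = (k%:R + alpha) * (B (x k.+1) w - B (x k) w) + (k%:R + 1) * B (b k) w
    + (alpha - 1) * (B (x k) w - B xs w) by ring.
by rewrite rec; field.
Qed.

(** The weighted sum of the cocoercivity inequalities telescopes. *)
Let bd k : k%:R / 2 * B (b k) (b k) <= B (b k) (d k).
Proof.
elim: k => [|k IH]; first by rewrite mul0r mul0r (psdC hB) Bd mul0r.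
have k0 : 0 <= k%:R :> R by exact: ler0n.
rewrite natS; have h1 := coco k.
have h2 w : (k%:R + 1) * (B (x k.+1) w - B (x k) w) = B (d k.+1) w - (k%:R + 1) * B (b k) w.
  by rewrite Bd natS /=; ring.
have h3 : (k%:R + 1) * B (b k.+1 - b k) (x k.+1 - x k)
   = B (d k.+1) (b k.+1) - B (d k.+1) (b k) - (k%:R + 1) * (B (b k) (b k.+1) - B (b k) (b k)).
  rewrite (psdC hB) (psdBl hB) !(psdBr hB).
  have -> : (k%:R + 1) * (B (x k.+1) (b k.+1) - B (x k.+1) (b k) - (B (x k) (b k.+1) - B (x k) (b k)))
    = (k%:R + 1) * (B (x k.+1) (b k.+1) - B (x k) (b k.+1)) - (k%:R + 1) * (B (x k.+1) (b k) - B (x k) (b k)).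
    by ring.
  by rewrite !h2; ring.
have h4 := rec_d k (b k).
have k1 : 0 <= k%:R + 1 :> R by lra.
have h5 := ler_wpM2l k1 h1.
have e5 : (k%:R + 1) * (2 * B (b k.+1 - b k) (x k.+1 - x k)) = 2 * ((k%:R + 1) * B (b k.+1 - b k) (x k.+1 - x k)) by ring.
rewrite e5 h3 (psdBl hB) !(psdBr hB) (psdC hB (b k.+1) (b k)) in h5.
rewrite (psdC hB (b k.+1) (d k.+1)).
rewrite (psdC hB (b k) (d k)) in IH.
have ka : 0 < k%:R + alpha by have := alpha2; lra.
rewrite -(ler_pM2l ka).
have h6 := ler_wpM2l (ltW ka) h5.
have h7 := ler_wpM2l k1 IH.
set p := B (b k.+1) (b k.+1) in h6 *; set q := B (b k) (b k) in h4 h6 h7.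
set r := B (d k.+1) (b k.+1) in h6 *; set t := B (d k.+1) (b k) in h4 h6.
set m := B (d k) (b k) in h4 h7; set n := B (b k) (b k.+1) in h6.
set K := k%:R in h4 h6 h7 *.
have h8 : (K + alpha) * ((K + 1) * (p - n - (n - q))) = (K + alpha) * ((K + 1) * p) + (K + alpha) * ((K + 1) * q) - 2 * ((K + alpha) * ((K + 1) * n)) by ring.
have h9 : (K + alpha) * (2 * (r - t - (K + 1) * (n - q))) = 2 * ((K + alpha) * r) - 2 * ((K + alpha) * t) - 2 * ((K + alpha) * ((K + 1) * n)) + 2 * ((K + alpha) * ((K + 1) * q)) by ring.
rewrite h8 h9 h4 in h6; lra.
Qed.

Let bs k : (k%:R + alpha - 1) / 2 * B (b k) (b k) <= B (s k) (b k).
Proof.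
rewrite Bs (psdC hB (d k)); have h1 := bd k.
have h2 := coco_star k; rewrite (psdBr hB) (psdC hB (b k) (x k)) (psdC hB (b k) xs) in h2.
have a1 : 0 <= alpha - 1 by have := alpha2; lra.
have := ler_wpM2l a1 h2; lra.
Qed.

Let N0 := N (x 0%N - xs).

Let sN k : N (s k) <= (alpha - 1) * N0.
Proof.
have a1 : 0 <= alpha - 1 by have := alpha2; lra.
elim: k => [|k IH].
  have -> : s 0%N = (alpha - 1) *: (x 0%N - xs) by rewrite /s /d scale0r add0r.
  by rewrite (seminormZ hB) ger0_norm.
apply: le_trans IH; rewrite -(@ler_pXn2r _ 2) ?nnegrE ?seminorm_ge0// !(sqr_seminorm hB).
rewrite rec_s (psdC hB (s k)) (psdC hB (b k)) !rec_s (psdC hB (b k)).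
have h := bs k; have q0 := psd_ge0 hB (b k).
have k0 : 0 <= k%:R :> R by exact: ler0n.
set q := B (b k) (b k) in h q0 *; set m := B (s k) (b k) in h *.
have h1 : (alpha - 1) / 2 * q <= m.
  by apply: le_trans h; rewrite ler_wpM2r//; lra.
have a2 : 0 <= alpha / 2 - 1 by have := alpha2; lra.
have h2 := ler_wpM2l a2 h1.
have : 0 <= (alpha / 2 - 1) * (q * alpha) by rewrite mulr_ge0// mulr_ge0//; have := alpha2; lra.
have h3 : (alpha / 2 - 1) * ((alpha / 2 - 1) * q) = (alpha / 2 - 1) * ((alpha - 1) / 2 * q) - (alpha / 2 - 1) * q / 2 by field.
have h4 := mulr_ge0 a2 q0.
lra.
Qed.

(** bs bounds the square of the residual by its product with s, whose norm is bounded
    by sN. *)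
Theorem fast_KM_residual k : (k%:R + alpha - 1) * N (b k) <= 2 * (alpha - 1) * N0.
Proof.
have h := bs k; have h1 := psd_CS hB (s k) (b k); have h2 := sN k.
have [b0|b0] := eqVneq (N (b k)) 0.
  by rewrite b0 mulr0 !mulr_ge0 ?seminorm_ge0//; have := alpha2; lra.
have b1 : 0 < N (b k) by rewrite lt_neqAle eq_sym b0 seminorm_ge0.
have e := sqr_seminorm hB (b k); rewrite expr2 in e.
rewrite -(ler_pM2r b1) -[X in X <= _]mulrA e.
have := ler_wpM2r (ltW b1) h2; lra.
Qed.

(** x (k + 1) - xs is a convex combination of s (k + 1) / (alpha - 1) and the unrelaxed
    step x k - b k - xs, both no longer than the initial error. *)
Theorem fast_KM_bounded k : N (x k - xs) <= N0.
Proof.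
elim: k => [//|k IH]; set y := x k.+1 - xs.
have h1 : N (x k - b k - xs) <= N0.
  apply: le_trans IH; rewrite -(@ler_pXn2r _ 2) ?nnegrE ?seminorm_ge0// !(sqr_seminorm hB).
  have := coco_star k; rewrite (addrAC (x k)); move: (x k - xs) => u.
  by rewrite (psdBl hB u) !(psdBr hB) (psdC hB u (b k)); lra.
have hy : (k%:R + alpha) * B y y = B (s k.+1) y + k.+1%:R * B (x k - b k - xs) y.
  by rewrite /y Bs Bd !(psdBl hB) natS /=; ring.
have c1 := psd_CS hB (s k.+1) y; have c2 := psd_CS hB (x k - b k - xs) y.
have [y0|y0] := eqVneq (N y) 0; first by rewrite y0 seminorm_ge0.
have y1 : 0 < N y by rewrite lt_neqAle eq_sym y0 seminorm_ge0.
have k1 : 0 <= k.+1%:R :> R by exact: ler0n.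
have c3 := ler_wpM2r (ltW y1) (sN k.+1); have c4 := ler_wpM2r (ltW y1) h1.
have c5 := ler_wpM2l k1 (le_trans c2 c4).
have ka : 0 < k%:R + alpha by have := ler0n R k; have := alpha2; lra.
have e := sqr_seminorm hB y; rewrite expr2 in e.
rewrite -(ler_pM2l ka) -(ler_pM2r y1) -[X in X <= _]mulrA e hy.
by rewrite natS in c5 *; lra.
Qed.

End fast_krasnoselskii_mann.

(** * The quadratic subproblem *)

Lemma nonneg_quadratic (R : realType) (a b : R) : 0 <= b ->
  (forall t, 0 <= t * a + t ^+ 2 * b) -> a = 0.
Proof.
move=> b0 h; apply/eqP; rewrite -sqrf_eq0 eq_le sqr_ge0 andbT.
have b1 : 0 < b + 1 by lra.
have := h (- a / (b + 1)).
have -> : - a / (b + 1) * a + (- a / (b + 1)) ^+ 2 * b = - (a ^+ 2) * (b + 1) ^- 2.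
  by field; rewrite gt_eqF.
by rewrite pmulr_lge0 ?oppr_ge0// invr_gt0 exprn_gt0.
Qed.

(** Fermat's rule: a step of length t towards y changes the quadratic by its linear
    part up to O(t^2), while convexity bounds the change of psi by t times the total. *)
Lemma quadratic_argminP (R : realType) (Z : normedModType R) (eZ : euclidean Z)
    (psi : Z -> R) (sig : R) (m z : Z) : cvx psi -> 0 < sig ->
  (forall y, psi z + sig / 2 * enorm eZ (m - z) ^+ 2 <= psi y + sig / 2 * enorm eZ (m - y) ^+ 2)
  <-> subgrad eZ psi z (sig *: (m - z)).
Proof.
move=> cpsi sig0.
have expand y : enorm eZ (m - y) ^+ 2 = enorm eZ (m - z) ^+ 2
    - 2 * inner eZ (m - z) (y - z) + enorm eZ (y - z) ^+ 2.
  have -> : m - y = (m - z) - (y - z) by rewrite opprB addrA subrK.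
  move: (m - z) (y - z) => a q.
  by rewrite !sqr_enorm innerBl !innerBr (innerC eZ q a); ring.
split=> h y; last first.
  have := h y; rewrite innerZl (expand y).
  have := mulr_ge0 (ltW sig0) (sqr_ge0 (enorm eZ (y - z))); lra.
rewrite innerZl; set a := inner eZ (m - z) (y - z); set q := enorm eZ (y - z) ^+ 2.
have q0 : 0 <= q by exact: sqr_ge0.
have key t : 0 < t -> t <= 1 -> psi z + sig * a <= psi y + t * (sig / 2 * q).
  move=> t0 t1; have t01 : 0 <= t <= 1 by rewrite ltW.
  have := h (t *: y + (1 - t) *: z); rewrite (expand (t *: y + (1 - t) *: z)).
  have -> : t *: y + (1 - t) *: z - z = t *: (y - z).
    by rewrite scalerBl scale1r scalerBr addrA addrAC addrK.
  rewrite innerZr (enormZp _ _ (ltW t0)) exprMn -/a -/q => h1.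
  have h2 := cpsi t y z t01.
  rewrite -(ler_pM2l t0); lra.
apply/ler_addgt0Pr => e e0.
pose c := sig / 2 * q; have c0 : 0 <= c by rewrite mulr_ge0//; lra.
pose t := Num.min 1 (e / (c + 1)).
have t0 : 0 < t by rewrite lt_min ltr01 divr_gt0//; lra.
have := key t t0; rewrite ge_min lexx => /(_ isT) h1; rewrite (le_trans h1)// lerD2l -/c.
have : t * (c + 1) <= e by rewrite -ler_pdivlMr ?ge_min ?lexx ?orbT//; lra.
lra.
Qed.

Section bounded_subsequence.
Context {R : realType} {V : normedModType R} (eV : euclidean V).

Lemma bounded_subsequence (u : nat -> V) (r : R) : (forall n, enorm eV (u n) <= r) ->
  exists (x : V) (phi : nat -> nat), (forall j, (j <= phi j)%N) /\ u \o phi @ \oo --> x.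
Proof.
move=> /bounded_cluster[x hx].
have /choice[phi hphi] : forall j : nat, exists n, (j <= n)%N /\ enorm eV (u n - x) < j.+1%:R^-1.
  by move=> j; have [|n jn un] := hx j.+1%:R^-1 _ j; [rewrite invr_gt0 ltr0n|exists n].
exists x, phi; split=> [j|]; first by have [] := hphi j.
apply/(cvg_enormP eV) => e e0.
exists (Num.bound e^-1) => // j /= ej.
have [_ h] := hphi j; rewrite (lt_trans h)//.
rewrite invf_plt ?posrE ?ltr0n//.
have e1 : 0 <= e^-1 by rewrite invr_ge0 ltW.
by rewrite (lt_le_trans (archi_boundP e1))// ler_nat (leq_trans ej).
Qed.

End bounded_subsequence.

(** * Optimality conditions and convergence of the inner solvers *)

Section inner_solvers.
Context {R : realType} {X Z : normedModType R} (eX : euclidean X) (eZ : euclidean Z).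
Variables (T : set X) (A : X -> Z) (g0 : Z) (c : X) (beta : R) (psi : Z -> R).
Hypotheses (Tsub : linear_subspace T) (Tcl : closed T).
Hypothesis AD : forall u v, A (u + v) = A u + A v.
Hypothesis AZ : forall a u, A (a *: u) = a *: A u.
Hypotheses (beta0 : 0 < beta) (cpsi : cvx psi).
Local Notation NX := (enorm eX).
Local Notation NZ := (enorm eZ).
Local Notation ipX := (inner eX).
Local Notation ipZ := (inner eZ).

Definition aff v := g0 + A v.

(** The derivative along u of the Lagrangian in v. *)
Definition dlag v lam u := ipX (c + beta *: v) u + ipZ lam (A u).

Definition kkt v z lam :=
  [/\ T v, forall u, T u -> dlag v lam u = 0, subgrad eZ psi z lam & z = aff v].

Lemma AB u v : A (u - v) = A u - A v.
Proof. by rewrite -(scaleN1r v) AD AZ scaleN1r. Qed.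

Lemma A0 : A 0 = 0.
Proof. by rewrite -(scale0r 0) AZ scale0r. Qed.

Lemma affB u v : aff u - aff v = A (u - v).
Proof. by rewrite /aff AB opprD addrACA subrr add0r. Qed.

Lemma subgrad_monotone z lam z' lam' : subgrad eZ psi z lam -> subgrad eZ psi z' lam' ->
  0 <= ipZ (lam' - lam) (z' - z).
Proof.
move=> h h'; have := h z'; have := h' z.
have -> : ipZ (lam') (z - z') = - ipZ (lam') (z' - z) by rewrite -innerNr opprB.
by rewrite innerBl; lra.
Qed.

Section bounds.
Variables (kap K L0 b0 : R).
Hypotheses (Abd : forall u, NZ (A u) <= kap * NX u) (kap0 : 0 <= kap).
Hypotheses (cK : NX c <= K) (L00 : 0 <= L0) (b00 : 0 < b0) (b0b : b0 <= beta).
Hypothesis psilow : forall w, psi g0 - L0 * NZ w <= psi (g0 + w).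

(** Stationarity tested with v itself: beta |v|^2 is balanced by terms that grow
    linearly. *)
Lemma kkt_bounded v z lam : kkt v z lam -> NX v <= (K + L0 * kap) / b0.
Proof.
move=> [Tv hv hl zE]; have := hv v Tv; rewrite /dlag innerDl innerZl -sqr_enorm.
have h1 := hl g0; have h2 := psilow (A v); rewrite -/(aff v) -zE in h2.
have e1 : g0 - z = - A v by rewrite zE /aff opprD addrA subrr add0r.
rewrite e1 innerNr in h1.
have h3 := inner_CS_abs eX c v; rewrite ler_norml in h3; move/andP: h3 => [h3 _].
have vN := enorm_ge0 eX v; have h4 := ler_wpM2r vN cK.
have h5 := ler_wpM2l L00 (Abd v).
move=> h6; have h7 : b0 * NX v ^+ 2 <= beta * NX v ^+ 2 by rewrite ler_wpM2r ?sqr_ge0.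
rewrite ler_pdivlMr//.
have [v0|v0] := eqVneq (NX v) 0.
  rewrite v0 mul0r addr_ge0// ?mulr_ge0//.
  exact: le_trans (enorm_ge0 eX c) cK.
have v1 : 0 < NX v by rewrite lt_neqAle eq_sym v0.
by rewrite -(ler_pM2r v1); rewrite expr2 in h6 h7; lra.
Qed.

(** Quadratic penalization of z = aff v yields approximate KKT triples; their
    multipliers are subgradients of psi on a bounded set, so a cluster point exists
    and satisfies the KKT conditions. *)
Lemma kkt_exists : exists v z lam, kkt v z lam.
Proof.
have bb := beta0; have LL := L00; have kk := kap0.
pose e2 := prod_euclidean eX eZ.
pose F (n : nat) (w : (X * Z)%type) := ipX c (w.1) + beta / 2 * NX w.1 ^+ 2 + psi w.2
  + n.+1%:R / 2 * NZ (aff w.1 - w.2) ^+ 2.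
pose D := [set w : (X * Z)%type | T w.1].
have [_ TD TZ] := Tsub; have T0 : T 0 by case: Tsub.
have fst_le (w : (X * Z)%type) : NX w.1 <= enorm e2 w := enorm_fst_le _ _ w.
have snd_le (w : (X * Z)%type) : NZ w.2 <= enorm e2 w := enorm_snd_le _ _ w.
have pair_le (w : (X * Z)%type) : enorm e2 w <= NX w.1 + NZ w.2 := enorm_prod_le _ _ w.
have cfst : continuous (fun w : (X * Z)%type => w.1).
  move=> w; apply/(continuous_enormP e2 eX) => e e0; exists e => // y.
  by apply: le_lt_trans; exact: (fst_le (y - w)).
have csnd : continuous (fun w : (X * Z)%type => w.2).
  move=> w; apply/(continuous_enormP e2 eZ) => e e0; exists e => // y.
  by apply: le_lt_trans; exact: (snd_le (y - w)).
have clD : closed D.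
  by apply: (@closed_comp _ _ (fun w : (X * Z)%type => w.1) T) => // w _; exact: cfst.
have caff : continuous aff.
  move=> v; apply/(continuous_enormP eX eZ) => e e0.
  have k1 : 0 < kap + 1 by rewrite ltr_wpDl.
  exists (e / (kap + 1)); first by rewrite divr_gt0.
  move=> y; rewrite ltr_pdivlMr// affB => h; have := Abd (y - v).
  by have := enorm_ge0 eX (y - v); lra.
have cin : continuous (fun v => ipX c v : R^o).
  move=> v; apply/(continuous_realP eX) => e e0.
  have c1 : 0 < NX c + 1 by rewrite ltr_wpDl ?enorm_ge0.
  exists (e / (NX c + 1)); first by rewrite divr_gt0.
  move=> y; rewrite ltr_pdivlMr// -innerBr => h; have := inner_CS_abs eX c (y - v).
  by have := enorm_ge0 eX (y - v); lra.
have cF n : continuous (F n : _ -> R^o).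
  move=> w; rewrite /F; apply: cvgD; first apply: cvgD; first apply: cvgD.
  - exact: (continuous_comp (cfst w) (cin w.1)).
  - apply: cvgM; first exact: cvg_cst.
    have h := continuous_comp (cfst w) (@continuous_enorm _ _ eX w.1); exact: (cvgM h h).
  - exact: (continuous_comp (csnd w) (cvx_continuous eZ cpsi (x := w.2))).
  - apply: cvgM; first exact: cvg_cst.
    have h1 := continuous_comp (cfst w) (caff w.1).
    have h2 : {for w, continuous (fun x : (X * Z)%type => aff x.1 - x.2)} by exact: (cvgB h1 (csnd w)).
    have h := continuous_comp h2 (@continuous_enorm _ _ eZ (aff w.1 - w.2)).
    exact: (cvgM h h).
pose k1 := K + L0 * kap.
have K0 : 0 <= K := le_trans (enorm_ge0 eX c) cK.
have k10 : 0 <= k1 by rewrite addr_ge0// mulr_ge0.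
(* ra and rb bound the sublevel sets through (0, g0) for all n at once. *)
pose ra := 4 * k1 / beta + 2 * L0 ^+ 2 / beta + 1.
have ra1 : 1 <= ra by rewrite lerDr addr_ge0// divr_ge0 ?mulr_ge0 ?sqr_ge0// ltW.
pose rb := 2 * L0 + 2 * (k1 * ra) + 2.
have sub n w : D w -> F n w <= F n (0, g0) -> NX w.1 <= ra /\ NZ (aff w.1 - w.2) <= rb.
  case: w => v z /= Tv; rewrite /F/= inner0r enorm0 /aff A0 addr0 subrr enorm0 expr0n/= !mulr0 !add0r addr0.
  rewrite -/(aff v); set a := NX v; set b := NZ (aff v - z) => hF.
  have a0 : 0 <= a := enorm_ge0 _ _; have b0' : 0 <= b := enorm_ge0 _ _.
  have ez : g0 + (z - g0) = z by rewrite addrC subrK.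
  have h1 := psilow (z - g0); rewrite ez in h1.
  have h2 : NZ (z - g0) <= kap * a + b.
    have -> : z - g0 = A v - (aff v - z) by rewrite opprB /aff [g0 + _]addrC opprD !addrA [A v + z]addrC addrK.
    by rewrite (le_trans (enormB _ _ _))// lerD2r Abd.
  have h3 := inner_CS_abs eX c v; rewrite ler_norml -/a in h3; move/andP: h3 => [h3 _].
  have h4 := ler_wpM2r a0 cK; have h5 := ler_wpM2l L00 h2.
  have n1 : 1 <= n.+1%:R :> R by rewrite ler1n.
  have h6 : b ^+ 2 <= n.+1%:R * b ^+ 2 by rewrite ler_peMl// sqr_ge0.
  have h7 : beta / 2 * a ^+ 2 - k1 * a + b ^+ 2 / 2 - L0 * b <= 0.
    by rewrite /k1; lra.
  have h8 : - (L0 ^+ 2 / 2) <= b ^+ 2 / 2 - L0 * b.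
    by have := sqr_ge0 (b - L0); rewrite sqrrB; lra.
  have ar : a <= ra.
    rewrite leNgt; apply/negP => ra_a.
    have e1 : beta * ra = 4 * k1 + 2 * L0 ^+ 2 + beta by rewrite /ra; field; rewrite gt_eqF.
    have h9 : 4 * k1 + 2 * L0 ^+ 2 + beta < beta * a by rewrite -e1 ltr_pM2l.
    have a1 : 1 <= a by rewrite (le_trans ra1)// ltW.
    have h10 : (4 * k1 + 2 * L0 ^+ 2 + beta) * a <= beta * a * a by rewrite ler_wpM2r// ltW.
    have h11 : L0 ^+ 2 <= L0 ^+ 2 * a by rewrite ler_peMr// sqr_ge0.
    have h12 : 0 < beta * a by rewrite mulr_gt0// (lt_le_trans ltr01).
    have h13 : 0 <= L0 ^+ 2 by exact: sqr_ge0.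
    have h14 : 0 <= k1 * a by rewrite mulr_ge0.
    by rewrite (expr2 a) in h7; lra.
  split=> //; rewrite leNgt; apply/negP => rb_b.
  have h9 : k1 * a <= k1 * ra by rewrite ler_wpM2l.
  have h10 : 0 <= beta / 2 * a ^+ 2 by rewrite mulr_ge0 ?sqr_ge0//; lra.
  have h11 : rb * b <= b * b by rewrite ler_wpM2r// ltW.
  have h12 : 0 <= k1 * ra by rewrite mulr_ge0//; lra.
  have b1 : 1 <= b by rewrite /rb in rb_b; lra.
  have h13 : k1 * ra <= k1 * ra * b by rewrite ler_peMr.
  by rewrite expr2 /rb in h7 h11; lra.
pose rz := NZ g0 + kap * ra + rb.
have subz n w : D w -> F n w <= F n (0, g0) -> NZ w.2 <= rz.
  move=> Dw /(sub n w Dw)[h1 h2].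
  have -> : w.2 = g0 + A w.1 - (aff w.1 - w.2) by rewrite opprB addrCA subrr addr0.
  rewrite (le_trans (enormB _ _ _))// lerD//.
  by rewrite (le_trans (enormD _ _ _))// lerD2l (le_trans (Abd _))// ler_wpM2l.
have D0 : D (0, g0) by [].
have [L' L'0 [_ hL' _]] := cvx_ball eZ cpsi rz.
have /choice[m hm] : forall n, exists w, is_argmin D (F n) w.
  move=> n; apply: (@coercive_min _ _ e2 D (F n) (0, g0) (ra + rz)) => // w Dw Fw.
  by rewrite (le_trans (pair_le w))// lerD//; [exact: (sub n w Dw Fw).1|exact: (subz n w Dw Fw)].
pose l n := n.+1%:R *: (aff (m n).1 - (m n).2).
have n0 n : 0 < n.+1%:R :> R by rewrite ltr0n.
have hl n : subgrad eZ psi (m n).2 (l n).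
  apply/(quadratic_argminP eZ (aff (m n).1) (m n).2 cpsi (n0 n)) => y.
  have [Tm hmin] := hm n.
  by have := hmin ((m n).1, y) Tm; rewrite /F/=; lra.
have mz n : NZ (m n).2 <= rz by have [Dm hmin] := hm n; apply: (subz n) => //; exact: hmin.
have mv n : NX (m n).1 <= ra by have [Dm hmin] := hm n; apply: (sub n _ Dm (hmin _ D0)).1.
have ml n : NZ (l n) <= L' by apply: hL' (hl n); exact: mz.
have hd n u : T u -> dlag (m n).1 (l n) u = 0.
  move=> Tu; have [Tm hmin] := hm n.
  apply: (@nonneg_quadratic _ _ (beta / 2 * NX u ^+ 2 + n.+1%:R / 2 * NZ (A u) ^+ 2)).
    by rewrite addr_ge0// mulr_ge0 ?sqr_ge0//; have := n0 n; lra.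
  move=> t; have := hmin ((m n).1 + t *: u, (m n).2) (TD _ _ Tm (TZ t u Tu)).
  rewrite /F /dlag /l/=.
  have -> : aff ((m n).1 + t *: u) - (m n).2 = aff (m n).1 - (m n).2 + t *: A u.
    by rewrite /aff AD AZ addrA [LHS]addrAC.
  move: (aff _ - _) => q; rewrite !sqr_enorm !innerE (innerC eX u) (innerC eZ (A u) q).
  set cu := ipX c u; set cv := ipX c _; set vu := ipX _ u; set uu := ipX u u; set vv := ipX _ _.
  set qq := ipZ q q; set qa := ipZ q _; set aa := ipZ _ _; lra.
pose e3 := prod_euclidean e2 eZ.
have [w|x [phi [phij hx]]] := @bounded_subsequence R _ e3 (fun n => (m n, l n)) (ra + rz + L').
  rewrite -(@ler_pXn2r _ 2)// ?nnegrE ?enorm_ge0//; last first.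
    by have := le_trans (enorm_ge0 eZ _) (mz 0%N); lra.
  rewrite sqr_enorm /= /prod_inner/= -[prod_inner _ _ _ _]/(inner e2 (m w) (m w)) -!sqr_enorm.
  have h1 : enorm e2 (m w) <= ra + rz by rewrite (le_trans (pair_le _))// lerD.
  have h2 := ml w; have h3 := enorm_ge0 e2 (m w); have h4 := enorm_ge0 eZ (l w).
  by rewrite !expr2; nra.
case: x hx => [[v z] lam] hx.
have hx' e : 0 < e -> exists n0, forall j, (n0 <= j)%N ->
    [/\ NX ((m (phi j)).1 - v) < e, NZ ((m (phi j)).2 - z) < e & NZ (l (phi j) - lam) < e].
  move=> e0; have [k _ hk] := (cvg_enormP e3 _ _ _).1 hx e e0; exists k => j /hk /= h.
  have h1 : enorm e2 (m (phi j) - (v, z)) < e.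
    exact: le_lt_trans (enorm_fst_le _ _ (_ - _)) h.
  split; [exact: le_lt_trans (fst_le _) h1|exact: le_lt_trans (snd_le _) h1|].
  exact: le_lt_trans (enorm_snd_le _ _ (_ - _)) h.
have small (y C : R) : 0 <= C -> (forall e, 0 < e -> `|y| <= C * e) -> y = 0.
  move=> C0 h; apply/eqP; rewrite -normr_le0; apply/ler_addgt0Pr => e e0; rewrite add0r.
  have C1 : 0 < C + 1 by lra.
  rewrite (le_trans (h (e / (C + 1)) _)) ?divr_gt0//.
  by rewrite mulrCA ler_piMr ?(ltW e0)// ler_pdivrMr; lra.
exists v, z, lam; split.
- apply: Tcl => B /(nbhs_enormP eX)[e e0 hB]; have [k hk] := hx' e e0.
  have [h1 _ _] := hk k (leqnn k).
  by exists (m (phi k)).1; split; [exact: (hm (phi k)).1|exact: hB].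
- move=> u Tu; apply: (small _ (beta * NX u + NZ (A u))).
    by rewrite addr_ge0 ?mulr_ge0 ?enorm_ge0// ltW.
  move=> e e0; have [k hk] := hx' e e0; have [h1 _ h3] := hk k (leqnn k).
  have <- : dlag v lam u - dlag (m (phi k)).1 (l (phi k)) u = dlag v lam u by rewrite hd// subr0.
  have -> : dlag v lam u - dlag (m (phi k)).1 (l (phi k)) u
    = - (beta * ipX ((m (phi k)).1 - v) u + ipZ (l (phi k) - lam) (A u)).
    by rewrite /dlag !innerE; ring.
  rewrite normrN (le_trans (ler_normD _ _))// normrM (ger0_norm (ltW beta0)).
  have h4 := inner_CS_abs eX ((m (phi k)).1 - v) u; have h5 := inner_CS_abs eZ (l (phi k) - lam) (A u).
  have h6 := ler_wpM2r (enorm_ge0 eX u) (ltW h1); have h7 := ler_wpM2r (enorm_ge0 eZ (A u)) (ltW h3).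
  have h8 := ler_wpM2l (ltW beta0) (le_trans h4 h6).
  by lra.
- have hz : (fun j => (m (phi j)).2) @ \oo --> z.
    by apply/(cvg_enormP eZ) => e e0; have [k hk] := hx' e e0; exists k => // j /= /hk[].
  apply: (@subgrad_closed _ _ eZ psi (fun j => (m (phi j)).2) (fun j => l (phi j))) => //.
  + by apply: (@cvg_comp _ _ _ _ psi _ _ _ hz); exact: (cvx_continuous eZ cpsi (x := z)).
  + by apply/(cvg_enormP eZ) => e e0; have [k hk] := hx' e e0; exists k => // j /= /hk[].
- apply/eqP; rewrite -subr_eq0 -(enorm_eq0 eZ); apply/eqP.
  apply: (small _ (2 + kap)); first by rewrite addr_ge0.
  move=> e e0; have [k hk] := hx' e e0.
  pose j := maxn k (Num.bound (L' / e)).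
  have [h1 h2 _] := hk j (leq_maxl _ _).
  rewrite ger0_norm ?enorm_ge0//.
  have h3 : NZ (aff (m (phi j)).1 - (m (phi j)).2) <= e.
    have := ml (phi j); rewrite /l (enormZp _ _ (ltW (n0 (phi j)))) => h3.
    have h4 : L' / e <= (phi j).+1%:R.
      have Le0 : 0 <= L' / e by rewrite divr_ge0// ltW.
      rewrite (le_trans (ltW (archi_boundP Le0)))// ler_nat.
      by rewrite (leq_trans (leq_maxr k _))// (leq_trans (phij j)).
    rewrite ler_pdivrMr// in h4.
    by rewrite -(ler_pM2l (n0 (phi j))); lra.
  have -> : z - aff v = (aff (m (phi j)).1 - aff v) - (aff (m (phi j)).1 - (m (phi j)).2) - ((m (phi j)).2 - z).
    move: (aff (m (phi j)).1) (m (phi j)).2 (aff v) => y1 y2 y3.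
    by rewrite (subrACA y1 y3) subrr sub0r opprB (subrACA y2 y3) subrr sub0r opprB.
  rewrite affB (le_trans (enormB _ _ _))// (le_trans (lerD (enormB _ _ _) (lexx _)))//.
  have := Abd ((m (phi j)).1 - v); have := ler_wpM2l kap0 (ltW h1); lra.
Qed.

End bounds.
(** ** Semi-proximal ADMM *)

Section rates.
Variables (sig kap : R).
Hypotheses (sig0 : 0 < sig) (kap0 : 0 <= kap).
Hypothesis Abd : forall u, NZ (A u) <= kap * NX u.
Local Notation gam := (sig * kap ^+ 2).

Let gam0 : 0 <= gam. Proof. by rewrite mulr_ge0 ?sqr_ge0// ltW. Qed.

Let Asq u : sig * ipZ (A u) (A u) <= gam * ipX u u.
Proof.
rewrite -!sqr_enorm -mulrA ler_pM2l// -exprMn.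
by rewrite ler_pXn2r// ?nnegrE ?mulr_ge0 ?enorm_ge0.
Qed.

(** The proximal weight gam I - sig A^* A. *)
Definition prox_form (u w : X) := gam * ipX u w - sig * ipZ (A u) (A w).

Lemma prox_form_psd : psd_form prox_form.
Proof.
split=> [u w|u v w|a u v|u]; rewrite /prox_form.
- by rewrite innerC (innerC eZ).
- by rewrite AD !innerDl; ring.
- by rewrite AZ !innerZl; ring.
- by rewrite subr_ge0 Asq.
Qed.

Lemma prox_form_le u : prox_form u u <= gam * NX u ^+ 2.
Proof.
rewrite /prox_form -!sqr_enorm gerBl mulr_ge0 ?sqr_ge0//; exact: ltW.
Qed.

(** The first-order condition of the v-update, in which the proximal term has replaced
    the quadratic penalty by its linearization at vc. *)
Definition penalized_stationary vc lam z v :=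
  T v /\ forall u, T u ->
    ipX (c + beta *: v) u + ipZ (lam + sig *: (aff vc - z)) (A u) + gam * ipX (v - vc) u = 0.

Definition admm_opt v z lam v' z' lam' :=
  [/\ penalized_stationary v lam z v', subgrad eZ psi z' lam'
    & lam' = lam + sig *: (aff v' - z')].

(** The squared distance between two triples in the metric in which the ADMM is Fejer
    monotone. *)
Definition lyapunov vs zs ls v z lam :=
  sig^-1 * ipZ (lam - ls) (lam - ls) + sig * ipZ (z - zs) (z - zs) + prox_form (v - vs) (v - vs).

Lemma lyapunov_ge0 vs zs ls v z lam : 0 <= lyapunov vs zs ls v z lam.
Proof.
have s0 : 0 <= sig^-1 by rewrite invr_ge0 ltW.
have := psd_ge0 prox_form_psd (v - vs).
have := mulr_ge0 s0 (psd_ge0 (inner_psd eZ) (lam - ls)).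
have := mulr_ge0 (ltW sig0) (psd_ge0 (inner_psd eZ) (z - zs)).
rewrite /lyapunov; lra.
Qed.

(** The multiplier update turns the optimality of v' into stationarity at lam', up to
    the length of the step. *)
Lemma admm_dlag v z lam v' z' lam' u : admm_opt v z lam v' z' lam' -> T u ->
  dlag v' lam' u = - (sig * ipZ (z' - z) (A u) + prox_form (v' - v) u).
Proof.
move=> [[Tv' hv] _ hl] Tu; have := hv u Tu; rewrite /dlag /prox_form.
have e1 : ipZ (A (v' - v)) (A u) = ipZ (aff v') (A u) - ipZ (aff v) (A u).
  by rewrite -innerBl affB.
by rewrite e1 hl !innerE => h; lra.
Qed.

(** Each step moves towards every KKT point, up to a cross term that monotonicity of
    the subdifferential makes nonnegative from the second step on. *)
Lemma admm_descent_cross vs zs ls v z lam v' z' lam' :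
  kkt vs zs ls -> admm_opt v z lam v' z' lam' ->
  lyapunov vs zs ls v' z' lam' + lyapunov v z lam v' z' lam'
    + 2 * ipZ (z' - z) (lam' - lam) + 2 * beta * NX (v' - vs) ^+ 2
  <= lyapunov vs zs ls v z lam.
Proof.
move=> [Ts hs sub_s zsE] hopt; have [[Tv' _] sub' hl] := hopt.
have Tu : T (v' - vs) by exact: subspaceB.
have h1 := admm_dlag hopt Tu; have h2 := hs _ Tu.
have h3 := subgrad_monotone sub_s sub'.
have Au w : sig * ipZ w (A (v' - vs)) = sig * ipZ w (z' - zs) + ipZ w (lam' - lam).
  by rewrite -affB -zsE hl addrBK !innerE; ring.
have p1 := psd_polar (inner_psd eZ) lam' lam ls.
have p2 := psd_polar (inner_psd eZ) z' z zs.
have p3 := psd_polar prox_form_psd v' v vs.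
rewrite /lyapunov sqr_enorm.
have e1 : dlag v' lam' (v' - vs) - dlag vs ls (v' - vs)
  = beta * ipX (v' - vs) (v' - vs) + ipZ (lam' - ls) (A (v' - vs)).
  by rewrite /dlag !innerE; ring.
rewrite h1 h2 in e1.
have e2 := Au (lam' - ls); have e3 := Au (z' - z).
have s0 : 0 < sig^-1 by rewrite invr_gt0.
have sV : sig^-1 * sig = 1 by rewrite mulVf// gt_eqF.
move: e1 e2 e3 p1 p2 p3 h3.
set q1 := ipZ (z' - z) (A _); set q2 := prox_form (v' - v) _; set q3 := ipX _ _.
set q4 := ipZ (lam' - ls) (A _); set q5 := ipZ (lam' - ls) (z' - zs); set q6 := ipZ (lam' - ls) (lam' - lam).
set q7 := ipZ (z' - z) (z' - zs); set q8 := ipZ (z' - z) (lam' - lam).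
rewrite (innerC eZ (lam' - lam) (lam' - ls)) -/q6.
set r1 := ipZ (lam' - ls) _; set r2 := ipZ (lam' - lam) _; set r3 := ipZ (lam - ls) _.
set t1 := ipZ (z' - zs) _; set t2 := ipZ (z' - z) _; set t3 := ipZ (z - zs) _.
set x1 := prox_form _ _; set x2 := prox_form _ _; set x3 := prox_form _ _.
move=> e1 e2 e3 p1 p2 p3 h3.
have f2 : q4 = q5 + sig^-1 * q6.
  by rewrite -[LHS]mul1r -sV -mulrA e2 mulrDr mulrA sV mul1r.
have f1 : sig^-1 * (2 * q6) = sig^-1 * r1 + sig^-1 * r2 - sig^-1 * r3 by rewrite p1; ring.
have f3 : sig * (2 * q7) = sig * t1 + sig * t2 - sig * t3 by rewrite p2; ring.
lra.
Qed.

Lemma admm_descent vs zs ls v z lam v' z' lam' :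
  kkt vs zs ls -> admm_opt v z lam v' z' lam' -> subgrad eZ psi z lam ->
  lyapunov vs zs ls v' z' lam' + lyapunov v z lam v' z' lam' + 2 * beta * NX (v' - vs) ^+ 2
  <= lyapunov vs zs ls v z lam.
Proof.
move=> hk hopt hz; have h := admm_descent_cross hk hopt; have [_ sub' _] := hopt.
have := subgrad_monotone hz sub'; rewrite innerC; lra.
Qed.

Lemma admm_descent_weak vs zs ls v z lam v' z' lam' :
  kkt vs zs ls -> admm_opt v z lam v' z' lam' ->
  lyapunov vs zs ls v' z' lam' + 2 * beta * NX (v' - vs) ^+ 2 <= lyapunov vs zs ls v z lam.
Proof.
move=> hk hopt; have h := admm_descent_cross hk hopt.
have h1 : 0 <= lyapunov v z lam v' z' lam' + 2 * ipZ (z' - z) (lam' - lam).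
  have h2 : 0 <= sig^-1 * NZ (sig *: (z' - z) + (lam' - lam)) ^+ 2.
    by rewrite mulr_ge0 ?sqr_ge0// invr_ge0 ltW.
  have h3 := psd_ge0 prox_form_psd (v' - v).
  have e : sig^-1 * NZ (sig *: (z' - z) + (lam' - lam)) ^+ 2
    = sig * ipZ (z' - z) (z' - z) + 2 * ipZ (z' - z) (lam' - lam) + sig^-1 * ipZ (lam' - lam) (lam' - lam).
    rewrite sqr_enorm; move: (z' - z) (lam' - lam) => a b.
    by rewrite !innerE (innerC eZ b a); field; rewrite gt_eqF.
  by rewrite e in h2; rewrite /lyapunov; lra.
lra.
Qed.

(** Each residual is controlled by one term of the Lyapunov length of the step. *)
Lemma admm_residual v z lam v' z' lam' : admm_opt v z lam v' z' lam' ->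
  let dec := lyapunov v z lam v' z' lam' in
  NZ (aff v' - z') <= Num.sqrt (dec / sig) /\
  forall u, T u -> `|dlag v' lam' u| <= 2 * Num.sqrt (gam * dec) * NX u.
Proof.
move=> hopt dec; have [_ _ hl] := hopt.
have d1 : sig^-1 * NZ (lam' - lam) ^+ 2 <= dec.
  by rewrite sqr_enorm /dec /lyapunov -addrA lerDl addr_ge0 ?(psd_ge0 prox_form_psd)// -sqr_enorm mulr_ge0 ?sqr_ge0// ltW.
have d2 : sig * NZ (z' - z) ^+ 2 <= dec.
  rewrite sqr_enorm /dec /lyapunov addrAC lerDr addr_ge0 ?(psd_ge0 prox_form_psd)// -sqr_enorm.
  by rewrite mulr_ge0 ?sqr_ge0// invr_ge0 ltW.
have d3 : prox_form (v' - v) (v' - v) <= dec.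
  by rewrite /dec /lyapunov lerDr -!sqr_enorm addr_ge0// mulr_ge0 ?sqr_ge0// ?invr_ge0 ltW.
have dec0 : 0 <= dec := le_trans (psd_ge0 prox_form_psd _) d3.
split.
  have e : NZ (lam' - lam) = sig * NZ (aff v' - z').
    by rewrite hl addrBK (enormZp _ _ (ltW sig0)).
  rewrite -[leLHS]ger0_norm ?enorm_ge0// -sqrtr_sqr ler_wsqrtr// ler_pdivlMr//.
  rewrite e exprMn in d1.
  have e2 : sig^-1 * (sig ^+ 2 * NZ (aff v' - z') ^+ 2) = NZ (aff v' - z') ^+ 2 * sig.
    by field; rewrite gt_eqF.
  by rewrite -e2.
move=> u Tu; rewrite (admm_dlag hopt Tu) normrN (le_trans (ler_normD _ _))//.
have sq w y : 0 <= w -> 0 <= y -> w ^+ 2 <= y -> w <= Num.sqrt y.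
  by move=> w0 y0 h; rewrite -[leLHS]ger0_norm// -sqrtr_sqr ler_wsqrtr.
have gd : 0 <= gam * dec by rewrite mulr_ge0.
have uN := enorm_ge0 eX u.
have h1 : `|sig * ipZ (z' - z) (A u)| <= Num.sqrt (gam * dec) * NX u.
  rewrite normrM (ger0_norm (ltW sig0)).
  have i1 := inner_CS_abs eZ (z' - z) (A u).
  have i2 := ler_wpM2l (enorm_ge0 eZ (z' - z)) (Abd u).
  have i3 : sig * kap * NZ (z' - z) <= Num.sqrt (gam * dec).
    apply: sq => //; first by rewrite !mulr_ge0 ?enorm_ge0// ltW.
    have -> : (sig * kap * NZ (z' - z)) ^+ 2 = gam * (sig * NZ (z' - z) ^+ 2) by ring.
    by rewrite ler_wpM2l.
  have i4 := ler_wpM2r uN i3; have i5 := ler_wpM2l (ltW sig0) (le_trans i1 i2).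
  lra.
have h2 : `|prox_form (v' - v) u| <= Num.sqrt (gam * dec) * NX u.
  rewrite (le_trans (psd_CS_abs prox_form_psd _ _))//.
  have i1 : seminorm (B := prox_form) (v' - v) <= Num.sqrt dec by rewrite ler_wsqrtr.
  have i2 : seminorm (B := prox_form) u <= Num.sqrt gam * NX u.
    rewrite -[X in _ <= _ * X]ger0_norm// -sqrtr_sqr -sqrtrM// ler_wsqrtr//; exact: prox_form_le.
  rewrite mulrC sqrtrM// mulrAC.
  by rewrite ler_pM ?seminorm_ge0.
by rewrite mulrDl in h1 *; lra.
Qed.

(** The smallest Lyapunov value over all KKT points drops by the length of each step,
    which by assumption is comparable to what remains. *)
Lemma admm_linear_rate (w : nat -> X * Z * Z) (C : R) vs zs ls : 0 < C ->
  kkt vs zs ls ->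
  (forall l, admm_opt (w l).1.1 (w l).1.2 (w l).2 (w l.+1).1.1 (w l.+1).1.2 (w l.+1).2) ->
  (forall l, exists v z lam, kkt v z lam /\
     lyapunov v z lam (w l.+1).1.1 (w l.+1).1.2 (w l.+1).2
     <= C * lyapunov (w l).1.1 (w l).1.2 (w l).2 (w l.+1).1.1 (w l.+1).1.2 (w l.+1).2) ->
  forall l, lyapunov (w l.+1).1.1 (w l.+1).1.2 (w l.+1).2 (w l.+2).1.1 (w l.+2).1.2 (w l.+2).2
    <= (C / (1 + C)) ^+ l * lyapunov vs zs ls (w 0).1.1 (w 0).1.2 (w 0).2.
Proof.
move=> C0 hs hw hC.
pose V (s x : X * Z * Z) := lyapunov s.1.1 s.1.2 s.2 x.1.1 x.1.2 x.2.
pose S (x : X * Z * Z) := [set V s x | s in [set s | kkt s.1.1 s.1.2 s.2]].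
pose D l := inf (S (w l)).
have Slb x : has_lbound (S x) by exists 0 => _ [s _ <-]; exact: lyapunov_ge0.
have S0 x : S x !=set0 by exists (V (vs, zs, ls) x), (vs, zs, ls).
have D0 l : 0 <= D l by apply: lb_le_inf => // _ [s _ <-]; exact: lyapunov_ge0.
have Dstep l : D l.+2 + V (w l.+1) (w l.+2) <= D l.+1.
  apply: lb_le_inf => // _ [s hks <-].
  have [_ subz _] := hw l.
  have h := admm_descent hks (hw l.+1) subz.
  have h1 : D l.+2 <= V s (w l.+2) by apply: ge_inf => //; exists s.
  have h2 : 0 <= 2 * beta * NX ((w l.+2).1.1 - s.1.1) ^+ 2.
    by rewrite mulr_ge0 ?sqr_ge0// mulr_ge0// ltW.
  by rewrite /V in h1 *; lra.
have DC l : D l.+2 <= C * V (w l.+1) (w l.+2).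
  have [v [z [lam [hk hle]]]] := hC l.+1.
  by apply: le_trans hle; apply: ge_inf => //; exists (v, z, lam).
have Dq l : D l.+1 <= (C / (1 + C)) ^+ l * V (vs, zs, ls) (w 0).
  elim: l => [|l IH].
    rewrite mul1r; apply: (@le_trans _ _ (V (vs, zs, ls) (w 1%N))).
      by apply: ge_inf => //; exists (vs, zs, ls).
    have := admm_descent_weak hs (hw 0%N).
    have h2 : 0 <= 2 * beta * NX ((w 1%N).1.1 - vs) ^+ 2.
      by rewrite mulr_ge0 ?sqr_ge0// mulr_ge0// ltW.
    by rewrite /V/=; lra.
  have C1 : 0 < 1 + C by lra.
  rewrite exprS -mulrA (le_trans _ (ler_wpM2l _ IH)) ?divr_ge0 ?(ltW C0) ?(ltW C1)//.
  rewrite mulrAC ler_pdivlMr//; have := Dstep l; have := DC l => h1 h2.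
  by have := ler_wpM2l (ltW C0) h2; lra.
move=> l; apply: le_trans (Dq l); have := Dstep l; have := D0 l.+2; rewrite /V; lra.
Qed.

(** ** Accelerated semi-proximal ADMM *)

Definition accelerated_opt vb lamb v z lam :=
  [/\ subgrad eZ psi z lam, lam = lamb + sig *: (aff vb - z)
    & penalized_stationary vb lam z v].

(** In (v, lam) the step is a proximal point step for the KKT operator in this
    degenerate metric. *)
Definition metric (p q : (X * Z)%type) :=
  gam * ipX p.1 q.1 + ipZ (A p.1) q.2 + ipZ (A q.1) p.2 + sig^-1 * ipZ p.2 q.2.

Lemma metric_psd : psd_form metric.
Proof.
split=> [p q|p q r|a p q|p]; rewrite /metric/=.
- by rewrite innerC (innerC eZ p.2 q.2); ring.
- by rewrite AD !innerE; ring.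
- by rewrite AZ !innerE; ring.
- have h1 := Asq p.1.
  have h2 : 0 <= sig^-1 * NZ (sig *: A p.1 + p.2) ^+ 2.
    by rewrite mulr_ge0 ?sqr_ge0// invr_ge0 ltW.
  have e : sig^-1 * NZ (sig *: A p.1 + p.2) ^+ 2
    = sig * ipZ (A p.1) (A p.1) + 2 * ipZ (A p.1) p.2 + sig^-1 * ipZ p.2 p.2.
    rewrite sqr_enorm; move: (A p.1) p.2 => a b.
    by rewrite !innerE (innerC eZ b a); field; rewrite gt_eqF.
  by rewrite e in h2; lra.
Qed.

Lemma metric_le p : metric p p <= 2 * (gam * NX p.1 ^+ 2 + sig^-1 * NZ p.2 ^+ 2).
Proof.
have h1 := Asq p.1.
have h2 : 0 <= sig^-1 * NZ (sig *: A p.1 - p.2) ^+ 2.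
  by rewrite mulr_ge0 ?sqr_ge0// invr_ge0 ltW.
have e : sig^-1 * NZ (sig *: A p.1 - p.2) ^+ 2
  = sig * ipZ (A p.1) (A p.1) - 2 * ipZ (A p.1) p.2 + sig^-1 * ipZ p.2 p.2.
  rewrite sqr_enorm; move: (A p.1) p.2 => a b.
  by rewrite !innerE (innerC eZ b a); field; rewrite gt_eqF.
by rewrite e in h2; rewrite /metric !sqr_enorm; lra.
Qed.

Lemma accelerated_dlag vb lamb v z lam u : accelerated_opt vb lamb v z lam -> T u ->
  dlag v lam u = - (ipZ (lam - lamb) (A u) + gam * ipX (v - vb) u).
Proof.
move=> [_ hl [Tv hv]] Tu; have := hv u Tu; rewrite /dlag.
have -> : sig *: (aff vb - z) = lam - lamb by rewrite hl addrBK.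
by rewrite !innerE => h; lra.
Qed.

Lemma accelerated_z vb lamb v z lam w : accelerated_opt vb lamb v z lam ->
  ipZ z w = ipZ (aff vb) w - sig^-1 * ipZ (lam - lamb) w.
Proof.
move=> [_ hl _].
have -> : lam - lamb = sig *: (aff vb - z) by rewrite hl addrBK.
by rewrite innerZl mulrA mulVf ?gt_eqF// mul1r innerBl; ring.
Qed.

(** Monotonicity of the KKT operator along two proximal steps; the strong convexity of
    the model in v yields the additional term. *)
Lemma accelerated_monotone vb lamb v z lam vb' lamb' v' z' lam' :
  accelerated_opt vb lamb v z lam -> accelerated_opt vb' lamb' v' z' lam' ->
  metric ((v, lam) - (vb, lamb) - ((v', lam') - (vb', lamb'))) ((v, lam) - (v', lam'))
    + beta * NX (v - v') ^+ 2 <= 0.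
Proof.
move=> h h'; have [sub _ [Tv _]] := h; have [sub' _ [Tv' _]] := h'.
have Tu : T (v - v') by exact: subspaceB.
have h1 := accelerated_dlag h Tu; have h2 := accelerated_dlag h' Tu.
have h3 := subgrad_monotone sub' sub.
have h4 : ipZ (z - z') (lam - lam') = ipZ (A (vb - vb')) (lam - lam')
    - sig^-1 * ipZ (lam - lamb - (lam' - lamb')) (lam - lam').
  rewrite (innerBl eZ z) (accelerated_z _ h) (accelerated_z _ h') -affB.
  by rewrite (innerBl eZ (aff vb)) (innerBl eZ (lam - lamb)); ring.
rewrite innerC h4 in h3.
rewrite /metric /= sqr_enorm.
have e1 : dlag v lam (v - v') - dlag v' lam' (v - v')
  = beta * ipX (v - v') (v - v') + ipZ (lam - lam') (A (v - v')).
  by rewrite /dlag !innerE; ring.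
rewrite h1 h2 in e1.
have -> : A (v - vb - (v' - vb')) = A (v - v') - A (vb - vb').
  by rewrite -AB subrACA.
rewrite (innerBl eX (v - vb)) (innerBl eZ (A (v - v'))) (innerC eZ (A (v - v')) (lam - lamb - (lam' - lamb'))).
rewrite (innerBl eZ (lam - lamb) _ (A _)) (innerC eZ (A (v - v')) (lam - lam')).
lra.
Qed.

Lemma kkt_accelerated v z lam : kkt v z lam -> accelerated_opt v lam v z lam.
Proof.
move=> [Tv hv sub zE]; split=> //; first by rewrite zE subrr scaler0 addr0.
split=> // u Tu; rewrite zE !subrr scaler0 addr0 inner0l mulr0 addr0; exact: hv.
Qed.

Local Notation mnorm := (@seminorm R _ metric).

(** Cauchy-Schwarz for the metric, against (0, aff v - z) and against (u, 0). *)
Lemma accelerated_residual vb lamb v z lam : accelerated_opt vb lamb v z lam ->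
  let r := mnorm ((v, lam) - (vb, lamb)) in
  NZ (aff v - z) <= r / Num.sqrt sig /\
  forall u, T u -> `|dlag v lam u| <= r * Num.sqrt gam * NX u.
Proof.
move=> h r; have r0 : 0 <= r := seminorm_ge0 _.
have ss : 0 < Num.sqrt sig by rewrite sqrtr_gt0.
split.
  set y := aff v - z.
  have h1 : NZ y ^+ 2 = metric ((v, lam) - (vb, lamb)) (0, y).
    rewrite sqr_enorm {1}/y innerBl (accelerated_z _ h) /metric/= inner0r A0 inner0l -affB !innerBl.
    by ring.
  have h2 := psd_CS metric_psd ((v, lam) - (vb, lamb)) (0, y).
  have h3 : mnorm (0, y) = NZ y / Num.sqrt sig.
    rewrite /seminorm /metric/= inner0r mulr0 A0 inner0l !add0r -sqr_enorm.
    by rewrite sqrtrM ?invr_ge0 ?ltW// sqrtrV ?ltW// sqrtr_sqr ger0_norm ?enorm_ge0// mulrC.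
  rewrite -h1 h3 -/r in h2.
  have [y0|y0] := eqVneq (NZ y) 0; first by rewrite y0 divr_ge0// ltW.
  have y1 : 0 < NZ y by rewrite lt_neqAle eq_sym y0 enorm_ge0.
  by rewrite -(ler_pM2r y1) -expr2 (le_trans h2)// mulrAC mulrA.
move=> u Tu; rewrite (accelerated_dlag h Tu) normrN.
have -> : ipZ (lam - lamb) (A u) + gam * ipX (v - vb) u = metric ((v, lam) - (vb, lamb)) (u, 0).
  by rewrite /metric/= !inner0r (innerC eZ (A u)); ring.
rewrite (le_trans (psd_CS_abs metric_psd _ _))// -mulrA ler_wpM2l//.
rewrite /seminorm /metric/= !inner0r mulr0 !addr0 -sqr_enorm sqrtrM//.
by rewrite sqrtr_sqr ger0_norm ?enorm_ge0.
Qed.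

(** The comparison with the constant step at a KKT point bounds v itself, which the
    metric may not see. *)
Lemma accelerated_nonexpansive vb lamb v z lam vs zs ls :
  accelerated_opt vb lamb v z lam -> kkt vs zs ls ->
  beta * NX (v - vs) ^+ 2 <= mnorm ((v, lam) - (vb, lamb)) * mnorm ((vb, lamb) - (vs, ls)).
Proof.
move=> h /kkt_accelerated hs; have := accelerated_monotone h hs.
rewrite subrr subr0.
set e := (v, lam) - (vs, ls); set d := (v, lam) - (vb, lamb); set f := (vb, lamb) - (vs, ls).
have ef : e = d + f by rewrite /e /d /f addrA subrK.
move=> h1; have h2 : metric d e = metric d d + metric d f by rewrite ef (psdDr metric_psd).
have h3 := psd_ge0 metric_psd d; have h4 := psd_CS_abs metric_psd d f.
by rewrite ler_norml in h4; move/andP: h4 => [h4 _]; lra.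
Qed.

(** A proximal point step is firmly nonexpansive, so its relaxed residual is cocoercive,
    as the fast Krasnoselskii-Mann iteration requires. *)
Theorem accelerated_rate (alpha vrho : R) (p ph q : nat -> (X * Z)%type) (z : nat -> Z) vs zs ls :
  2 <= alpha -> 0 < vrho <= 2 -> kkt vs zs ls ->
  (forall l, accelerated_opt (p l).1 (p l).2 (q l).1 (z l) (q l).2) ->
  (forall l, ph l.+1 = (1 - vrho) *: p l + vrho *: q l) ->
  (forall l, p l.+1 = p l + (alpha / (2 * (l%:R + alpha))) *: (ph l.+1 - p l)
                    + (l%:R / (l%:R + alpha)) *: (ph l.+1 - ph l)) ->
  forall l, (l%:R + alpha - 1) * (vrho * mnorm (q l - p l)) <= 2 * (alpha - 1) * mnorm (p 0%N - (vs, ls))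
    /\ mnorm (p l - (vs, ls)) <= mnorm (p 0%N - (vs, ls)).
Proof.
move=> a2 /andP[v0 v2] hs hq hph hp.
have hB := metric_psd.
pose b l := vrho *: (p l - q l).
have eta2 (x : (X * Z)%type) : (x.1, x.2) = x by case: x.
have firm vb lamb v zz lam vb' lamb' v' zz' lam' :
    accelerated_opt vb lamb v zz lam -> accelerated_opt vb' lamb' v' zz' lam' ->
  forall dp dq, dp = (vb, lamb) - (vb', lamb') -> dq = (v, lam) - (v', lam') ->
  metric (vrho *: (dp - dq)) (vrho *: (dp - dq)) <= 2 * metric (vrho *: (dp - dq)) dp.
  move=> h h' dp dq dpE dqE; have := accelerated_monotone h h'; rewrite subrACA -dpE -dqE.
  have bn : 0 <= beta * NX (v - v') ^+ 2 by rewrite mulr_ge0 ?sqr_ge0// ltW.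
  have m0 := psd_ge0 hB (dp - dq).
  rewrite !(psdZl hB) !(psdZr hB) -[dq - dp]opprB (psdNl hB) => h1.
  have e : metric (dp - dq) dp = metric (dp - dq) (dp - dq) + metric (dp - dq) dq.
    by rewrite -(psdDr hB) subrK.
  rewrite e; move: m0 h1 bn.
  set m := metric (dp - dq) (dp - dq); set n := metric (dp - dq) dq; set y := beta * _.
  move=> m0 h1 bn; have -> : 2 * (vrho * (m + n)) = vrho * (2 * (m + n)) by ring.
  by rewrite ler_pM2l//; have := ler_wpM2r m0 v2; lra.
have coco l : metric (b l.+1 - b l) (b l.+1 - b l) <= 2 * metric (b l.+1 - b l) (p l.+1 - p l).
  by have := firm _ _ _ _ _ _ _ _ _ _ (hq l.+1) (hq l) _ _ erefl erefl; rewrite !eta2 /= -subrACA scalerBr.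
have coco_star l : metric (b l) (b l) <= 2 * metric (b l) (p l - (vs, ls)).
  have := firm _ _ _ _ _ _ _ _ _ _ (hq l) (kkt_accelerated hs) _ _ erefl erefl.
  by rewrite !eta2 /= -subrACA subrr subr0.
have phE l w : metric (ph l.+1) w = metric (p l) w - vrho * (metric (p l) w - metric (q l) w).
  by rewrite hph !(psdE hB); ring.
have rec l w : (l%:R + alpha) * (metric (p l.+1) w - metric (p l) w)
  = l%:R * (metric (p l) w - metric (p l.-1) w) - alpha / 2 * metric (b l) w
    - l%:R * (metric (b l) w - metric (b l.-1) w).
  have la : l%:R + alpha != 0 by rewrite gt_eqF// ltr_wpDl//; lra.
  rewrite hp !(psdDl hB) !(psdZl hB) !(psdBl hB) phE.
  case: l la => [|l] la; first by rewrite /= mulr0n add0r in la *; rewrite !mul0r; field.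
  by rewrite phE /=; move: (l.+1%:R) la => N la; field.
move=> l; split; last exact: (fast_KM_bounded hB a2 coco coco_star rec).
have := fast_KM_residual hB a2 coco coco_star rec l.
have -> : mnorm (b l) = vrho * mnorm (q l - p l).
  by rewrite /b (seminormZ hB) ger0_norm ?(ltW v0)// -(seminormN hB) opprB.
by [].
Qed.

End rates.
End inner_solvers.


(** * The subproblems of the algorithm *)

Section subproblems.
Context {R : realType} {X Y : normedModType R} (P : problem X Y).
Hypothesis hP : standing_assumptions P.
Local Notation NX := (enorm (eX P)).
Local Notation NZ := (enorm (eZ P)).
Local Notation ipX := (inner (eX P)).
Local Notation ipZ := (inner (eZ P)).

Lemma K_closed : closed (K P). Proof. by have [_ [? _] _ _ _] := hP. Qed.
Lemma K_convex : convex_set (K P : set (convex_lmodType Y)).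
Proof. by have [_ [_ ?] _ _ _] := hP. Qed.
Lemma K_nonempty : K P !=set0.
Proof. by have [_ _ _ _ [_ _ [x [Kx _]]]] := hP; exists (g P x). Qed.
Lemma tnorm_norm : is_norm (tnorm P). Proof. by have [_ _ ? _ _] := hP. Qed.
Lemma th_cvx : cvx (th P).
Proof. by have [_ _ _ _ [h _ _]] := hP; exact: convex_function_cvx h. Qed.
Lemma h_cvx : cvx (h P).
Proof. by have [_ _ _ _ [_ h _]] := hP; exact: convex_function_cvx h. Qed.
Lemma M_tangent x : M P x -> linear_subspace (tangent (M P) x) /\ closed (tangent (M P) x).
Proof. by have [[hM _] _ _ _ _] := hP; exact: (tangent_subspace (eX P) hM). Qed.

Variable s : subproblem X.
Hypotheses (Ms : M P (sx s)) (rho0 : 0 <= srho s) (beta0 : 0 < sbeta s).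
Local Notation T := (tangent (M P) (sx s)).
Local Notation A := (opA P s).
Local Notation g0 := (sx s, g P (sx s)).
Local Notation psi_s := (psi P s).
Local Notation kap := (opnorm (eX P) (eZ P) A).
Local Notation dlag_s := (dlag (eX P) (eZ P) A (gradell P s) (sbeta s)).

Let Tsub : linear_subspace T. Proof. exact: (M_tangent Ms).1. Qed.
Let Tcl : closed T. Proof. exact: (M_tangent Ms).2. Qed.

Lemma opAD u v : A (u + v) = A u + A v.
Proof. by rewrite /opA jacD. Qed.

Lemma opAZ a u : A (a *: u) = a *: A u.
Proof. by rewrite /opA jacZ. Qed.

Lemma opA_le u : NZ (A u) <= kap * NX u.
Proof. exact: opnormP opAD opAZ u. Qed.

Lemma kap_ge0 : 0 <= kap.
Proof. exact: opnorm_ge0 opAD opAZ. Qed.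

Lemma G_aff v : G P s v = aff A g0 v.
Proof. by []. Qed.

Lemma gradG_inner xi u : ipX (gradG P s xi) u = ipZ xi (A u).
Proof. by rewrite innerDl adjgP. Qed.

Lemma psi_cvx : cvx psi_s.
Proof. exact: cvx_psi K_closed K_convex K_nonempty tnorm_norm th_cvx _ rho0. Qed.

Lemma stat_inner v xi u : T u -> ipX (stat_vec P s v xi) u = dlag_s v xi u.
Proof.
by move=> Tu; rewrite /stat_vec /projT (proj_inner _ Tsub Tcl)// innerDl gradG_inner.
Qed.

Lemma stat_le v xi r : 0 <= r -> (forall u, T u -> `|dlag_s v xi u| <= r * NX u) ->
  NX (stat_vec P s v xi) <= r.
Proof.
move=> r0 h; apply: (enorm_proj_le Tsub Tcl) => // u Tu.
by rewrite innerDl gradG_inner (le_trans (ler_norm _))//; exact: h.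
Qed.

Definition kkt_sub := kkt (eX P) (eZ P) T A g0 (gradell P s) (sbeta s) psi_s.
Definition admm_opt_sub sig :=
  admm_opt (eX P) (eZ P) T A g0 (gradell P s) (sbeta s) psi_s sig kap.
Definition accelerated_opt_sub sig :=
  accelerated_opt (eX P) (eZ P) T A g0 (gradell P s) (sbeta s) psi_s sig kap.
Definition lyapunov_sub sig := lyapunov (eX P) (eZ P) A sig kap.

Lemma wnorm_prox_form sig u : 0 < sig ->
  wnorm (eX P) (proxQ P s sig) u ^+ 2 = prox_form (eX P) (eZ P) A sig kap u u.
Proof.
move=> sig0; have e : ipX u (proxQ P s sig u) = prox_form (eX P) (eZ P) A sig kap u u.
  rewrite /proxQ /prox_form /gam innerBr !innerZr (innerC _ u (adjoint _ _ _ _)).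
  by rewrite (adjointP _ _ opAD opAZ).
by rewrite /wnorm sqr_sqrtr e// (psd_ge0 (prox_form_psd opAD opAZ sig0 kap_ge0 opA_le)).
Qed.

(** Along v + t u the objective of the update is a quadratic polynomial in t, minimal
    at t = 0. *)
Lemma v_update_stationary sig vc z lam v : 0 < sig -> v_update P s sig vc z lam v ->
  penalized_stationary (eX P) (eZ P) T A g0 (gradell P s) (sbeta s) sig kap vc lam z v.
Proof.
move=> sig0 [Tv hmin]; split=> // u Tu; have [_ TD TZ] := Tsub.
have hQ := prox_form_psd opAD opAZ sig0 kap_ge0 opA_le.
apply: (@nonneg_quadratic _ _ (sbeta s / 2 * ipX u u + sig / 2 * ipZ (A u) (A u)
    + 2^-1 * prox_form (eX P) (eZ P) A sig kap u u)).
  rewrite !addr_ge0// mulr_ge0 ?(psd_ge0 hQ) ?(psd_ge0 (inner_psd _))//; have := beta0; lra.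
move=> t; have := hmin (v + t *: u) (TD _ _ Tv (TZ t u Tu)).
rewrite !wnorm_prox_form// /augL /ell !G_aff.
have -> : v + t *: u - vc = (v - vc) + t *: u by rewrite addrAC.
have -> : aff A g0 (v + t *: u) - z = aff A g0 v - z + t *: A u.
  by rewrite /aff opAD opAZ addrA [LHS]addrAC.
have e : ipZ (aff A g0 vc - z) (A u) = ipZ (aff A g0 v - z) (A u) - ipZ (A (v - vc)) (A u).
  rewrite -innerBl; congr (ipZ _ _).
  by rewrite -(affB g0 opAD opAZ) subrACA subrr sub0r opprB.
move: (v - vc) e => d e.
rewrite !(psdE hQ) (psdC hQ u) !sqr_enorm /prox_form.
move: (aff A g0 vc - z) (aff A g0 v - z) (A d) (A u) (gradell P s) e.
move=> r q Ad Au c e; rewrite !innerDl !innerDr !innerZl !innerZr e.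
rewrite (innerC _ Au q) (innerC _ u v); lra.
Qed.

Lemma z_update_subgrad sig v lam z : 0 < sig -> z_update P s sig v lam z ->
  subgrad (eZ P) psi_s z (lam + sig *: (G P s v - z)).
Proof.
move=> sig0 [_ hmin].
have -> : lam + sig *: (G P s v - z) = sig *: (G P s v + sig^-1 *: lam - z).
  by rewrite [in RHS]addrAC [RHS]scalerDr scalerA mulfV ?gt_eqF// scale1r [LHS]addrC.
apply/quadratic_argminP => //; first exact: psi_cvx.
have e y : sig / 2 * NZ (G P s v + sig^-1 *: lam - y) ^+ 2
  = sig / 2 * NZ (G P s v - y) ^+ 2 + ipZ lam (G P s v - y) + sig^-1 / 2 * ipZ lam lam.
  rewrite addrAC; move: (G P s v - y) => q.
  rewrite !sqr_enorm !innerDl !innerDr !innerZl !innerZr (innerC _ lam q).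
  by field; rewrite gt_eqF.
by move=> y; rewrite !e; have := hmin y I; rewrite /augL; lra.
Qed.

Lemma admm_step_opt sig w w' : 0 < sig -> admm_step P s sig w w' ->
  admm_opt_sub sig w.1.1 w.1.2 w.2 w'.1.1 w'.1.2 w'.2.
Proof.
case: w => [[v z] lam]; case: w' => [[v' z'] lam'] /= sig0 [hv hz hl].
split=> //; first exact: v_update_stationary.
by rewrite hl; exact: z_update_subgrad.
Qed.

Lemma accelerated_step_opt sig wb w : 0 < sig -> accelerated_step P s sig wb w ->
  accelerated_opt_sub sig wb.1.1 wb.2 w.1.1 w.1.2 w.2.
Proof.
case: wb => [[vb zb] lamb]; case: w => [[v z] lam] /= sig0 [hz hl hv].
split=> //; last exact: v_update_stationary.
by rewrite hl; exact: z_update_subgrad.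
Qed.

(** ** The residual of the optimality system *)

Lemma prox_subgrad u : subgrad (eZ P) psi_s (prox (eZ P) 1 psi_s u) (u - prox (eZ P) 1 psi_s u).
Proof.
have [L L0 [_ _ hL]] := cvx_ball (eZ P) psi_cvx (NZ u).
pose F u' := psi_s u' + (2 * 1)^-1 * NZ (u' - u) ^+ 2.
have [m hm] : exists m, is_argmin setT F m.
  apply: (@coercive_min _ _ (eZ P) setT F u (NZ u + 2 * L)) => //.
  - move=> w; apply: cvgD; first exact: (cvx_continuous (eZ P) psi_cvx (x := w)).
    have h : {for w, continuous (fun u' => NZ (u' - u) : R^o)}.
      have -> : (fun u' => NZ (u' - u)) = (fun u' => NZ (u - u')).
        by apply/funext => u'; rewrite enorm_distC.
      exact: enorm_continuous.
    by apply: cvgM; [exact: cvg_cst|exact: (cvgM h h)].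
  - move=> u' _; rewrite /F subrr enorm0 expr0n mulr0 addr0 mulr1 => hu.
    have := hL u (u' - u) (lexx _); rewrite (addrC u) subrK => h1.
    have h2 := enorm_ge0 (eZ P) (u' - u).
    have h3 := enorm_le_add (eZ P) u' u.
    suff : NZ (u' - u) <= 2 * L by lra.
    rewrite leNgt; apply/negP => h4.
    have : 2 * L * NZ (u' - u) < NZ (u' - u) * NZ (u' - u) by rewrite ltr_pM2r//; lra.
    by move: hu; rewrite expr2; lra.
have [_ hp] : is_argmin setT F (prox (eZ P) 1 psi_s u) by exact: (xgetPex 0 (ex_intro _ m hm)).
have := (quadratic_argminP (eZ P) u (prox (eZ P) 1 psi_s u) psi_cvx (@ltr01 R)).1.
rewrite scale1r; apply=> y.
by have := hp y I; rewrite /F mulr1 !(enorm_distC _ u) mul1r.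
Qed.

Lemma prox_uniq u z : subgrad (eZ P) psi_s z (u - z) -> prox (eZ P) 1 psi_s u = z.
Proof.
move=> h; have := subgrad_monotone (prox_subgrad u) h.
rewrite subrACA subrr sub0r opprB -[_ - z]opprB innerNl -sqr_enorm oppr_ge0.
have := sqr_ge0 (NZ (z - prox (eZ P) 1 psi_s u)) => h1 h2.
have : NZ (z - prox (eZ P) 1 psi_s u) ^+ 2 == 0 by rewrite eq_le h1 h2.
by rewrite sqrf_eq0 enorm_eq0 subr_eq0 => /eqP ->.
Qed.

Lemma residual_proj v xi :
  v - gradell P s - sbeta s *: v - gradG P s xi = v - (gradell P s + sbeta s *: v + gradG P s xi).
Proof. by rewrite !opprD !addrA. Qed.

Lemma kkt_residual0 w : kkt_residual P s w = 0 -> kkt_sub w.1.1 w.1.2 w.2.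
Proof.
case: w => [[v z] lam] h0.
have /eqP := congr1 (fun w : (X * _ * _)%type => w.1.1) h0.
rewrite /= subr_eq0 residual_proj => /eqP hv.
have /eqP := congr1 (fun w : (_ * (X * Y) * _)%type => w.1.2) h0.
rewrite /= subr_eq0 => /eqP hz.
have /eqP := congr1 (fun w : (_ * _ * (X * Y))%type => w.2) h0.
rewrite /= subr_eq0 => /eqP hG.
have [Tp hp] := projP (eX P) Tsub Tcl (v - (gradell P s + sbeta s *: v + gradG P s lam)).
rewrite /projT in hv; rewrite -hv in Tp hp.
split=> //.
- move=> u Tu; have := hp u Tu; rewrite addrAC subrr add0r innerNl innerDl gradG_inner /dlag => h.
  by apply/eqP; rewrite -oppr_eq0 h.
- by have := prox_subgrad (z + lam); rewrite -hz addrBK.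
Qed.

(** After an ADMM step lam is a subgradient at z, which makes the proximal component of
    the residual vanish. *)
Lemma kkt_residual_opt v z lam : T v -> subgrad (eZ P) psi_s z lam ->
  kkt_residual P s (v, z, lam) = (stat_vec P s v lam, 0, z - G P s v).
Proof.
move=> Tv hz; rewrite /kkt_residual residual_proj; congr (_, _, _).
  have [Tq hq] := projP (eX P) Tsub Tcl (gradell P s + sbeta s *: v + gradG P s lam).
  rewrite /projT (@proj_uniq _ _ _ _ Tsub Tcl _ (v - stat_vec P s v lam)).
  - by rewrite opprB addrC subrK.
  - exact: (subspaceB Tsub).
  - move=> u Tu; rewrite subrACA subrr sub0r innerNl.
    by apply/eqP; rewrite oppr_eq0; apply/eqP; exact: hq.
by rewrite (@prox_uniq (z + lam) z) ?subrr// addrBK.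
Qed.

Lemma sqr_enorm_triple v z lam :
  enorm (eW P) (v, z, lam) ^+ 2 = NX v ^+ 2 + NZ z ^+ 2 + NZ lam ^+ 2.
Proof. by rewrite !sqr_enorm. Qed.

End subproblems.


(** * Uniform rates of the inner solvers *)

Lemma le_sqrtr (R : realType) (x y : R) : 0 <= x -> x ^+ 2 <= y -> x <= Num.sqrt y.
Proof. by move=> x0 h; rewrite -[leLHS]ger0_norm// -sqrtr_sqr ler_wsqrtr. Qed.

Section uniform.
Context {R : realType} {X Y : normedModType R} (P : problem X Y).
Hypothesis hP : standing_assumptions P.
Variable p : params X.
Hypothesis hr : retraction (M P) (retr p).
Local Notation NX := (enorm (eX P)).
Local Notation NY := (enorm (eY P)).
Local Notation NZ := (enorm (eZ P)).
Local Notation ipX := (inner (eX P)).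
Local Notation ipZ := (inner (eZ P)).
Local Notation W := (X * (X * Y) * (X * Y))%type.
Local Notation d := (Defs.dist P).
Local Notation kap s := (opnorm (eX P) (eZ P) (opA P s)).

(** As the distance is globally Lipschitz, rho enters only through its upper bound. *)
Lemma psi_uniform (r C : R) : exists2 L, 0 <= L & forall s, 0 <= srho s <= C ->
  [/\ forall u v, NZ u <= r -> NZ v <= r -> `|psi P s u - psi P s v| <= L * NZ (u - v),
      forall z xi, NZ z <= r -> subgrad (eZ P) (psi P s) z xi -> NZ xi <= L
    & forall z w, NZ z <= r -> psi P s z - L * NZ w <= psi P s (z + w)].
Proof.
have [Lt Lt0 [ht1 ht2 ht3]] := cvx_ball (eX P) (th_cvx hP) r.
have [c c0 hc] := dist_lipschitz (K_closed hP) (K_nonempty hP) (tnorm_norm hP).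
exists (Lt + `|C| * c); first by rewrite addr_ge0 ?mulr_ge0// ltW.
move=> s /andP[rho0 rhoC].
have rc y z : srho s * (d y - d z) <= `|C| * c * NY (y - z).
  rewrite -mulrA; apply: (@le_trans _ _ (srho s * (c * NY (y - z)))); first by rewrite ler_wpM2l.
  rewrite ler_wpM2r//; first by rewrite mulr_ge0 ?enorm_ge0// ltW.
  exact: le_trans rhoC (ler_norm _).
have Cc : 0 <= `|C| * c by rewrite mulr_ge0// ltW.
have f1 (u : (X * Y)%type) : NX u.1 <= NZ u := enorm_fst_le _ _ u.
have f2 (u : (X * Y)%type) : NY u.2 <= NZ u := enorm_snd_le _ _ u.
split.
- move=> u v ur vr; rewrite /psi.
  have h1 : `|th P u.1 - th P v.1| <= Lt * NZ (u - v).
    rewrite (le_trans (ht1 _ _ (le_trans (f1 u) ur) (le_trans (f1 v) vr)))//.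
    by rewrite ler_wpM2l//; exact: (f1 (u - v)).
  have h2 := rc u.2 v.2; have h3 := rc v.2 u.2; rewrite (enorm_distC _ v.2) in h3.
  have h4 := ler_wpM2l Cc (f2 (u - v)).
  rewrite ler_norml in h1; move/andP: h1 => [h1 h1'].
  rewrite ler_norml; apply/andP; rewrite /= in h4; split; lra.
- move=> z xi zr /subgrad_psi[h1 h2]; rewrite (le_trans (enorm_prod_le _ _ xi))//.
  rewrite lerD//; first exact: ht2 (le_trans (f1 z) zr) h1.
  have := h2 (z.2 + xi.2); rewrite addrBK -sqr_enorm => h3.
  have := rc (z.2 + xi.2) z.2; rewrite addrBK => h4.
  have [-> //|x0] := eqVneq (NY xi.2) 0.
  have x1 : 0 < NY xi.2 by rewrite lt_neqAle eq_sym x0 enorm_ge0.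
  by rewrite -(ler_pM2r x1) -expr2; lra.
- move=> z w zr; have h1 := ht3 z.1 w.1 (le_trans (f1 z) zr).
  have h2 := rc z.2 (z.2 + w.2); rewrite enorm_distC addrBK in h2.
  have h3 := ler_wpM2l Lt0 (f1 w); have h4 := ler_wpM2l Cc (f2 w).
  by rewrite /psi /=; lra.
Qed.

(** The subproblems met by a bounded run of the algorithm. *)
Definition tame (C b0 : R) (s : subproblem X) :=
  [/\ M P (sx s), NX (sx s) <= C, subdiff_mh P (sx s) (szeta s), 0 <= srho s <= C
    & b0 <= sbeta s].

Lemma tame_uniform (C b0 : R) : exists2 L, 1 <= L & forall s, tame C b0 s ->
  [/\ smooth_bounds P p L (sx s), NX (szeta s) <= L /\ NX (gradell P s) <= L,
      kap s <= L, NZ (sx s, g P (sx s)) <= L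
    & forall w, psi P s (sx s, g P (sx s)) - L * NZ w <= psi P s ((sx s, g P (sx s)) + w)].
Proof.
have [L1 L10 h1] := smooth_uniform hP hr C.
have [L2 L20 [_ h2 _]] := cvx_ball (eX P) (h_cvx hP) C.
have [L3 L30 h3] := psi_uniform (`|C| + L1) C.
pose L := `|C| + 2 * L1 + L2 + L3 + 1; exists L; first by rewrite /L; have := normr_ge0 C; lra.
have C0 := normr_ge0 C.
have L1L : L1 <= L by rewrite /L; lra.
have Lp : 0 < L by rewrite /L; lra.
have Li : L^-1 <= L1^-1 by rewrite lef_pV2 ?posrE.
move=> s [Ms sC hz hrho _]; have [[hf hgf] hg hj hT hR] := h1 _ Ms sC.
have zL : NX (szeta s) <= L2.
  by rewrite -enormN; apply: (h2 (sx s)) => //; exact: concave_limiting_subgrad (h_cvx hP) _ _ hz.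
have g0L : NZ (sx s, g P (sx s)) <= `|C| + L1.
  by rewrite (le_trans (enorm_prod_le _ _ _))// lerD// (le_trans sC)// ler_norm.
split.
- split.
  + by split; apply: le_trans L1L.
  + exact: le_trans hg L1L.
  + by move=> w; rewrite (le_trans (hj w))// ler_wpM2r// enorm_ge0.
  + move=> z zd; have [e1 e2] := hT z (lt_le_trans zd Li).
    by split; [apply: le_trans e1 _|apply: le_trans e2 _]; rewrite ler_wpM2r ?sqr_ge0.
  + move=> w Tw wd; apply: (le_trans (hR w Tw (lt_le_trans wd Li))).
    by rewrite ler_wpM2r ?sqr_ge0.
- split; first by rewrite /L; lra.
  by rewrite /gradell (le_trans (enormD _ _ _))// /L; lra.
- apply: opnorm_le; first by rewrite /L; lra.
  move=> u; rewrite (le_trans (enorm_prod_le _ _ _))//=; have := hj u; have := enorm_ge0 (eX P) u.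
  have h4 := enorm_ge0 (eX P) u.
  have h5 : (1 + L1) * NX u <= L * NX u by rewrite ler_wpM2r// /L; lra.
  lra.
- by rewrite (le_trans g0L)// /L; lra.
- move=> w; have [_ _ h6] := h3 s hrho; have := h6 _ w g0L.
  have h7 : L3 * NZ w <= L * NZ w by rewrite ler_wpM2r ?enorm_ge0// /L; lra.
  lra.
Qed.

Lemma kkt_uniform (C b0 : R) : 0 < b0 -> exists2 B, 0 < B & forall s, tame C b0 s ->
  exists v z lam, kkt_sub P s v z lam /\ [/\ NX v <= B, NZ z <= B & NZ lam <= B].
Proof.
move=> b00; have [L L1 hL] := tame_uniform C b0.
pose Bv := (L + L * L) / b0; pose Bz := L + L * Bv.
have L0 : 0 < L by lra.
have Bv0 : 0 <= Bv by rewrite divr_ge0 ?(ltW b00)//; have := mulr_gt0 L0 L0; lra.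
have Bz0 : 0 <= Bz by have := mulr_ge0 (ltW L0) Bv0; rewrite /Bz; lra.
have [L3 L30 h3] := psi_uniform Bz C.
exists (Bv + Bz + L3 + 1); first by lra.
move=> s hs; have [Ms sC hz hrho hb] := hs; have [hsm [_ hc] hk hg hlow] := hL s hs.
have rho0 : 0 <= srho s by case/andP: hrho.
have beta0 := lt_le_trans b00 hb.
have Ab u : NZ (opA P s u) <= L * NX u.
  by rewrite (le_trans (opA_le P s u))// ler_wpM2r ?enorm_ge0.
have [Ts Tc] := M_tangent hP Ms.
have [v [z [lam hkkt]]] := kkt_exists Ts Tc (opAD P s) (opAZ P s) beta0 (psi_cvx hP rho0)
  Ab (ltW L0) hc (ltW L0) hlow.
exists v, z, lam; split=> //.
have hv : NX v <= Bv := kkt_bounded Ab (ltW L0) hc (ltW L0) b00 hb hlow hkkt.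
have [_ _ hsub zE] := hkkt.
have hzB : NZ z <= Bz.
  rewrite zE (le_trans (enormD _ _ _))// lerD//.
  by rewrite (le_trans (Ab v))// ler_wpM2l// ltW.
have hl : NZ lam <= L3 by have [_ h _] := h3 s hrho; exact: h hzB hsub.
by split; lra.
Qed.

Section rates.
Variables (C b0 sbar : R) (B0 : set W).
Hypotheses (b00 : 0 < b0) (sbar1 : 1 <= sbar) (hB0 : compact B0).

Let sig_bounds sig : sbar^-1 <= sig <= sbar -> 0 < sig /\ sig^-1 <= sbar.
Proof.
have s0 : 0 < sbar by have := sbar1; lra.
move=> /andP[h1 h2]; have sig0 : 0 < sig by rewrite (lt_le_trans _ h1)// invr_gt0.
by split=> //; rewrite invf_ple ?posrE.
Qed.

Let start_bound : exists2 B, 0 < B & forall s (w : W), tame C b0 s -> B0 w ->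
  exists v z lam, kkt_sub P s v z lam /\
    [/\ NX v <= B, NX (w.1.1 - v) <= B, NZ (w.1.2 - z) <= B & NZ (w.2 - lam) <= B].
Proof.
have [B B00 hB] := kkt_uniform C b00; have [r r0 hw] := compact_enorm_bounded (eW P) hB0.
exists (r + B); first by lra.
move=> s w hs /hw wr; have [v [z [lam [hk [h1 h2 h3]]]]] := hB s hs.
exists v, z, lam; split=> //.
have e1 := le_trans (enorm_fst_le _ _ w) wr; have e2 := le_trans (enorm_snd_le _ _ w) wr.
have e3 := le_trans (enorm_fst_le _ _ w.1) e1; have e4 := le_trans (enorm_snd_le _ _ w.1) e1.
by split; [lra|..]; rewrite (le_trans (enormB _ _ _))// lerD.
Qed.

(** What the outer iteration needs from an output of an inner solver. *)
Definition accurate (s : subproblem X) (e E : R) (w : W) :=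
  [/\ tangent (M P) (sx s) w.1.1, subgrad (eZ P) (psi P s) w.1.2 w.2,
      NZ (G P s w.1.1 - w.1.2) <= e, NX (stat_vec P s w.1.1 w.2) <= e & NX w.1.1 <= E].

(** The initial distance to a KKT point is bounded uniformly, and the accelerated method
    divides it by the number of passes. *)
Lemma accelerated_uniform (alpha vrho : R) : 2 <= alpha -> 0 < vrho <= 2 ->
  exists2 E, 0 < E & forall s sig wb wh w, tame C b0 s -> sbar^-1 <= sig <= sbar ->
    B0 (wb 0%N) -> accelerated_spadmm P s alpha vrho sig wb wh w ->
    forall l, accurate s (E / l.+1%:R) E (w l).
Proof.
move=> a2 v02; have /andP[v0 v2] := v02.
have [L L1 hL] := tame_uniform C b0; have [B Bp hB] := start_bound.
have s1 := sbar1; have b00' := b00.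
have [L0 al1] : 0 <= L /\ 1 <= alpha - 1 by split; lra.
have al0 : 0 <= 2 * (alpha - 1) by rewrite mulr_ge0// (le_trans ler01).
pose D := Num.sqrt (2 * (sbar * L ^+ 2 * B ^+ 2 + sbar * B ^+ 2)).
pose E1 := 2 * (alpha - 1) * D / vrho.
have D0 : 0 <= D by exact: sqrtr_ge0.
have E10 : 0 <= E1 by rewrite divr_ge0 ?(ltW v0)// mulr_ge0.
pose S1 := Num.sqrt sbar; pose S2 := Num.sqrt (sbar * L ^+ 2).
have S10 : 0 <= S1 by exact: sqrtr_ge0.
have S20 : 0 <= S2 by exact: sqrtr_ge0.
pose S3 := Num.sqrt (E1 * D / b0).
have S30 : 0 <= S3 by exact: sqrtr_ge0.
pose E := E1 * S1 + E1 * S2 + B + S3.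
have e1 := mulr_ge0 E10 S10; have e2 := mulr_ge0 E10 S20.
have [E0 ES1 ES2] : [/\ 0 < E, E1 * S1 <= E & E1 * S2 <= E] by rewrite /E; split; lra.
have ES3 : B + S3 <= E by rewrite /E; lra.
exists E => //.
move=> s sig wb wh w hs hsig hw0 [Tb hwh hstep] l.
have [sig0 sigV] := sig_bounds hsig; have /andP[_ sigs] := hsig.
have [Ms sC hz hrho hb] := hs; have rho0 : 0 <= srho s by case/andP: hrho.
have beta0 := lt_le_trans b00 hb; have [Ts Tc] := M_tangent hP Ms.
have [v [z [lam [hk [hv1 hv2 hz2 hl2]]]]] := hB s _ hs hw0.
have [_ _ hkap _ _] := hL s hs.
have k0 := kap_ge0 P s; have Ab := opA_le P s; have AD := opAD P s; have AZ := opAZ P s.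
have hopt m : accelerated_opt_sub P s sig (wb m).1.1 (wb m).2 (w m).1.1 (w m).1.2 (w m).2.
  by apply: accelerated_step_opt => //; have [] := hstep m.
pose pr (x : W) := (x.1.1, x.2).
have gamL : sig * kap s ^+ 2 <= sbar * L ^+ 2.
  rewrite ler_pM ?sqr_ge0 ?(ltW sig0)//.
  by rewrite ler_pXn2r ?nnegrE.
have gam0 : 0 <= sig * kap s ^+ 2 by rewrite mulr_ge0 ?sqr_ge0// ltW.
have hm : seminorm (B := metric (eX P) (eZ P) (opA P s) sig (kap s)) (pr (wb 0%N) - (v, lam)) <= D.
  rewrite ler_wsqrtr// (le_trans (metric_le sig0 k0 Ab _))// ler_pM2l//.
  rewrite lerD// ler_pM ?sqr_ge0 ?invr_ge0 ?(ltW sig0)//.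
    by rewrite ler_pXn2r ?nnegrE ?enorm_ge0 ?(ltW Bp).
  by rewrite ler_pXn2r ?nnegrE ?enorm_ge0 ?(ltW Bp).
have [] := accelerated_rate (p := fun m => pr (wb m)) (ph := fun m => pr (wh m))
  (q := fun m => pr (w m)) (z := fun m => (w m).1.2) Ts AD AZ beta0 sig0 k0 Ab a2 v02 hk hopt
  _ _ l.
- by move=> m; have [_ -> _] := hstep m.
- by move=> m; have [_ _ ->] := hstep m.
set mq := seminorm _; set md := seminorm _ => h1 h2.
have mq0 : 0 <= mq by exact: seminorm_ge0.
have l0 : 0 < l.+1%:R :> R by rewrite ltr0n.
have mqE : mq <= E1 / l.+1%:R.
  rewrite ler_pdivlMr// /E1 ler_pdivlMr//.
  have h3 : 2 * (alpha - 1) * seminorm (B := metric (eX P) (eZ P) (opA P s) sig (kap s))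
    (pr (wb 0%N) - (v, lam)) <= 2 * (alpha - 1) * D by rewrite ler_wpM2l.
  apply: le_trans h3; apply: le_trans h1.
  rewrite [leLHS](_ : _ = l.+1%:R * (vrho * mq)); last by ring.
  by rewrite ler_wpM2r ?mulr_ge0 ?(ltW v0)// -natr1 -addrA lerD2l.
have [r1 r2] := accelerated_residual AD AZ sig0 k0 Ab (hopt l).
have [hsub _ [Tv _]] := hopt l.
have lE x : 0 <= x -> E1 * x <= E -> E1 / l.+1%:R * x <= E / l.+1%:R.
  by move=> x0 h; rewrite mulrAC ler_wpM2r// invr_ge0 ltW.
split=> //.
- apply: (le_trans r1); rewrite -/mq.
  apply: le_trans (lE S1 S10 _); last by [].
  rewrite ler_pM ?invr_ge0 ?sqrtr_ge0//.
  by rewrite -sqrtrV ?(ltW sig0)// ler_wsqrtr.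
- apply: (stat_le hP Ms); first by rewrite divr_ge0 ?(ltW l0) ?(ltW E0).
  move=> u Tu; apply: (le_trans (r2 u Tu)); rewrite ler_wpM2r ?enorm_ge0// -/mq.
  apply: le_trans (lE S2 S20 _); last by [].
  by rewrite ler_pM ?sqrtr_ge0// ler_wsqrtr.
- have h3 := accelerated_nonexpansive Ts AD AZ sig0 k0 Ab (hopt l) hk.
  have h4 : NX ((w l).1.1 - v) <= S3.
    apply: le_sqrtr; first exact: enorm_ge0.
    rewrite ler_pdivlMr// mulrC.
    apply: (@le_trans _ _ (sbeta s * NX ((w l).1.1 - v) ^+ 2)); first by rewrite ler_wpM2r ?sqr_ge0.
    apply: (le_trans h3); rewrite ler_pM ?seminorm_ge0//; last exact: le_trans hm.
    by rewrite -/mq (le_trans mqE)// ler_pdivrMr// ler_peMr// ler1n.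
  by rewrite (le_trans (enorm_le_add (eX P) _ v))// (le_trans _ ES3)// lerD.
Qed.

(** A step with small decrease has a small KKT residual, and the error bound then
    places a KKT point nearby. *)
Lemma error_bound_lyapunov s sig (w w' : W) c : tame C b0 s -> 0 < sig -> 0 < c ->
  admm_opt_sub P s sig w.1.1 w.1.2 w.2 w'.1.1 w'.1.2 w'.2 ->
  (Defs.edist (eW P) [set u : W | kkt_residual P s u = 0%R] w'
    <= (c * enorm (eW P) (kkt_residual P s w'))%:E)%E ->
  exists v z lam, kkt_sub P s v z lam /\
    lyapunov_sub P s sig v z lam w'.1.1 w'.1.2 w'.2
    <= (sig^-1 + sig + sig * kap s ^+ 2) * (4 * c ^+ 2) * (4 * (sig * kap s ^+ 2) + sig^-1)
       * lyapunov_sub P s sig w.1.1 w.1.2 w.2 w'.1.1 w'.1.2 w'.2.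
Proof.
move=> [Ms sC hz hrho hb] sig0 c0 hopt hed; have rho0 : 0 <= srho s by case/andP: hrho.
have k0 := kap_ge0 P s; have Ab := opA_le P s; have AD := opAD P s; have AZ := opAZ P s.
have [Ts Tc] := M_tangent hP Ms.
have sV0 : 0 < sig^-1 by rewrite invr_gt0.
have gam0 : 0 <= sig * kap s ^+ 2 by rewrite mulr_ge0 ?sqr_ge0// ltW.
case: w' hopt hed => [[v' z'] lam'] /= hopt hed.
set dec := lyapunov_sub P s sig w.1.1 w.1.2 w.2 v' z' lam'.
have dec0 : 0 <= dec by exact: (lyapunov_ge0 AD AZ sig0 k0 Ab).
have [[Tv' _] hsub _] := hopt.
have [r1 r2] := admm_residual AD AZ sig0 k0 Ab hopt; rewrite -/dec in r1 r2.
have hst := stat_le hP Ms _ r2.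
have resE := kkt_residual_opt hP Ms rho0 Tv' hsub.
have res2 : enorm (eW P) (kkt_residual P s (v', z', lam')) ^+ 2
    <= (4 * (sig * kap s ^+ 2) + sig^-1) * dec.
  rewrite resE sqr_enorm_triple enorm0 expr0n addr0 (enorm_distC _ z').
  have h1 : NX (stat_vec P s v' lam') ^+ 2 <= (2 * Num.sqrt (sig * kap s ^+ 2 * dec)) ^+ 2.
    rewrite ler_pXn2r ?nnegrE ?enorm_ge0 ?mulr_ge0 ?sqrtr_ge0//.
    by apply: hst; rewrite mulr_ge0 ?sqrtr_ge0.
  have h2 : NZ (G P s v' - z') ^+ 2 <= Num.sqrt (dec / sig) ^+ 2.
    by rewrite ler_pXn2r ?nnegrE ?enorm_ge0 ?sqrtr_ge0.
  rewrite sqr_sqrtr ?divr_ge0 ?(ltW sig0)// in h2.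
  have e : Num.sqrt (sig * kap s ^+ 2 * dec) ^+ 2 = sig * kap s ^+ 2 * dec.
    by rewrite sqr_sqrtr//; exact: mulr_ge0.
  by rewrite exprMn e in h1; lra.
have lyap_le v z lam :
    lyapunov_sub P s sig v z lam v' z' lam'
    <= (sig^-1 + sig + sig * kap s ^+ 2) * enorm (eW P) (((v', z', lam') : W) - (v, z, lam)) ^+ 2.
  have -> : ((v', z', lam') : W) - (v, z, lam) = (v' - v, z' - z, lam' - lam) by [].
  rewrite sqr_enorm_triple /lyapunov_sub /lyapunov -!sqr_enorm.
  have h1 := prox_form_le (eX P) (eZ P) (opA P s) (kap s) sig0 (v' - v).
  have x1 := sqr_ge0 (NX (v' - v)); have x2 := sqr_ge0 (NZ (z' - z)); have x3 := sqr_ge0 (NZ (lam' - lam)).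
  have := mulr_ge0 (ltW sV0) x1; have := mulr_ge0 (ltW sV0) x2.
  have := mulr_ge0 (ltW sig0) x1; have := mulr_ge0 (ltW sig0) x3.
  have := mulr_ge0 gam0 x2; have := mulr_ge0 gam0 x3; lra.
set r := enorm (eW P) (kkt_residual P s (v', z', lam')) in res2 hed *.
have r0 : 0 <= r by exact: enorm_ge0.
have [u hu ur] : exists2 u : W, kkt_residual P s u = 0 & enorm (eW P) ((v', z', lam') - u) <= 2 * c * r.
  have [r00|r00] := eqVneq r 0.
    exists (v', z', lam'); last by rewrite subrr enorm0 !mulr_ge0// ltW.
    by apply/eqP; rewrite -(enorm_eq0 (eW P)) -/r r00.
  have r1' : 0 < r by rewrite lt_neqAle eq_sym r00.
  have : (Defs.edist (eW P) [set u | kkt_residual P s u = 0%R] (v', z', lam') < (2 * c * r)%:E)%E.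
    apply: le_lt_trans hed _; rewrite lte_fin -mulrA.
    by have := mulr_gt0 c0 r1'; lra.
  by move=> /ereal_inf_lt[_ [u hu <-]]; rewrite lte_fin => h; exists u => //; exact: ltW.
exists u.1.1, u.1.2, u.2; split; first exact: kkt_residual0.
apply: (le_trans (lyap_le _ _ _)).
rewrite [leRHS](_ : _ = (sig^-1 + sig + sig * kap s ^+ 2)
  * (4 * (c ^+ 2 * ((4 * (sig * kap s ^+ 2) + sig^-1) * dec)))); last by ring.
rewrite ler_wpM2l ?addr_ge0 ?(ltW sig0) ?(ltW sV0)//.
have -> : (u.1.1, u.1.2, u.2) = u by case: (u) => [[]].
apply: (@le_trans _ _ ((2 * c * r) ^+ 2)).
  by rewrite ler_pXn2r ?nnegrE ?enorm_ge0// !mulr_ge0// ltW.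
have -> : (2 * c * r) ^+ 2 = 4 * (c ^+ 2 * r ^+ 2) by ring.
by rewrite ler_pM2l// ler_wpM2l ?sqr_ge0.
Qed.

(** Descent needs subgradients at both ends of a step, which the starting point does not
    provide, and the rate controls the step after; hence the shift by two. *)
Lemma admm_uniform (c : R) : 0 < c ->
  exists2 E, 0 < E & exists2 q, 0 < q < 1 & forall s sig (w : nat -> W),
    tame C b0 s -> sbar^-1 <= sig <= sbar -> B0 (w 0%N) -> spadmm P s sig w ->
    (forall l, (1 <= l)%N -> (Defs.edist (eW P) [set u | kkt_residual P s u = 0%R] (w l)
       <= (c * enorm (eW P) (kkt_residual P s (w l)))%:E)%E) ->
    forall l, accurate s (E * q ^+ l) E (w l.+2).
Proof.
move=> c0; have [L L1 hL] := tame_uniform C b0; have [B Bp hB] := start_bound.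
have s1 := sbar1; have b00' := b00.
pose gb := sbar * L ^+ 2.
have g0 : 0 < gb by rewrite mulr_gt0 ?exprn_gt0//; lra.
pose Q := (sbar + sbar + gb) * (4 * c ^+ 2) * (4 * gb + sbar).
have Q0 : 0 < Q by rewrite !mulr_gt0 ?exprn_gt0//; lra.
pose V0 := (sbar + sbar + gb) * B ^+ 2.
have V00 : 0 < V0 by rewrite mulr_gt0 ?exprn_gt0//; lra.
pose q := Num.sqrt (Q / (1 + Q)).
have q01 : 0 < Q / (1 + Q) < 1 by rewrite divr_gt0 ?ltr_pdivrMr//=; lra.
have [q0' q1'] := andP q01.
have q0 : 0 < q by rewrite sqrtr_gt0.
have q1 : q < 1 by rewrite -sqrtr1 ltr_sqrt.
have qX l : Num.sqrt ((Q / (1 + Q)) ^+ l) = q ^+ l.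
  apply/eqP; rewrite -(@eqrXn2 _ 2) ?sqrtr_ge0 ?exprn_ge0 ?(ltW q0)//.
  by rewrite sqr_sqrtr ?exprn_ge0 ?(ltW q0')// -exprM mulnC exprM sqr_sqrtr ?(ltW q0').
pose S1 := Num.sqrt (V0 * sbar); pose S2 := 2 * Num.sqrt (gb * V0).
pose S3 := Num.sqrt (V0 / (2 * b0)).
have S10 : 0 <= S1 by exact: sqrtr_ge0.
have S20 : 0 <= S2 by rewrite mulr_ge0 ?sqrtr_ge0.
have S30 : 0 <= S3 by exact: sqrtr_ge0.
pose E := S1 + S2 + B + S3.
have [E0 ES1 ES2] : [/\ 0 < E, S1 <= E & S2 <= E] by rewrite /E; split; lra.
have VS3 : B + S3 <= E by rewrite /E; lra.
have vs0 : 0 <= V0 * sbar by apply: mulr_ge0; [exact: ltW|lra].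
have gv0 : 0 <= gb * V0 by apply: mulr_ge0; exact: ltW.
have [s0 L0] : 0 < sbar /\ 0 <= L by split; lra.
exists E => //.
exists q; first by rewrite q0.
move=> s sig w hs hsig hw0 [Tw hstep] hed l.
have [sig0 sigV] := sig_bounds hsig; have /andP[_ sigs] := hsig.
have [Ms sC hz hrho hb] := hs; have rho0 : 0 <= srho s by case/andP: hrho.
have beta0 := lt_le_trans b00 hb; have [Ts Tc] := M_tangent hP Ms.
have [v [z [lam [hk [hv1 hv2 hz2 hl2]]]]] := hB s _ hs hw0.
have [_ _ hkap _ _] := hL s hs.
have k0 := kap_ge0 P s; have Ab := opA_le P s; have AD := opAD P s; have AZ := opAZ P s.
have hopt m := admm_step_opt hP Ms rho0 beta0 sig0 (hstep m).
have sV0 : 0 < sig^-1 by rewrite invr_gt0.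
have gamL : sig * kap s ^+ 2 <= gb.
  rewrite /gb ler_pM ?sqr_ge0 ?(ltW sig0)//.
  by rewrite ler_pXn2r ?nnegrE.
have gam0 : 0 <= sig * kap s ^+ 2 by rewrite mulr_ge0 ?sqr_ge0// ltW.
pose V m := lyapunov_sub P s sig v z lam (w m).1.1 (w m).1.2 (w m).2.
have hV0 : V 0%N <= V0.
  rewrite /V /lyapunov_sub /lyapunov /V0 -!sqr_enorm !mulrDl !lerD//.
  - by rewrite ler_pM ?sqr_ge0 ?(ltW sV0)// ler_pXn2r ?nnegrE ?enorm_ge0 ?(ltW Bp).
  - by rewrite ler_pM ?sqr_ge0 ?(ltW sig0)// ler_pXn2r ?nnegrE ?enorm_ge0 ?(ltW Bp).
  - apply: (le_trans (prox_form_le (eX P) (eZ P) (opA P s) (kap s) sig0 _)).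
    by rewrite ler_pM ?sqr_ge0// ler_pXn2r ?nnegrE ?enorm_ge0 ?(ltW Bp).
have hdesc m : V m.+1 + 2 * sbeta s * NX ((w m.+1).1.1 - v) ^+ 2 <= V m.
  by have := admm_descent_weak Ts AD AZ sig0 k0 Ab hk (hopt m).
have Vge0 m : 0 <= V m by exact: (lyapunov_ge0 AD AZ sig0 k0 Ab).
have Vle m : V m <= V0.
  elim: m => // m IH; rewrite (le_trans _ IH)// (le_trans _ (hdesc m))// lerDl.
  by rewrite mulr_ge0 ?sqr_ge0// mulr_ge0// ltW.
have hstar m : exists v z lam, kkt_sub P s v z lam /\
   lyapunov_sub P s sig v z lam (w m.+1).1.1 (w m.+1).1.2 (w m.+1).2
   <= Q * lyapunov_sub P s sig (w m).1.1 (w m).1.2 (w m).2 (w m.+1).1.1 (w m.+1).1.2 (w m.+1).2.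
  have [v1 [z1 [l1 [hk1 hl1]]]] := error_bound_lyapunov hs sig0 c0 (hopt m) (hed m.+1 isT).
  exists v1, z1, l1; split=> //; apply: (le_trans hl1).
  rewrite ler_wpM2r//; first exact: (lyapunov_ge0 AD AZ sig0 k0 Ab).
  have c4 : 0 <= 4 * c ^+ 2 by rewrite mulr_ge0// sqr_ge0.
  rewrite /Q; apply: ler_pM.
  - by rewrite mulr_ge0 ?addr_ge0 ?(ltW sV0) ?(ltW sig0).
  - by rewrite addr_ge0 ?(ltW sV0)// mulr_ge0.
  - by rewrite ler_wpM2r// !lerD.
  - by rewrite lerD// ler_pM2l.
have hrate := admm_linear_rate Ts AD AZ beta0 sig0 k0 Ab Q0 hk hopt hstar l.
have [r1 r2] := admm_residual AD AZ sig0 k0 Ab (hopt l.+1).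
set dec := lyapunov _ _ _ _ _ _ _ _ _ _ _ in hrate r1 r2.
have [[Tv _] hsub _] := hopt l.+1.
have decV : dec <= (Q / (1 + Q)) ^+ l * V0.
  by apply: (le_trans hrate); rewrite ler_wpM2l ?exprn_ge0 ?(ltW q0')//; exact: hV0.
have dec0 : 0 <= dec by exact: (lyapunov_ge0 AD AZ sig0 k0 Ab).
have ql : 0 < q ^+ l by rewrite exprn_gt0.
split=> //.
- apply: (le_trans r1).
  apply: (@le_trans _ _ (S1 * q ^+ l)); last by rewrite ler_wpM2r ?(ltW ql).
  rewrite -qX /S1 -sqrtrM// ler_wsqrtr//.
  rewrite [leRHS](_ : _ = (Q / (1 + Q)) ^+ l * V0 * sbar); last by ring.
  by rewrite ler_pM// ltW.
- apply: (stat_le hP Ms); first by rewrite mulr_ge0 ?(ltW ql) ?(ltW E0).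
  move=> u Tu; apply: (le_trans (r2 u Tu)); rewrite ler_wpM2r ?enorm_ge0//.
  apply: (@le_trans _ _ (S2 * q ^+ l)); last by rewrite ler_wpM2r ?(ltW ql).
  rewrite /S2 -[2 * _ * _]mulrA ler_pM2l// -qX -sqrtrM// ler_wsqrtr// -[gb * _ * _]mulrA.
  by rewrite ler_pM// [V0 * _]mulrC.
- have h4 : NX ((w l.+2).1.1 - v) <= S3.
    apply: le_sqrtr; first exact: enorm_ge0.
    rewrite ler_pdivlMr; last by rewrite mulr_gt0.
    have h1 := le_trans (hdesc l.+1) (Vle l.+1); have h3 := Vge0 l.+2.
    apply: le_trans h1; apply: (@le_trans _ _ (2 * sbeta s * NX ((w l.+2).1.1 - v) ^+ 2)).
      by rewrite mulrC ler_wpM2r ?sqr_ge0// ler_pM2l.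
    by rewrite lerDr.
  by rewrite (le_trans (enorm_le_add (eX P) _ v))// (le_trans _ VS3)// lerD.
Qed.

End rates.
End uniform.


(** * One iteration of the algorithm *)

Section iteration.
Context {R : realType} {X Y : normedModType R} (P : problem X Y).
Hypothesis hP : standing_assumptions P.
Variable p : params X.
Hypothesis hr : retraction (M P) (retr p).
Variables (C b0 : R).
Hypothesis b00 : 0 < b0.
Local Notation NX := (enorm (eX P)).
Local Notation NY := (enorm (eY P)).
Local Notation NZ := (enorm (eZ P)).
Local Notation ipX := (inner (eX P)).
Local Notation ipZ := (inner (eZ P)).
Local Notation W := (X * (X * Y) * (X * Y))%type.
Local Notation d := (Defs.dist P).
Local Notation kap s := (opnorm (eX P) (eZ P) (opA P s)).
Local Notation tame := (tame P C b0).

(** The nearest point of K to z.2 serves as y: there the multiplier of the penalty is a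
    normal vector. The multiplier of the quadratic term is beta v, which is small. *)
Lemma stationary_of_small : exists2 kst, 0 < kst & forall s v z xi del eps, tame s ->
  tangent (M P) (sx s) v -> subgrad (eZ P) (psi P s) z xi ->
  NZ (G P s v - z) <= del -> NX (stat_vec P s v xi) <= del -> NX v <= del ->
  NX (sbeta s *: v) <= del -> d z.2 <= del -> kst * del <= eps -> eps_stationary P eps (sx s).
Proof.
have [L L1 hL] := tame_uniform hP hr C b0.
have [c c0 hc] := norm_equiv (eY P) (tnorm_norm hP).
exists (2 + L + c); first by lra.
move=> s v z xi del eps hs Tv hsub hG hst hv hbv hd hk.
have [Ms sC hz hrho hb] := hs; have rho0 : 0 <= srho s by case/andP: hrho.
have [[_ _ hj _ _] _ _ _ _] := hL s hs.
have [Ts Tc] := M_tangent hP Ms.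
have [y Ky dE] := dist_attained (K_closed hP) (K_nonempty hP) (tnorm_norm hP) z.2.
have [h1 h2] := subgrad_psi hsub.
have del0 : 0 <= del := le_trans (enorm_ge0 _ _) hv.
have Ld : 0 <= L * del by rewrite mulr_ge0//; lra.
have cd : 0 <= c * del by rewrite mulr_ge0// ltW.
split=> //; exists z.1, (szeta s), xi.1, y, xi.2; split=> //.
- split=> //; first exact/(cvx_subgradP (eX P) (th_cvx hP)).
  have := subgrad_dist_normal (K_closed hP) (K_nonempty hP) (tnorm_norm hP) rho0 Ky dE h2.
  by [].
- have e : sx s - z.1 = (sx s + v - z.1) - v by rewrite addrAC addrK.
  have h3 : NX (sx s + v - z.1) <= del.
    exact: le_trans (enorm_fst_le _ _ (G P s v - z)) hG.
  by rewrite e (le_trans (enormB _ _ _))//; lra.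
- have e : g P (sx s) - y = (g P (sx s) + jac P (sx s) v - z.2) - jac P (sx s) v + (z.2 - y).
    by rewrite (addrAC (g P (sx s))) addrK addrA subrK.
  have h3 : NY (g P (sx s) + jac P (sx s) v - z.2) <= del.
    exact: le_trans (enorm_snd_le _ _ (G P s v - z)) hG.
  have [_ h4] := hc (z.2 - y); rewrite -dE in h4.
  have h5 := ler_wpM2l (ltW c0) hd; have h6 := hj v.
  have h7 : L * NX v <= L * del by rewrite ler_wpM2l//; lra.
  by rewrite e (le_trans (enormD _ _ _))// (le_trans (lerD (enormB _ _ _) (lexx _)))//; lra.
- have e : projT P (sx s) (gradf P (sx s) + szeta s + xi.1 + adjg P (sx s) xi.2)
    = stat_vec P s v xi - projT P (sx s) (sbeta s *: v).
    rewrite /stat_vec -[gradell P s + _ + _]addrA [sbeta s *: v + _]addrC addrA /projT.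
    by rewrite (projD _ Ts Tc _ (sbeta s *: v)) addrK /gradG addrA.
  rewrite e (le_trans (enormB _ _ _))//.
  have h3 := proj_le (eX P) Ts Tc (sbeta s *: v); rewrite -/(projT P (sx s) _) in h3; lra.
Qed.

Lemma jac0 x : jac P x 0 = 0.
Proof. by rewrite -{1}(scale0r (0 : X)) jacZ scale0r. Qed.

Lemma theta_hat0 s : Theta_hat P s 0 = Theta_pen P (srho s) (sx s).
Proof.
rewrite /Theta_hat /ell /G /psi /= jac0 /Theta_pen /Theta inner0r enorm0 expr0n mulr0 !addr0/=; ring.
Qed.

Lemma descent_neq0 s v : Theta_hat P s v < Theta_pen P (srho s) (sx s) -> v != 0.
Proof. by apply: contraTneq => ->; rewrite theta_hat0 ltxx. Qed.

(** The model at v falls below its value at 0 by the strong convexity of the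
    quadratic term, up to the inexactness of the triple. *)
Lemma pred_lower (E : R) : exists2 L, 0 < L & forall s v z xi, tame s ->
  tangent (M P) (sx s) v -> subgrad (eZ P) (psi P s) z xi ->
  NX v <= E -> NZ (G P s v - z) <= E ->
  sbeta s / 2 * NX v ^+ 2 - NX (stat_vec P s v xi) * NX v - L * NZ (G P s v - z)
  <= Theta_pen P (srho s) (sx s) - Theta_hat P s v.
Proof.
have [L L1 hL] := tame_uniform hP hr C b0.
pose r := L + L * E + E.
have [L2 L20 hL2] := psi_uniform hP r C.
exists (2 * L2 + 1); first by lra.
move=> s v z xi hs Tv hsub hv hz.
have [Ms sC hzt hrho hb] := hs; have [_ _ hkap hg _] := hL s hs.
have [h1 h2 _] := hL2 s hrho.
have E0 : 0 <= E := le_trans (enorm_ge0 _ _) hv.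
have Ev : NZ (opA P s v) <= L * E.
  rewrite (le_trans (opA_le P s v))// ler_pM ?enorm_ge0//; exact: kap_ge0.
have hGr : NZ (G P s v) <= L + L * E by rewrite G_aff /aff (le_trans (enormD _ _ _))// lerD.
have hzr : NZ z <= r.
  have -> : z = G P s v - (G P s v - z) by rewrite subKr.
  by rewrite (le_trans (enormB _ _ _))// lerD.
have hxi := h2 z xi hzr hsub.
have hG2 : NZ (G P s v) <= r by rewrite (le_trans hGr)// lerDl.
have h3 := h1 _ _ hG2 hzr; rewrite ler_norml in h3; move/andP: h3 => [_ h3].
have h4 := hsub (G P s 0).
have e0 : G P s 0 - z = G P s v - z - opA P s v.
  by rewrite !G_aff /aff (A0 (opAZ P s)) addr0 [_ + opA P s v - z]addrAC addrK.
rewrite e0 innerBr in h4.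
have h5 := stat_inner hP Ms v xi Tv; rewrite /dlag innerDl innerZl in h5.
have h6 := inner_CS_abs (eX P) (stat_vec P s v xi) v; rewrite ler_norml in h6.
move/andP: h6 => [_ h6].
have h7 := inner_CS_abs (eZ P) xi (G P s v - z); rewrite ler_norml in h7.
move/andP: h7 => [h7 _].
have h8 := ler_wpM2r (enorm_ge0 (eZ P) (G P s v - z)) hxi.
have h9 := enorm_ge0 (eZ P) (G P s v - z).
rewrite -theta_hat0 /Theta_hat /ell inner0r enorm0 expr0n mulr0 addr0 add0r sqr_enorm.
move: h3 h4 h5 h6 h7 h8 h9; set q := NZ (G P s v - z); lra.
Qed.

(** Below its value at 0 the model must have beta |v|^2 / 2 compensated by terms that
    grow linearly in v. *)
Lemma step_bound : exists2 V, 0 < V & forall s v, tame s ->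
  Theta_hat P s v < Theta_pen P (srho s) (sx s) -> sbeta s * NX v <= V.
Proof.
have [L L1 hL] := tame_uniform hP hr C b0.
have L0 : 0 < L by lra.
exists (2 * (L * L + L)); first by rewrite mulr_gt0// addr_gt0// mulr_gt0.
move=> s v hs hD; have v0 := descent_neq0 hD.
have [_ [_ hc] hkap _ hlow] := hL s hs.
have vp : 0 < NX v by rewrite enorm_gt0.
have Ev : NZ (opA P s v) <= L * NX v.
  by rewrite (le_trans (opA_le P s v))// ler_wpM2r// ltW.
have h1 := hlow (opA P s v).
have h2 := ler_wpM2l (ltW L0) Ev.
have h3 := inner_CS_abs (eX P) (gradell P s) v; rewrite ler_norml in h3; move/andP: h3 => [h3 _].
have h4 := ler_wpM2r (ltW vp) hc.
have e0 : G P s 0 = (sx s, g P (sx s)) by rewrite G_aff /aff (A0 (opAZ P s)) addr0.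
rewrite -theta_hat0 /Theta_hat /ell inner0r enorm0 expr0n mulr0 addr0 add0r e0 in hD.
rewrite -[(sx s, g P (sx s)) + _]/(G P s v) in h1.
rewrite -(ler_pM2r vp); rewrite expr2 in hD; lra.
Qed.

(** The model at v majorizes the objective at the retracted point, up to a quadratic
    error that does not depend on beta. *)
Lemma retraction_upper : exists2 C1, 0 < C1 & exists2 v1, 0 < v1 & forall s v, tame s ->
  tangent (M P) (sx s) v -> NX v <= v1 ->
  Theta_pen P (srho s) (retr p (sx s) v) - Theta_hat P s v <= (C1 - sbeta s / 2) * NX v ^+ 2.
Proof.
have [L L1 hL] := tame_uniform hP hr C b0.
have L0 : 0 < L by lra.
have [Lt Lt0 [hth _ _]] := cvx_ball (eX P) (th_cvx hP) (`|C| + 2).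
have [c c0 hc] := dist_lipschitz (K_closed hP) (K_nonempty hP) (tnorm_norm hP).
have C0 : 0 <= `|C| := normr_ge0 C.
have LL : 0 < L * L by rewrite mulr_gt0.
have tL : 0 <= Lt * L by rewrite mulr_ge0// ltW.
have cL : 0 <= `|C| * (c * (4 * L + L * L)).
  by rewrite mulr_ge0// mulr_ge0 ?(ltW c0)//; lra.
exists (4 * L + L * L + Lt * L + L * L + `|C| * (c * (4 * L + L * L))); first by lra.
exists (4 * L)^-1; first by rewrite invr_gt0 mulr_gt0.
move=> s v hs Tv hv; have [[[_ hgf] _ hj hT hR] [hzL _] _ _ _] := hL s hs.
have [Ms sC hzt /andP[rho0 rhoC] _] := hs.
have rhoC' : srho s <= `|C| := le_trans rhoC (ler_norm C).
clear hL hs Ms rhoC.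
have v0 := enorm_ge0 (eX P) v.
have vL : 4 * L * NX v <= 1 by rewrite mulrC -ler_pdivlMr ?mulr_gt0// div1r.
have v1 : NX v <= 1.
  have : 4 * NX v <= 4 * L * NX v by rewrite ler_wpM2r//; lra.
  lra.
have v2 := sqr_ge0 (NX v).
have Vi : NX v < L^-1.
  by rewrite -(ltr_pM2l L0) mulfV ?gt_eqF//; lra.
pose y := retr p (sx s) v; pose e := y - sx s - v.
have he : NX e <= L * NX v ^+ 2 by exact: hR.
have ye : y - sx s = v + e by rewrite /e [RHS]addrC subrK.
rewrite -/y; clearbody e y; clear hR.
have he1 : NX e <= NX v.
  have : L * NX v ^+ 2 <= NX v by rewrite expr2 mulrA ler_piMl//; lra.
  lra.
have hy2 : NX (y - sx s) <= 2 * NX v by rewrite ye (le_trans (enormD _ _ _))//; lra.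
have hyL : NX (y - sx s) < L^-1.
  by rewrite -(ltr_pM2l L0) mulfV ?gt_eqF//; have := ler_wpM2l (ltW L0) hy2; lra.
have [hf hg] := hT y hyL; clear hT.
have hy4 : L * NX (y - sx s) ^+ 2 <= 4 * L * NX v ^+ 2.
  have : NX (y - sx s) ^+ 2 <= (2 * NX v) ^+ 2.
    by rewrite ler_pXn2r ?nnegrE ?enorm_ge0// mulr_ge0.
  by rewrite exprMn => h1; have := ler_wpM2l (ltW L0) h1; lra.
have Le := ler_wpM2l (ltW L0) he.
have f1 : f P y - f P (sx s) - ipX (gradf P (sx s)) v <= (4 * L + L * L) * NX v ^+ 2.
  clear - hf hgf hy4 Le ye he; rewrite ye innerDr in hf; rewrite ler_norml in hf; move/andP: hf => [_ hf].
  rewrite -ye in hf.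
  have h1 := inner_CS_abs (eX P) (gradf P (sx s)) e; rewrite ler_norml in h1; move/andP: h1 => [_ h1].
  have h2 := ler_wpM2r (enorm_ge0 (eX P) e) hgf; lra.
have f2 : th P y - th P (sx s + v) <= Lt * L * NX v ^+ 2.
  have Cn := ler_norm C; clear - sC Cn v1 he he1 Lt0 hth ye.
  have h1 : NX (sx s + v) <= `|C| + 2.
    by rewrite (le_trans (enormD _ _ _))//; lra.
  have h2 : NX y <= `|C| + 2.
    have -> : y = sx s + v + e by rewrite -addrA -ye addrC subrK.
    by rewrite (le_trans (enormD _ _ _))// (le_trans (lerD (enormD _ _ _) (lexx _)))//; lra.
  have := hth _ _ h2 h1; rewrite ler_norml => /andP[_ h3].
  have h4 : y - (sx s + v) = e by rewrite opprD addrA ye addrC addKr.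
  by rewrite h4 in h3; have := ler_wpM2l Lt0 he; lra.
have f3 : - h P y + h P (sx s) - ipX (szeta s) v <= L * L * NX v ^+ 2.
  have h1 := concave_limiting_subgrad (h_cvx hP) hzt y; clear - h1 ye hzL Le.
  rewrite ye innerNl innerDr in h1.
  have h2 := inner_CS_abs (eX P) (szeta s) e; rewrite ler_norml in h2; move/andP: h2 => [_ h2].
  have h3 := ler_wpM2r (enorm_ge0 (eX P) e) hzL; lra.
have f4 : srho s * (d (g P y) - d (g P (sx s) + jac P (sx s) v))
    <= `|C| * (c * (4 * L + L * L)) * NX v ^+ 2.
  have h1 := hc (g P y) (g P (sx s) + jac P (sx s) v).
  have h2 : NY (g P y - (g P (sx s) + jac P (sx s) v)) <= (4 * L + L * L) * NX v ^+ 2.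
    have -> : g P y - (g P (sx s) + jac P (sx s) v)
      = g P y - g P (sx s) - jac P (sx s) (y - sx s) + jac P (sx s) e.
      by rewrite ye jacD !opprD !addrA subrK.
    by rewrite (le_trans (enormD _ _ _))//; have := hj e; clear - hg hy4 Le; lra.
  have h3 := ler_wpM2l (ltW c0) h2.
  have h4 : 0 <= c * ((4 * L + L * L) * NX v ^+ 2).
    by rewrite mulr_ge0 ?(ltW c0)// mulr_ge0//; lra.
  have h5 := ler_wpM2l rho0 (le_trans h1 h3).
  have h6 := ler_wpM2r h4 rhoC'; clear - h5 h6; lra.
rewrite /Theta_pen /Theta /Theta_hat /ell /psi /G /= /gradell innerDl.
by clear - f1 f2 f3 f4; lra.
Qed.

(** Once beta dominates the curvature of the data, the retracted step does at least
    as well as the model, so it is accepted. *)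
Lemma large_beta : exists2 b1, 0 < b1 & forall s v z xi, tame s -> b1 <= sbeta s ->
  tangent (M P) (sx s) v -> subgrad (eZ P) (psi P s) z xi ->
  Theta_hat P s v < Theta_pen P (srho s) (sx s) ->
  NZ (G P s v - z) <= a_max p * NX v ^+ 2 -> NX (stat_vec P s v xi) <= b_max p * NX v ->
  gbar p * NX v ^+ 2 <= Theta_pen P (srho s) (sx s) - Theta_hat P s v /\
  Theta_pen P (srho s) (retr p (sx s) v) <= Theta_hat P s v.
Proof.
have [C1 C10 [v1 v10 hup]] := retraction_upper.
have [V V0 hV] := step_bound.
pose am := `|a_max p|; pose bm := `|b_max p|.
have [am0 bm0] : 0 <= am /\ 0 <= bm by split; exact: normr_ge0.
have [L2 L20 hpred] := pred_lower (1 + am).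
have La : 0 <= L2 * am by rewrite mulr_ge0// ltW.
have Vv : 0 < V / v1 by rewrite divr_gt0.
have gb0 := normr_ge0 (gbar p).
pose b1 := 2 * C1 + 2 * (`|gbar p| + bm + L2 * am) + V / v1 + V.
have [b1p b1a b1b b1c b1d] : [/\ 0 < b1, 2 * C1 <= b1, 2 * (`|gbar p| + bm + L2 * am) <= b1,
    V / v1 <= b1 & V <= b1] by rewrite /b1; split; lra.
clearbody b1; exists b1 => //.
move=> s v z xi hs hb1 Tv hsub hD hG hst.
have sb0 : 0 < sbeta s by exact: lt_le_trans hb1.
have hv := hV s v hs hD.
have v0 := enorm_ge0 (eX P) v; have v2 := sqr_ge0 (NX v).
have vv1 : NX v <= v1.
  rewrite -(ler_pM2l sb0) (le_trans hv)// mulrC -ler_pdivrMl// mulrC.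
  exact: le_trans hb1.
have vle1 : NX v <= 1.
  by rewrite -(ler_pM2l sb0) mulr1 (le_trans hv)// (le_trans b1d).
split; last first.
  rewrite -subr_le0 (le_trans (hup s v hs Tv vv1))//.
  by rewrite mulr_le0_ge0//; have := le_trans b1a hb1; lra.
have hG' : NZ (G P s v - z) <= am * NX v ^+ 2.
  by rewrite (le_trans hG)// ler_wpM2r// ler_norm.
have hst' : NX (stat_vec P s v xi) <= bm * NX v.
  by rewrite (le_trans hst)// ler_wpM2r// ler_norm.
have vam : NX v <= 1 + am by lra.
have hG1 : NZ (G P s v - z) <= 1 + am.
  have : am * NX v ^+ 2 <= am by rewrite ler_piMr// expr2 mulr_ile1.
  lra.
apply: le_trans (hpred s v z xi hs Tv hsub vam hG1).
have h2 := ler_wpM2r v0 hst'; have h3 := ler_wpM2l (ltW L20) hG'.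
have h4 : gbar p * NX v ^+ 2 <= `|gbar p| * NX v ^+ 2 by rewrite ler_wpM2r// ler_norm.
have h5 := ler_wpM2r v2 (le_trans b1b hb1).
have h6 : bm * NX v * NX v = bm * NX v ^+ 2 by rewrite expr2 mulrA.
by clear - h2 h3 h4 h5 h6; lra.
Qed.

(** An accurate triple passes the test: if the step is small then (I1) holds, and
    otherwise the inaccuracy is dominated by the square of the step. *)
Lemma acceptance (E b1 a_min b_min : R) : 0 < a_min -> 0 < b_min -> 0 < b1 ->
  exists2 cA, 0 < cA & forall s w e del epsk a b, tame s -> sbeta s <= b1 ->
    accurate P s e E w -> 0 < del <= 1 -> del <= epsk -> e <= cA * del ^+ 2 -> e <= E ->
    a_min <= a -> b_min <= b -> inner_accept P s epsk a b w.
Proof.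
move=> am0 bm0 b10; have [L L0 hpred] := pred_lower E.
pose E1 := `|E| + L + 1.
have E10 : 0 < E1 by rewrite /E1; have := normr_ge0 E; lra.
(* One summand for each requirement on the accuracy: (I1), the two parts of (I2), (D). *)
pose D := 1 + b1 ^+ 2 / a_min + b1 / b_min + 4 * b1 ^+ 2 * E1 / b0.
have bb := b00.
have b12 : 0 < b1 ^+ 2 by rewrite exprn_gt0.
have q1 : 0 < b1 ^+ 2 / a_min by rewrite divr_gt0.
have q2 : 0 < b1 / b_min by rewrite divr_gt0.
have q3 : 0 < 4 * b1 ^+ 2 * E1 / b0 by rewrite divr_gt0 ?mulr_gt0.
have D0 : 0 < D by rewrite /D; lra.
have lD x : x <= D -> D^-1 * x <= 1 by move=> xD; rewrite mulrC ler_pdivrMr// mul1r.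
have cA0 : 0 < D^-1 by rewrite invr_gt0.
have c1 : D^-1 <= 1 by have := lD 1 ltac:(rewrite /D; lra); rewrite mulr1.
have c2 : D^-1 * b1 ^+ 2 <= a_min.
  have := lD (b1 ^+ 2 / a_min) ltac:(rewrite /D; lra).
  by rewrite mulrA ler_pdivrMr// mul1r.
have c3 : D^-1 * b1 <= b_min.
  have := lD (b1 / b_min) ltac:(rewrite /D; lra).
  by rewrite mulrA ler_pdivrMr// mul1r.
have c4 : D^-1 * (4 * b1 ^+ 2 * E1) <= b0.
  have := lD (4 * b1 ^+ 2 * E1 / b0) ltac:(rewrite /D; lra).
  by rewrite mulrA ler_pdivrMr// mul1r.
exists D^-1 => //; clear lD; clearbody D.
move=> s [[v z] xi] e del epsk a b hs hb1 [/= Tv hsub hG hst hv] /andP[d0 d1] dk he heE ha hb.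
have [Ms sC hzt hrho hbb] := hs; have rho0 : 0 <= srho s by case/andP: hrho.
have sb0 : 0 < sbeta s by exact: lt_le_trans hbb.
have v0 := enorm_ge0 (eX P) v; have e0 : 0 <= e := le_trans (enorm_ge0 _ _) hG.
have dsq : del ^+ 2 <= del by rewrite expr2 ler_piMl// ltW.
have dsq0 : 0 < del ^+ 2 by rewrite exprn_gt0.
have edel : e <= del.
  have : D^-1 * del ^+ 2 <= del ^+ 2 by rewrite ler_piMl// ltW.
  lra.
split=> //; first exact/(cvx_subgradP (eZ P) (psi_cvx hP rho0)).
have [hI|hI] := leP (sbeta s * NX v) epsk.
  apply/orP; left; rewrite /cond_I1 !ge_max (enormZp _ _ (ltW sb0)) hI andbT.
  by apply/andP; split; [apply: le_trans hG _|apply: le_trans hst _]; lra.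
apply/orP; right; rewrite /cond_D /cond_I2/=.
have bv : del <= b1 * NX v.
  by have := ler_wpM2r v0 hb1; lra.
have bv2 : del ^+ 2 <= b1 ^+ 2 * NX v ^+ 2.
  by rewrite -exprMn ler_pXn2r ?nnegrE ?mulr_ge0// ltW.
have vsq := sqr_ge0 (NX v).
have ev : e <= D^-1 * b1 ^+ 2 * NX v ^+ 2.
  by have := ler_wpM2l (ltW cA0) bv2; lra.
have vp : 0 < NX v.
  by rewrite -(pmulr_rgt0 _ b10) (lt_le_trans d0).
have vp2 : 0 < NX v ^+ 2 by rewrite exprn_gt0.
apply/and3P; split.
- rewrite -subr_gt0; have := hpred s v z xi hs Tv hsub hv (le_trans hG heE).
  apply: lt_le_trans.
  have vE : NX v <= E1 - L by rewrite /E1; have := ler_norm E; lra.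
  have h1 : NX (stat_vec P s v xi) * NX v <= e * (E1 - L).
    by rewrite ler_pM ?enorm_ge0.
  have h2 := ler_wpM2l (ltW L0) hG.
  have h3 := ler_wpM2r (ltW E10) ev.
  have h4 := ler_wpM2r vsq c4; have h5 := ler_wpM2r vsq hbb.
  have h6 : 0 < sbeta s * NX v ^+ 2 by rewrite mulr_gt0.
  lra.
- apply: (le_trans hG); apply: (le_trans ev).
  by rewrite ler_wpM2r// (le_trans c2).
- apply: (le_trans hst).
  have h1 : D^-1 * del <= D^-1 * (b1 * NX v) by rewrite ler_wpM2l// ltW.
  have h2 : D^-1 * del ^+ 2 <= D^-1 * del by rewrite ler_wpM2l// ltW.
  have h3 := ler_wpM2r v0 (le_trans c3 hb); lra.
Qed.

Lemma values_bounded : exists D F, forall x, M P x -> NX x <= C -> d (g P x) <= D /\ - F <= Theta P x.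
Proof.
have [L1 L10 h1] := smooth_uniform hP hr C.
have [Ct Ct0 ht] := cvx_bounded (eX P) (th_cvx hP) C.
have [Ch Ch0 hh] := cvx_bounded (eX P) (h_cvx hP) C.
have [c c0 hc] := dist_lipschitz (K_closed hP) (K_nonempty hP) (tnorm_norm hP).
have [u Ku] := K_nonempty hP.
exists (c * (L1 + NY u) + d u), (L1 + Ct + Ch) => x Mx xC.
have [[hf _] hg _ _ _] := h1 x Mx xC; split.
  have := hc (g P x) u; have := ler_wpM2l (ltW c0) (enormB (eY P) (g P x) u).
  have := ler_wpM2l (ltW c0) (lerD hg (lexx (NY u))); lra.
have := ht x xC; have := hh x xC; move: hf; rewrite /Theta !ler_norml.
by move=> /andP[? _] /andP[_ ?] /andP[? _]; lra.
Qed.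

End iteration.


(** * The outer iteration *)

Lemma geometric_unbounded (R : realType) (a x : R) : 1 < a -> exists n, x < a ^+ n.
Proof.
move=> a1; have bern n : 1 + n%:R * (a - 1) <= a ^+ n.
  elim: n => [|n IH]; first by rewrite mul0r addr0 expr0.
  have a0 : 0 <= a by lra.
  rewrite exprS (le_trans _ (ler_wpM2l a0 IH))// -natr1.
  have : 0 <= n%:R * (a - 1) * (a - 1) by rewrite !mulr_ge0//; lra.
  lra.
exists (Num.bound (`|x| / (a - 1))); apply: lt_le_trans (bern _).
have h : 0 <= `|x| / (a - 1) by rewrite divr_ge0//; lra.
have := archi_boundP h; rewrite ltr_pdivrMr; last by lra.
have := ler_norm x; lra.
Qed.

Lemma ln_le_id (R : realType) (x : R) : 0 < x -> ln x <= x.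
Proof. by move=> x0; have := @le_ln1Dx R (x - 1) ltac:(lra); rewrite addrC subrK; lra. Qed.

Section run.
Context {R : realType} {X Y : normedModType R} (P : problem X Y) (p : params X).
Hypotheses (hP : standing_assumptions P) (hp : valid_params P p).
Variables (t : trace X Y) (C a_min b_min : R).
Hypothesis halg : algorithm1 P p t.
Hypothesis hC : forall k, reached P t k -> enorm (eX P) (tx t k) <= C /\ `|trho t k| <= C.
Hypotheses (am0 : 0 < a_min) (bm0 : 0 < b_min).
Hypothesis hab : forall k, reached P t k -> a_min <= ta t k /\ b_min <= tb t k.
Local Notation NX := (enorm (eX P)).
Local Notation NZ := (enorm (eZ P)).
Local Notation W := (X * (X * Y) * (X * Y))%type.
Local Notation d := (Defs.dist P).
Local Notation "'r' k" := (reached P t k) (at level 10, k at level 8).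
Local Notation tame := (tame P C (beta_min p)).

Let hr : retraction (M P) (retr p). Proof. by have [[? _] _ _ _] := hp. Qed.
Let bmin0 : 0 < beta_min p. Proof. by have [_ [_ /andP[? _] _ _] _ _] := hp. Qed.
Let tau1 : 1 < tau p. Proof. by have [_ _ [? _ _] _] := hp. Qed.
Let sg11 : 1 < sg1 p. Proof. by have [_ _ _ [_ _ _ _ [_ ?]]] := hp. Qed.
Let sg201 : 0 < sg2 p < 1. Proof. by have [_ _ _ [_ _ _ _ [? _]]] := hp. Qed.
Let vs01 : 0 < varsigma p < 1. Proof. by have [_ _ [_ _ ?] _] := hp. Qed.
Let eta10 : 0 < eta1 p. Proof. by have [_ _ _ [? _ _ _ _]] := hp. Qed.
Let eta11 : eta1 p < 1. Proof. by have [_ _ _ [_ ? ? _ _]] := hp; lra. Qed.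
Let gb0 : 0 < gbar p. Proof. by have [_ _ _ [_ _ _ ? _]] := hp. Qed.

Lemma inner_acceptP s epsk a b (w : W) : inner_accept P s epsk a b w <->
  [/\ tangent (M P) (sx s) w.1.1, limiting_subdiff (eZ P) (psi P s) w.1.2 w.2
    & cond_I1 P s epsk w || (cond_D P s w && cond_I2 P s a b w)].
Proof. by case: w => [[]]. Qed.

Lemma cond_I1P s epsk (w : W) : cond_I1 P s epsk w <->
  [/\ NZ (G P s w.1.1 - w.1.2) <= epsk, NX (stat_vec P s w.1.1 w.2) <= epsk
    & NX (sbeta s *: w.1.1) <= epsk].
Proof.
case: w => [[v z] xi]; rewrite /cond_I1 !ge_max /=.
by split=> [/andP[/andP[? ?] ?]|[-> -> ->]].
Qed.

Lemma inner_lastP k : (exists l, inner_stops P t k l) -> inner_stops P t k (inner_last P t k).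
Proof. exact: xgetPex. Qed.

Lemma inner_stops_le k n : inner_accept P (sub t k) (teps t k) (ta t k) (tb t k) (tout t k n) ->
  (exists l, inner_stops P t k l) /\ (inner_last P t k <= n)%N.
Proof.
move=> hn.
pose q : pred nat := fun l => `[< inner_accept P (sub t k) (teps t k) (ta t k) (tb t k) (tout t k l) >].
have ex : exists l, inner_stops P t k l.
  case: (@ex_minnP q (ex_intro _ n (asboolT hn))) => l /asboolP hl lmin; exists l; split=> // l' l'l hl'.
  by have := lmin l' (asboolT hl'); rewrite leqNgt l'l.
split=> //; have [_ hmin] := inner_lastP ex; rewrite leqNgt; apply/negP => /hmin; exact.
Qed.

Lemma step_facts k : (exists l, inner_stops P t k l) -> r k -> 0 <= trho t k -> M P (tx t k) ->
  let w := triple P t k in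
  [/\ tangent (M P) (tx t k) w.1.1, subgrad (eZ P) (psi P (sub t k)) w.1.2 w.2
    & ~~ I1k P t k -> [/\ Theta_hat P (sub t k) w.1.1 < Theta_pen P (trho t k) (tx t k),
        NZ (G P (sub t k) w.1.1 - w.1.2) <= a_max p * NX w.1.1 ^+ 2
      & NX (stat_vec P (sub t k) w.1.1 w.2) <= b_max p * NX w.1.1]].
Proof.
move=> ex hk rho0 Mk w; have [/inner_acceptP[Tv hsub hc] _] := inner_lastP ex.
split=> //; first exact/(cvx_subgradP (eZ P) (psi_cvx hP (s := sub t k) rho0)).
have [_ /(_ k hk)[_ /andP[_ ha] /andP[_ hb]] _] := halg.
rewrite -/(triple P t k) -/(I1k P t k) in hc.
move=> /negPf I1; rewrite I1 /= in hc; move: hc; rewrite -/w /cond_D /cond_I2.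
case: w => [[v z] xi]/= /and3P[h1 h2 h3]; split=> //.
  by rewrite (le_trans h2)// ler_wpM2r ?sqr_ge0.
by rewrite (le_trans h3)// ler_wpM2r ?enorm_ge0.
Qed.

Lemma reachedS_inv k : r k.+1 -> [/\ r k, exists l, inner_stops P t k l & outer_update P p t k].
Proof. by move=> hk; have [_ _ h] := halg; have [h1 h2 _] := hk; split=> //; exact: h. Qed.

Lemma reached_good k : r k -> [/\ M P (tx t k), rho0 p <= trho t k, beta_min p <= tbeta t k
  & 0 < teps t k].
Proof.
have [[e1 e2 e3 e4] _ _] := halg.
have [[_ Mx0] [rp0 /andP[b0 b01] _ _] [_ ep0 /andP[vs0 vs1]] _] := hp.
elim: k => [|k IH].
  by rewrite e1 e2 e3 e4 => _; split=> //; exact: ltW.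
move=> hk1; have [hk ex hup] := reachedS_inv hk1.
have [Mk rhok betak epsk] := IH hk.
have rk0 : 0 <= trho t k by rewrite (le_trans _ rhok)// ltW.
have bk0 : 0 < tbeta t k by rewrite (lt_le_trans _ betak).
have [Tv hsub _] := step_facts ex hk rk0 Mk.
have tr : rho0 p <= tau p * trho t k.
  have t1 := tau1; have : trho t k <= tau p * trho t k by rewrite ler_peMl// ltW.
  lra.
move: hup; rewrite /outer_update; case: (I1k P t k).
  move=> [-> -> -> ->]; split=> //; last exact: mulr_gt0.
  by case: ifP.
case: (rejected P p t k).
  move=> [-> -> -> ->]; split=> //.
  have s1 := sg11; have : tbeta t k <= sg1 p * tbeta t k by rewrite ler_peMl// ltW.
  lra.
move=> [-> -> -> ->]; split=> //.
- by have [hM _ _ _] := hr; exact: hM.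
- by case: ifP.
- by case: ifP => // _; rewrite le_max lexx orbT.
Qed.

Lemma reached_tame k : r k -> tame (sub t k).
Proof.
move=> hk; have [Mk rhok betak _] := reached_good hk; have [xC rC] := hC hk.
have [_ /(_ k hk)[hz _ _] _] := halg; have [_ [rp0 _ _ _] _ _] := hp.
split=> //=; apply/andP; split; first by rewrite (le_trans _ rhok)// ltW.
exact: le_trans (ler_norm _) rC.
Qed.

Lemma reached_rho_ge0 k : r k -> 0 <= trho t k.
Proof. by move=> /reached_tame[_ _ _ /andP[]]. Qed.

Lemma reached_facts k : (exists l, inner_stops P t k l) -> r k ->
  let w := triple P t k in
  [/\ tangent (M P) (tx t k) w.1.1, subgrad (eZ P) (psi P (sub t k)) w.1.2 w.2
    & ~~ I1k P t k -> [/\ Theta_hat P (sub t k) w.1.1 < Theta_pen P (trho t k) (tx t k),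
        NZ (G P (sub t k) w.1.1 - w.1.2) <= a_max p * NX w.1.1 ^+ 2
      & NX (stat_vec P (sub t k) w.1.1 w.2) <= b_max p * NX w.1.1]].
Proof.
move=> ex hk; have [Mk _ _ _] := reached_good hk.
exact: step_facts (reached_rho_ge0 hk) Mk.
Qed.

(** The stopping tests never fire: eps_k stays positive, and a step that decreases the
    model is nonzero. *)
Lemma reachedS k : r k -> (exists l, inner_stops P t k l) -> r k.+1.
Proof.
move=> hk ex; split=> //; rewrite /outer_stop.
have [_ _ _ epsk] := reached_good hk; have [_ _ hD] := reached_facts ex hk.
case: ifPn => [_|/hD[h _ _]]; first by rewrite gt_eqF// lt_max epsk.
have v0 := descent_neq0 (s := sub t k) h.
by rewrite gt_eqF// lt_max enorm_gt0 v0.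
Qed.

Lemma not_rejected : exists2 b1, 0 < b1 & forall k, r k -> (exists l, inner_stops P t k l) ->
  ~~ I1k P t k -> b1 <= tbeta t k -> ~~ rejected P p t k.
Proof.
have [b1 b10 hb1] := large_beta hP hr C (beta_min p); exists b1 => //.
move=> k hk ex nI1 bk; have [Tv hsub /(_ nI1)[hD hG hst]] := reached_facts ex hk.
have [h1 h2] := hb1 _ _ _ _ (reached_tame hk) bk Tv hsub hD hG hst.
rewrite /rejected negb_or -!leNgt /pred_red /Defs.ratio /ared /pred_red.
rewrite -/(vk P t k) in h1 h2 hD.
apply/andP; split=> //.
have pr : 0 < Theta_pen P (trho t k) (tx t k) - Theta_hat P (sub t k) (vk P t k) by rewrite subr_gt0.
have e1 := eta11.
rewrite ler_pdivlMr// (le_trans (ler_piMl (ltW pr) (ltW e1)))//.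
by rewrite lerD2l lerN2.
Qed.

Lemma beta_bounded : exists2 b1, 0 < b1 & forall k, r k -> tbeta t k <= b1.
Proof.
have [b b0 hb] := not_rejected.
have [[_ _ e3 _] _ _] := halg; have [_ [_ /andP[_ b01] _ _] _ _] := hp.
have bm := bmin0; have s1 := sg11; have /andP[s20 s21] := sg201.
exists (beta0 p + sg1 p * b); first by rewrite addr_gt0 ?mulr_gt0//; lra.
have sb : 0 <= sg1 p * b by rewrite mulr_ge0//; lra.
elim=> [|k IH]; first by move=> _; rewrite e3 lerDl.
move=> /reachedS_inv[hk ex]; have hk1 := IH hk; have [_ _ bk _] := reached_good hk.
rewrite /outer_update; case: ifPn => [_ [_ -> _ _] //|nI1].
case: ifPn => [hrej [_ -> _ _]|_ [_ -> _ _]].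
  have : tbeta t k < b.
    by rewrite ltNge; apply/negP => /(hb k hk ex nI1); rewrite hrej.
  move=> h; have : sg1 p * tbeta t k <= sg1 p * b by rewrite ler_wpM2l ?ltW//; lra.
  by have := bm; lra.
case: ifP => // _; rewrite ge_max; apply/andP; split; last by lra.
have : sg2 p * tbeta t k <= tbeta t k by rewrite ler_piMl//; lra.
lra.
Qed.

(** When (I1) fails, (I2) makes the step at least proportional to the tolerance. *)
Lemma long_step : exists2 c3, 0 < c3 & forall k, r k -> (exists l, inner_stops P t k l) ->
  ~~ I1k P t k -> c3 * teps t k <= NX (vk P t k).
Proof.
have [b1 b10 hb1] := beta_bounded; have [V V0 hV] := step_bound hP hr C (beta_min p).
have [_ [_ _ aM0 bM0] _ _] := hp; have bm := bmin0.
pose D := a_max p * (V / beta_min p) + b_max p + b1.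
have aV : 0 < a_max p * (V / beta_min p) by rewrite mulr_gt0// divr_gt0.
have [D0 D1 D2 D3] : [/\ 0 < D, a_max p * (V / beta_min p) <= D, b_max p <= D & b1 <= D].
  by rewrite /D; split; lra.
exists D^-1; first by rewrite invr_gt0.
move=> k hk ex nI1; have [_ _ /(_ nI1)[hD hG hst]] := reached_facts ex hk.
rewrite ler_pdivrMl// leNgt; apply/negP => hlt; move: nI1; apply/negP; rewrite negbK.
have [_ _ bk _] := reached_good hk.
have bk0 : 0 < tbeta t k by exact: lt_le_trans bk.
have v0 := enorm_ge0 (eX P) (triple P t k).1.1.
have hv := hV (sub t k) _ (reached_tame hk) hD.
rewrite /vk in hlt; rewrite /I1k; apply/cond_I1P.
have le_eps x : x <= D -> x * NX (triple P t k).1.1 <= teps t k.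
  by move=> xD; rewrite (le_trans _ (ltW hlt))// ler_wpM2r.
split.
- apply: (le_trans hG); apply: le_trans (le_eps _ D1).
  rewrite expr2 mulrA ler_wpM2r// ler_wpM2l ?(ltW aM0)// ler_pdivlMr// (le_trans _ hv)//.
  by rewrite mulrC /= ler_wpM2r.
- exact: le_trans hst (le_eps _ D2).
- by rewrite (enormZp _ _ (ltW bk0)) (le_trans _ (le_eps _ D3))// ler_wpM2r//; exact: hb1.
Qed.

(** A small tolerance reached with a small distance forces stationarity, so at a
    nonstationary iteration rho is increased instead. *)
Lemma small_I1_stationary : exists2 c1, 0 < c1 & forall k eps, r k -> (exists l, inner_stops P t k l) ->
  I1k P t k -> teps t k <= c1 * eps -> dk P t k <= teps t k -> eps_stationary P eps (tx t k).
Proof.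
have [kst kst0 hst] := stationary_of_small hP hr C (beta_min p); have bm := bmin0.
pose q := 1 + (beta_min p)^-1.
have q1 : 1 <= q by rewrite lerDl invr_ge0 ltW.
have q0 : 0 < q by lra.
exists (kst * q)^-1; first by rewrite invr_gt0 mulr_gt0.
move=> k eps hk ex /cond_I1P[h1 h2 h3] he hd; have [Tv hsub _] := reached_facts ex hk.
have [_ _ bk epsk] := reached_good hk.
have bk0 : 0 < tbeta t k by exact: lt_le_trans bk.
have eq1 : teps t k <= q * teps t k by rewrite ler_peMl// ltW.
apply: (hst (sub t k) _ _ _ (q * teps t k) eps (reached_tame hk) Tv hsub).
- exact: le_trans h1 eq1.
- exact: le_trans h2 eq1.
- have h4 : NX (triple P t k).1.1 <= (beta_min p)^-1 * teps t k.
    rewrite ler_pdivlMl// (le_trans _ h3)// (enormZp _ _ (ltW bk0)).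
    by rewrite ler_wpM2r ?enorm_ge0.
  by rewrite (le_trans h4)// ler_wpM2r ?(ltW epsk)// lerDr.
- exact: le_trans h3 eq1.
- exact: le_trans hd eq1.
- by rewrite mulrA -ler_pdivlMl ?mulr_gt0.
Qed.

(** Each decrease of the tolerance below the target level is paid for by an increase of
    rho, of which boundedness allows only finitely many. *)
Lemma tolerance_bounded : exists2 c2, 0 < c2 <= 1 & forall eps k, 0 < eps < 1 -> r k ->
  (forall j, (j < k)%N -> ~ eps_stationary P eps (tx t j)) -> c2 * eps <= teps t k.
Proof.
have [c1 c10 hc1] := small_I1_stationary.
have [[_ e2 _ e4] _ _] := halg; have [_ [rp0 _ _ _] [_ ep0 _] _] := hp.
have /andP[vs0 vs1] := vs01; have t1 := tau1.
have [N hN] := geometric_unbounded (C / rho0 p) t1.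
(* m0 eps is below the initial tolerance and below every tolerance that is reached
   without an increase of rho, from one larger than c1 eps. *)
pose m0 := Num.min 1 (Num.min (eps0 p) (varsigma p * c1)).
have m00 : 0 < m0 by rewrite !lt_min ltr01 ep0 mulr_gt0.
have m01 : m0 <= 1 by rewrite ge_min lexx.
have m0e : m0 <= eps0 p by rewrite !ge_min lexx orbT.
have m0v : m0 <= varsigma p * c1 by rewrite !ge_min lexx !orbT.
exists (varsigma p ^+ N * m0).
  by rewrite mulr_gt0 ?exprn_gt0//= mulr_ile1// ?exprn_ge0 ?exprn_ile1// ltW.
move=> eps k /andP[eps_0 eps_1] hk hns.
have [n [hn1 hn2]] : exists n, rho0 p * tau p ^+ n <= trho t k /\
    m0 * eps * varsigma p ^+ n <= teps t k.
  elim: k hk hns => [|k IH].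
    move=> _ _; exists 0%N; rewrite !expr0 !mulr1 e2 e4; split=> //.
    by apply: le_trans m0e; rewrite ler_piMr// ltW.
  move=> hk1 hns; have [hk ex hup] := reachedS_inv hk1.
  have [n [hn1 hn2]] := IH hk (fun j jk => hns j (ltnW jk)).
  have nsk := hns k (ltnSn k).
  have tr : trho t k <= tau p * trho t k by rewrite ler_peMl ?reached_rho_ge0// ltW.
  have me0 : 0 < m0 * eps by rewrite mulr_gt0.
  move: hup; rewrite /outer_update; case: ifPn => [I1 [_ _ -> ->]|_].
    case: ifPn => [hd|_].
      exists n; split=> //.
      have he : c1 * eps < teps t k.
        by rewrite ltNge; apply/negP => he; apply: nsk; exact: hc1 k eps hk ex I1 he hd.
      have h1 : m0 * eps * varsigma p ^+ n <= m0 * eps.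
        by rewrite ler_piMr ?(ltW me0)// exprn_ile1// ltW.
      have h2 := ler_wpM2r (ltW eps_0) m0v.
      have h3 := ler_wpM2l (ltW vs0) (ltW he); lra.
    exists n.+1; rewrite !exprS; split.
      by rewrite mulrCA ler_wpM2l//; lra.
    by rewrite mulrCA ler_wpM2l// ltW.
  case: ifPn => [_ [_ _ -> ->]|_ [_ _ -> ->]]; first by exists n.
  by exists n; split=> //; case: ifP => // _; exact: le_trans tr.
have nN : (n <= N)%N.
  rewrite leqNgt; apply/negP => Nn; have [_ /(le_trans (ler_norm _)) rC] := hC hk.
  have h1 : tau p ^+ N <= tau p ^+ n by rewrite ler_eXn2l// ltnW.
  have h2 : C < rho0 p * tau p ^+ N by rewrite -ltr_pdivrMl// mulrC.
  have h3 : rho0 p * tau p ^+ N <= rho0 p * tau p ^+ n by rewrite ler_wpM2l// ltW.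
  lra.
apply: le_trans hn2; rewrite -[leLHS]mulrA [leLHS]mulrC.
by rewrite ler_wpM2l ?mulr_ge0 ?(ltW m00) ?(ltW eps_0)// ler_iXn2l.
Qed.

Section potential.
Variable D : R.
Hypothesis hD : forall k, r k -> d (g P (tx t k)) <= D.

(** Replacing dist by dist - D makes the merit function nonincreasing in rho. *)
Definition merit k := Theta P (tx t k) + trho t k * (d (g P (tx t k)) - D).

Lemma merit_rho x rho rho' : rho <= rho' -> d (g P x) <= D ->
  Theta P x + rho' * (d (g P x) - D) <= Theta P x + rho * (d (g P x) - D).
Proof. by move=> h1 h2; rewrite lerD2l; apply: ler_wnM2r => //; lra. Qed.

Lemma one_step k : r k.+1 ->
  [\/ [/\ I1k P t k, merit k.+1 <= merit k, teps t k.+1 = varsigma p * teps t k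
        & tbeta t k.+1 = tbeta t k],
      [/\ merit k.+1 <= merit k, teps t k.+1 = teps t k & tbeta t k.+1 = sg1 p * tbeta t k]
    | [/\ ~~ I1k P t k, merit k.+1 + eta1 p * gbar p * NX (vk P t k) ^+ 2 <= merit k,
        teps t k.+1 = teps t k & sg2 p * tbeta t k <= tbeta t k.+1]].
Proof.
move=> hk1; have hd1 := hD hk1; have [hk ex hup] := reachedS_inv hk1.
have hd := hD hk; have [_ _ bk _] := reached_good hk; have rho0 := reached_rho_ge0 hk.
have t1 := tau1; have bm := bmin0.
have tr : trho t k <= tau p * trho t k by rewrite ler_peMl// ltW.
move: hup hd1; rewrite /outer_update /merit; case: ifPn => [I1 [-> -> -> ->]|nI1].
  move=> hd1; constructor 1; split=> //; apply: merit_rho => //.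
  by case: ifP.
case: ifPn => [_ [-> -> -> ->]|hrej [-> -> -> ->]] hd1.
  by constructor 2.
constructor 3; split=> //; last first.
  have /andP[s20 s21] := sg201.
  case: ifP => _; first by rewrite ler_piMl//; lra.
  by rewrite le_max lexx.
have [_ _ /(_ nI1)[hTD _ _]] := reached_facts ex hk.
rewrite -/(vk P t k) in hTD.
move: hrej; rewrite /rejected negb_or -!leNgt => /andP[hrat hpred].
have pr : 0 < pred_red P t k by rewrite subr_gt0.
rewrite /Defs.ratio ler_pdivlMr// in hrat.
have h1 : eta1 p * gbar p * NX (vk P t k) ^+ 2 <= ared P p t k.
  by apply: le_trans hrat; rewrite -mulrA ler_wpM2l// ltW.
have h2 : trho t k <= (if increase_rho P t k then tau p * trho t k else trho t k) by case: ifP.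
have := merit_rho h2 hd1; move: h1; rewrite /ared /Theta_pen; lra.
Qed.

End potential.

(** The potential adds to the merit function the logarithms of the tolerance and of
    beta_max / beta_k, scaled so that each kind of iteration decreases it by one. *)
Lemma iterations_bounded : exists2 K0, 0 < K0 & forall eps, 0 < eps < 1 ->
  forall k, r k -> (forall j, (j < k)%N -> ~ eps_stationary P eps (tx t j)) ->
  k%:R <= K0 * eps ^- 2.
Proof.
have [c2 /andP[c20 c21] hc2] := tolerance_bounded.
have [c3 c30 hc3] := long_step.
have [b1 b10 hb1] := beta_bounded.
have [D [F hDF]] := values_bounded hP hr C.
have hD k (hk : r k) : d (g P (tx t k)) <= D.
  by have [Mk _ _ _] := reached_good hk; have [xC _] := hC hk; have [] := hDF _ Mk xC.
have C0 : 0 <= C by have [_ h] := hC (k := 0%N) I; exact: le_trans (normr_ge0 _) h.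
pose Pmin := - F - C * `|D|.
have hPmin k (hk : r k) : Pmin <= merit D k.
  have [Mk _ _ _] := reached_good hk; have [xC rC] := hC hk; have [_ h1] := hDF _ Mk xC.
  have h2 := dist_ge0 (K_nonempty hP) (tnorm_norm hP) (g P (tx t k)).
  have rk := reached_rho_ge0 hk; rewrite ger0_norm// in rC.
  have h3 := mulr_ge0 rk h2.
  have h4 : trho t k * D <= trho t k * `|D| by rewrite ler_wpM2l// ler_norm.
  have h5 : trho t k * `|D| <= C * `|D| by rewrite ler_wpM2r.
  by rewrite /Pmin /merit; lra.
have bm := bmin0; have /andP[s20 s21] := sg201; have s1 := sg11; have /andP[vs0 vs1] := vs01.
pose ls := ln (sg1 p); pose lv := - ln (varsigma p); pose b' := - ln (sg2 p) / ls.
have ls0 : 0 < ls by rewrite ln_gt0.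
have lv0 : 0 < lv by rewrite oppr_gt0 ln_lt0// vs0.
have b'0 : 0 <= b' by rewrite divr_ge0 ?(ltW ls0)// oppr_ge0 ln_le0// ltW.
pose c4 := eta1 p * gbar p * (c3 * c2) ^+ 2.
have c40 : 0 < c4 by rewrite !mulr_gt0 ?exprn_gt0 ?mulr_gt0.
pose A := (1 + b') / c4.
have A0 : 0 < A by rewrite divr_gt0//; lra.
have [[_ _ e3 e4] _ _] := halg; have [_ [_ /andP[_ bp] _ _] [_ ep0 _] _] := hp.
pose k1 := A * `|merit D 0 - Pmin|.
pose k2 := (`|ln (eps0 p) - ln c2| + 1) / lv.
pose k3 := `|ln b1 - ln (beta0 p)| / ls.
have k10 : 0 <= k1 by rewrite mulr_ge0// ltW.
have k20 : 0 <= k2 by rewrite divr_ge0// ltW.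
have k30 : 0 <= k3 by rewrite divr_ge0// ltW.
exists (k1 + k2 + k3 + 1); first by lra.
move=> eps heps; have /andP[eps_0 eps_1] := heps.
pose pot k := A * eps ^- 2 * (merit D k - Pmin) + (ln (teps t k) - ln (c2 * eps)) / lv
  + (ln b1 - ln (tbeta t k)) / ls.
have e20 : 0 < eps ^- 2 by rewrite invr_gt0 exprn_gt0.
have Ae0 : 0 < A * eps ^- 2 by rewrite mulr_gt0.
have ce0 : 0 < c2 * eps by rewrite mulr_gt0.
have beta_gt0 k (hk : r k) : 0 < tbeta t k.
  by have [_ _ h _] := reached_good hk; exact: lt_le_trans h.
have pot_ge0 k : r k -> (forall j, (j < k)%N -> ~ eps_stationary P eps (tx t j)) -> 0 <= pot k.
  move=> hk hns; have ek := hc2 eps k heps hk hns; have [_ _ _ ek0] := reached_good hk.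
  have bk := hb1 k hk; rewrite /pot !addr_ge0//.
  - by rewrite mulr_ge0 ?(ltW Ae0)// subr_ge0 hPmin.
  - by rewrite divr_ge0 ?(ltW lv0)// subr_ge0 ler_ln ?posrE.
  - by rewrite divr_ge0 ?(ltW ls0)// subr_ge0 ler_ln ?posrE ?beta_gt0.
have pot_step k : r k.+1 -> (forall j, (j < k.+1)%N -> ~ eps_stationary P eps (tx t j)) ->
    pot k.+1 + 1 <= pot k.
  move=> hk1 hns; have [hk ex _] := reachedS_inv hk1.
  have ek := hc2 eps k heps hk (fun j jk => hns j (ltnW jk)).
  have [_ _ _ ek0] := reached_good hk; have bk0 := beta_gt0 k hk; have bk1 := beta_gt0 _ hk1.
  case: (one_step hD hk1) => [[_ hm he hb]|[hm he hb]|[nI1 hm he hb]].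
  - have h1 := ler_wpM2l (ltW Ae0) hm.
    rewrite /pot he hb lnM ?posrE//.
    have -> : (ln (varsigma p) + ln (teps t k) - ln (c2 * eps)) / lv
      = (ln (teps t k) - ln (c2 * eps)) / lv - 1.
      by rewrite /lv; field; rewrite lt_eqF// ln_lt0// vs0.
    by lra.
  - have h1 := ler_wpM2l (ltW Ae0) hm.
    have sp : 0 < sg1 p by lra.
    rewrite /pot he hb lnM ?posrE//.
    have -> : (ln b1 - (ln (sg1 p) + ln (tbeta t k))) / ls = (ln b1 - ln (tbeta t k)) / ls - 1.
      by rewrite -/ls; field; rewrite gt_eqF.
    by lra.
  - have h1 := ler_wpM2l (ltW Ae0) hm.
    have h2 : 1 + b' <= A * eps ^- 2 * (eta1 p * gbar p * NX (vk P t k) ^+ 2).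
      have hv : c3 * c2 * eps <= NX (vk P t k).
        rewrite (le_trans _ (hc3 k hk ex nI1))// -mulrA.
        by rewrite ler_wpM2l// ltW.
      have hv2 : (c3 * c2) ^+ 2 * eps ^+ 2 <= NX (vk P t k) ^+ 2.
        by rewrite -exprMn ler_pXn2r ?nnegrE ?enorm_ge0// !mulr_ge0// ltW.
      have hv3 : c4 * eps ^+ 2 <= eta1 p * gbar p * NX (vk P t k) ^+ 2.
        by rewrite /c4 -mulrA ler_wpM2l// ltW// mulr_gt0.
      have <- : A * eps ^- 2 * (c4 * eps ^+ 2) = 1 + b'.
        by rewrite /A; field; rewrite !gt_eqF.
      by rewrite ler_wpM2l// ltW.
    have h3 : ln (sg2 p) + ln (tbeta t k) <= ln (tbeta t k.+1).
      by rewrite -lnM ?posrE// ler_ln ?posrE ?mulr_gt0.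
    have h4 : (ln b1 - ln (tbeta t k.+1)) / ls <= (ln b1 - ln (tbeta t k)) / ls + b'.
      by rewrite /b' -mulrDl ler_wpM2r ?invr_ge0 ?(ltW ls0)//; lra.
    by rewrite /pot he; lra.
have pot0 : pot 0%N <= (k1 + k2 + k3 + 1) * eps ^- 2.
  have e1 : 1 <= eps ^- 2 by rewrite invf_ge1 ?exprn_gt0// exprn_ile1// ltW.
  have lne : - ln eps <= eps ^- 2.
    rewrite -lnV ?posrE//.
    apply: (le_trans (ln_le_id _)); first by rewrite invr_gt0.
    by rewrite lef_pV2 ?posrE ?exprn_gt0// expr2 ler_piMl// ltW.
  have h1 : A * eps ^- 2 * (merit D 0 - Pmin) <= k1 * eps ^- 2.
    rewrite /k1 mulrAC ler_wpM2r ?(ltW e20)// ler_wpM2l ?(ltW A0)//; exact: ler_norm.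
  have h2 : (ln (teps t 0) - ln (c2 * eps)) / lv <= k2 * eps ^- 2.
    rewrite /k2 mulrAC ler_wpM2r ?invr_ge0 ?(ltW lv0)// e4 lnM ?posrE//.
    have h4 : ln (eps0 p) - ln c2 <= `|ln (eps0 p) - ln c2| := ler_norm _.
    have h5 : `|ln (eps0 p) - ln c2| <= `|ln (eps0 p) - ln c2| * eps ^- 2.
      by rewrite ler_peMr.
    by lra.
  have h3 : (ln b1 - ln (tbeta t 0)) / ls <= k3 * eps ^- 2.
    rewrite /k3 mulrAC ler_wpM2r ?invr_ge0 ?(ltW ls0)// e3.
    by rewrite (le_trans (ler_norm _))// ler_peMr.
  by rewrite /pot; lra.
suff H k : r k -> (forall j, (j < k)%N -> ~ eps_stationary P eps (tx t j)) -> pot k + k%:R <= pot 0%N.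
  by move=> k hk hns; have := H k hk hns; have := pot_ge0 k hk hns; lra.
elim: k => [|k IH]; first by rewrite addr0.
move=> hk1 hns; have [hk _ _] := reachedS_inv hk1.
have := IH hk (fun j jk => hns j (ltnW jk)); have := pot_step k hk1 hns.
by rewrite -natr1; lra.
Qed.

(** Until stationarity the tolerance stays of order eps, so the inner solver stops as
    soon as its accuracy is of order eps^2. *)
Theorem outer_complexity (e : nat -> R) (E : R) (m : nat) : (forall l, e l <= E) ->
  (forall k l, r k -> accurate P (sub t k) (e l) E (tout t k (l + m))) ->
  exists2 K0, 0 < K0 & exists2 c5, 0 < c5 & forall eps, 0 < eps < 1 ->
  forall n, e n <= c5 * eps ^+ 2 -> exists k, [/\ first_stationary P t eps k,
    k%:R <= K0 * eps ^- 2 & forall j, (j <= k)%N -> (inner_last P t j <= n + m)%N].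
Proof.
move=> heE hacc; have [c2 /andP[c20 c21] hc2] := tolerance_bounded.
have [b1 b10 hb1] := beta_bounded; have [K0 K00 hK] := iterations_bounded.
have [cA cA0 hA] := acceptance hP hr C bmin0 E am0 bm0 b10.
exists K0 => //; exists (cA * c2 ^+ 2); first by rewrite mulr_gt0 ?exprn_gt0.
move=> eps heps n hn; have /andP[eps_0 eps_1] := heps.
have stops k : r k -> (forall j, (j < k)%N -> ~ eps_stationary P eps (tx t j)) ->
    (exists l, inner_stops P t k l) /\ (inner_last P t k <= n + m)%N.
  move=> hk hns; apply: inner_stops_le; have [ha hb] := hab hk.
  apply: (hA (sub t k) _ (e n) (c2 * eps)) => //.
  - exact: reached_tame.
  - exact: hb1.
  - exact: hacc.
  - by rewrite mulr_gt0//= mulr_ile1// ltW.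
  - exact: hc2.
  - by rewrite exprMn mulrA.
have reach k : (forall j, (j < k)%N -> ~ eps_stationary P eps (tx t j)) -> r k.
  elim: k => [//|k IH] hns; have hk := IH (fun j jk => hns j (ltnW jk)).
  apply: reachedS => //; exact: (stops k hk (fun j jk => hns j (ltnW jk))).1.
pose q : pred nat := fun k => `[< eps_stationary P eps (tx t k) >].
have ex : exists k, q k.
  apply: contrapT => hno.
  have ns j : ~ eps_stationary P eps (tx t j) by move=> hj; apply: hno; exists j; exact/asboolP.
  have e0 : 0 <= K0 * eps ^- 2 by rewrite mulr_ge0 ?(ltW K00)// invr_ge0 exprn_ge0// ltW.
  have := hK eps heps (Num.bound (K0 * eps ^- 2)) (reach _ (fun j _ => ns j)) (fun j _ => ns j).
  by rewrite leNgt (archi_boundP e0).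
case: (ex_minnP ex) => k /asboolP hk kmin.
have ns j : (j < k)%N -> ~ eps_stationary P eps (tx t j).
  by move=> jk hj; have := kmin j (asboolT hj); rewrite leqNgt jk.
exists k; split.
- split=> //; split; first exact: reach.
  exact: (stops k (reach k ns) ns).1.
- exact: hK (reach k ns) ns.
- move=> j jk; have nsj i : (i < j)%N -> ~ eps_stationary P eps (tx t i).
    by move=> ij; apply: ns; exact: leq_trans ij jk.
  exact: (stops j (reach j nsj) nsj).2.
Qed.

End run.

(** * Counting the oracle calls *)

Section counting.
Context {R : realType} {X Y : normedModType R} (P : problem X Y) (t : trace X Y).

Lemma calls_A_7 w k l : calls_A P t w k l = 7.
Proof. by rewrite /calls_A; case: (w k l) => [[]] ? ? ?; case: (w k l.+1) => [[]]. Qed.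

Lemma calls_B_7 wb w k l : calls_B P t wb w k l = 7.
Proof. by rewrite /calls_B; case: (wb k l) => [[]] ? ? ?; case: (w k l) => [[]]. Qed.

Lemma total_calls_le calls k n : (forall j l, calls j l = 7) ->
  (forall j, (j <= k)%N -> (inner_last P t j <= n)%N) ->
  (total_calls P t calls k <= k.+1 * (7 * n.+1))%N.
Proof.
move=> c7 hn; rewrite /total_calls.
rewrite -[X in (_ <= X)%N](_ : (\sum_(j < k.+1) 7 * n.+1 = k.+1 * (7 * n.+1))%N); last first.
  by rewrite sum_nat_const card_ord.
apply: leq_sum => j _; under eq_bigr do rewrite c7.
by rewrite sum_nat_const card_ord mulnC leq_pmul2l// ltnS hn// -ltnS.
Qed.

End counting.

Theorem theorem4p2 (R : realType) (X Y : normedModType R) (P : problem X Y)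
    (p : params X) (hP : standing_assumptions P) (hp : valid_params P p)
    (sbar : R) (hsbar : 1 <= sbar)
    (B0 : set (X * (X * Y) * (X * Y))%type) (hB0 : compact B0) :
  (forall (alpha vrho : R) (t : trace X Y) (a_min b_min : R)
      (wb wh w : nat -> nat -> (X * (X * Y) * (X * Y))%type),
    2 <= alpha -> 0 < vrho <= 2 ->
    algorithm1 P p t -> 0 < a_min -> 0 < b_min ->
    common_assumptions P p t sbar a_min b_min ->
    solver_B P t alpha vrho B0 wb wh w ->
    oracle_complexity P t (calls_B P t wb w) [set eps | 0 < eps < 1]
      (fun eps => eps ^- 4))
  /\
  (forall (t : trace X Y) (a_min b_min cR : R)
      (w : nat -> nat -> (X * (X * Y) * (X * Y))%type),
    algorithm1 P p t -> 0 < a_min -> 0 < b_min ->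
    common_assumptions P p t sbar a_min b_min ->
    solver_A P t B0 w ->
    0 < cR -> error_bound P t w cR ->
    forall eps_hi : R, 0 < eps_hi < 1 ->
    oracle_complexity P t (calls_A P t w) [set eps | 0 < eps <= eps_hi]
      (fun eps => eps ^- 2 * ln eps^-1)).
Proof.
have hr : retraction (M P) (retr p) by have [[? _] _ _ _] := hp.
have bm : 0 < beta_min p by have [_ [_ /andP[? _] _ _] _ _] := hp.
split=> [alpha vrho t a_min b_min wb wh w a2 v02 halg am0 bm0 [[C hC] _ hab hsig] hB
        |t a_min b_min cR w halg am0 bm0 [[C hC] _ hab hsig] hA cR0 heb eps_hi /andP[eh0 eh1]].
  have [E E0 hE] := accelerated_uniform hP hr C bm hsbar hB0 a2 v02.
  have [||K0 K00 [c5 c50 hcpl]] :=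
      outer_complexity hP hp halg hC am0 bm0 hab (e := fun l => E / l.+1%:R) (E := E) (m := 0).
  - by move=> l; rewrite ler_pdivrMr// ler_peMr ?(ltW E0)// ler1n.
  - move=> k l hk; rewrite addn0; have [hw hacc hout] := hB k hk; rewrite hout.
    exact: hE (reached_tame hP hp halg hC hk) (hsig k hk) hw hacc l.
  pose c6 := E / c5.
  have c60 : 0 < c6 by rewrite divr_gt0.
  exists ((K0 + 1) * (7 * (c6 + 1))); first by rewrite !mulr_gt0//; lra.
  move=> eps /= heps; have /andP[e0 e1] := heps.
  have i1 : 1 <= eps ^- 2 by rewrite invf_ge1 ?exprn_gt0// exprn_ile1// ltW.
  have x0 : 0 <= c6 * eps ^- 2 by rewrite mulr_ge0 ?(ltW c60)//; lra.
  pose n := Num.truncn (c6 * eps ^- 2).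
  have /andP[n1 n2] : n%:R <= c6 * eps ^- 2 < n.+1%:R by exact: truncn_itv.
  have [|k [hst hk hl]] := hcpl eps heps n.
    rewrite ler_pdivrMr// mulrC.
    have -> : E = c6 * eps ^- 2 * (c5 * eps ^+ 2) by rewrite /c6; field; rewrite !gt_eqF.
    by rewrite ler_wpM2r ?mulr_ge0 ?exprn_ge0 ?(ltW c50) ?(ltW e0)// ltW.
  exists k; split=> //.
  have h := total_calls_le (P := P) (t := t) (k := k) (n := n) (calls_B_7 P t wb w).
  apply: (@le_trans _ _ (k.+1 * (7 * n.+1))%:R).
    by rewrite ler_nat h// => j /hl; rewrite addn0.
  rewrite !natrM.
  have -> : eps ^- 4 = eps ^- 2 * eps ^- 2 by rewrite -invfM -exprD.
  rewrite [leRHS](_ : _ = (K0 + 1) * eps ^- 2 * (7 * ((c6 + 1) * eps ^- 2))); last by ring.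
  by rewrite !ler_pM// -natr1; lra.
have [E E0 [q /andP[q0 q1] hE]] := admm_uniform hP hr C bm hsbar hB0 cR0.
have [||K0 K00 [c5 c50 hcpl]] :=
    outer_complexity hP hp halg hC am0 bm0 hab (e := fun l => E * q ^+ l) (E := E) (m := 1).
- by move=> l; rewrite ler_piMr ?(ltW E0)// exprn_ile1// ltW.
- move=> k l hk; rewrite addn1; have [hw hacc hout] := hA k hk; rewrite hout.
  exact: hE (reached_tame hP hp halg hC hk) (hsig k hk) hw hacc (heb k hk) l.
pose lq := ln q^-1; pose l0 := ln eps_hi^-1; pose a := `|ln (E / c5)|.
have lq0 : 0 < lq by rewrite ln_gt0// invf_gt1.
have l00 : 0 < l0 by rewrite ln_gt0// invf_gt1.
have a0 : 0 <= a by exact: normr_ge0.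
pose c6 := (a / lq + 3) / l0 + 2 / lq.
have al0 : 0 <= a / lq by rewrite divr_ge0// ltW.
have c60 : 0 < c6 by rewrite addr_gt0 ?divr_gt0//; lra.
exists ((K0 + 1) * (7 * c6)); first by rewrite !mulr_gt0//; lra.
move=> eps /= /andP[e0 eh].
have e1 : eps < 1 by exact: le_lt_trans eh1.
have heps : 0 < eps < 1 by rewrite e0.
have i1 : 1 <= eps ^- 2 by rewrite invf_ge1 ?exprn_gt0// exprn_ile1// ltW.
have le : l0 <= ln eps^-1 by rewrite ler_ln ?posrE ?invr_gt0// lef_pV2 ?posrE.
pose x := (a + 2 * ln eps^-1) / lq.
have x0 : 0 <= x by rewrite divr_ge0 ?(ltW lq0)//; lra.
pose n := (Num.truncn x).+1.
have /andP[n1 n2] : (Num.truncn x)%:R <= x < n%:R by exact: truncn_itv.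
have hx : (n + 2)%:R <= c6 * ln eps^-1.
  rewrite /n addSn addn2 -!natr1.
  have -> : c6 * ln eps^-1 = (a / lq + 3) * (ln eps^-1 / l0) + 2 * ln eps^-1 / lq.
    by rewrite /c6; field; rewrite !gt_eqF.
  have h1 : a / lq + 3 <= (a / lq + 3) * (ln eps^-1 / l0).
    by rewrite ler_peMr ?ler_pdivlMr ?mul1r//; lra.
  have h2 : x = a / lq + 2 * ln eps^-1 / lq by rewrite /x mulrDl.
  lra.
have [|k [hst hk hl]] := hcpl eps heps n.
  rewrite -ler_pdivlMl//.
  have ce : 0 < E^-1 * (c5 * eps ^+ 2) by rewrite !mulr_gt0 ?invr_gt0 ?exprn_gt0.
  rewrite -ler_ln ?posrE ?exprn_gt0// lnXn//.
  have -> : E^-1 * (c5 * eps ^+ 2) = (E / c5 * eps^-1 ^+ 2)^-1.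
    by field; rewrite !gt_eqF.
  rewrite lnV ?posrE ?mulr_gt0 ?exprn_gt0 ?invr_gt0 ?divr_gt0//.
  rewrite lnM ?posrE ?exprn_gt0 ?invr_gt0 ?divr_gt0// lnXn ?invr_gt0//.
  have lqE : ln q = - lq by rewrite /lq lnV ?posrE// opprK.
  rewrite lqE mulNrn lerN2 -[lq *+ n]mulr_natr -[ln eps^-1 *+ 2]mulr_natl.
  have h1 : ln (E / c5) <= a by exact: ler_norm.
  have h2 : a + 2 * ln eps^-1 < lq * n%:R by rewrite [ltRHS]mulrC -ltr_pdivrMr.
  lra.
exists k; split=> //.
have h := total_calls_le (P := P) (t := t) (k := k) (n := n + 1) (calls_A_7 P t w).
apply: (@le_trans _ _ (k.+1 * (7 * (n + 1).+1))%:R); first by rewrite ler_nat h.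
rewrite !natrM -addnS.
rewrite [leRHS](_ : _ = (K0 + 1) * eps ^- 2 * (7 * (c6 * ln eps^-1))); last by ring.
by rewrite !ler_pM//; rewrite -natr1; lra.
Qed.
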